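(* Let $Q$ be the double of a finite quiver and assume that the dimension vector $\alpha\in\Sigma_0$ is indivisible. Then the GIT fan in $\Theta$ for the action of $G(\alpha)$ on $\mu^{-1}(0)$ equals the fan given by the hyperplane arrangement $$\mathcal{A}_\alpha=\{\beta^\perp\cap\alpha^\perp\mid \alpha=\beta+(\alpha-\beta)\text{ is a decomposition into two roots in }R^+\}.$$
   Context: Let $\Bbbk$ be an algebraically closed field of characteristic zero. $Q$ has vertex set $Q_0$, arrows in opposite pairs $a,a^*$, and a sign function $\epsilon\colon Q_1\to\{\pm1\}$ with $\epsilon(a^* )=-\epsilon(a)$. For $\alpha\in\mathbb{N}^{Q_0}$, $\mathrm{Rep}(Q,\alpha)=\bigoplus_{a\in Q_1}\mathrm{Hom}(\Bbbk^{\alpha_{\mathrm{tl}(a)}},\Bbbk^{\alpha_{\mathrm{hd}(a)}})$ carries the conjugation action of $G(\alpha)=(\prod_i\mathrm{GL}(\alpha_i))/\Bbbk^\times$, with moment map $\mu(B)=\big(\sum_{\mathrm{hd}(a)=i}\epsilon(a)B_aB_{a^*}\big)_i$. ($\alpha$ is not required to come from a framing, i.e. no component of $\alpha$ need be $1$.) $\Theta=\{\theta\in\mathrm{Hom}(\mathbb{Z}^{Q_0},\mathbb{Q}):\theta(\alpha)=0\}=\alpha^\perp$, identified with rational characters via $\chi_\theta(g)=\prod_i\det(g_i)^{\theta_i}$. For $\gamma\in\mathbb{Z}^{Q_0}$, $\gamma^\perp=\{\theta\in\mathrm{Hom}(\mathbb{Z}^{Q_0},\mathbb{Q}):\theta(\gamma)=0\}$.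 The GIT fan: $\theta,\theta'\in\Theta$ are GIT-equivalent if the $\chi_\theta$- and $\chi_{\theta'}$-semistable loci in $\mu^{-1}(0)$ coincide; the equivalence classes are the relative interiors of the cones of the GIT fan. The fan given by $\mathcal{A}_\alpha$ is the complete fan of closed cones of the polyhedral decomposition of $\Theta$ cut out by the hyperplanes in $\mathcal{A}_\alpha$. Roots. Let $\langle\beta,\gamma\rangle=\sum_i\beta_i\gamma_i-\sum_{\epsilon(a)=1}\beta_{\mathrm{tl}(a)}\gamma_{\mathrm{hd}(a)}$, $(\cdot,\cdot)$ its symmetrisation, $p(\gamma)=1-\frac12(\gamma,\gamma)$. $R\subset\mathbb{Z}^{Q_0}$ is the associated (Kac) root system: real roots are the images of the $e_i$ ($i$ loop-free) under the group generated by reflections at loop-free vertices; imaginary roots are $\pm$ the images under this group of nonzero vectors in $\mathbb{N}^{Q_0}$ with connected support having nonpositive pairing $(\cdot,e_i)$ with all $e_i$. $R^+=R\cap\mathbb{Z}_{\ge0}^{Q_0}$. $\Sigma_0$ is the set of $\gamma\in R^+$ with $p(\gamma)>p(\beta^{(1)})+\cdots+p(\beta^{(k)})$ for every proper decomposition $\gamma=\beta^{(1)}+\cdots+\beta^{(k)}$ with all $\beta^{(i)}\in R^+$. *)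

(* Defs.v *)
From HB Require Import structures.
From mathcomp Require Import all_boot all_order all_algebra.
From mathcomp Require Import boolp classical_sets.
From mathcomp Require Import mpoly.

Set Implicit Arguments.
Unset Strict Implicit.
Unset Printing Implicit Defensive.

Import Order.TTheory GRing.Theory Num.Theory.
Local Open Scope classical_set_scope.
Local Open Scope ring_scope.

(* The double of a finite quiver. [arrow i j] is the finite set of arrows with
   tail i and head j; [star] is the pairing a <-> a^*, and [sgn] is epsilon.
   The sign condition forces a^* != a, also for loops, so that the quiver is
   the double of its subquiver of arrows of sign 1. *)
Record double_quiver : Type := DoubleQuiver {
  vertex :> finType;
  arrow : vertex -> vertex -> finType;
  star : forall i j : vertex, arrow i j -> arrow j i;
  sgn : forall i j : vertex, arrow i j -> int;
  starK : forall (i j : vertex) (a : arrow i j), star (star a) = a;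
  sgn_pm1 : forall (i j : vertex) (a : arrow i j), sgn a = 1 \/ sgn a = -1;
  sgn_star : forall (i j : vertex) (a : arrow i j), sgn (star a) = - sgn a }.

Arguments arrow {Q} i j : rename.
Arguments star {Q i j} a : rename.
Arguments sgn {Q i j} a : rename.

Section Roots.
Variable Q : double_quiver.

Implicit Types (beta gamma delta : {ffun Q -> int}) (i j : Q).

Definition unit_vec i : {ffun Q -> int} := [ffun j => (j == i)%:Z].

Definition euler beta gamma : int :=
  \sum_i beta i * gamma i
  - \sum_i \sum_j \sum_(a : arrow i j | sgn a == 1) beta i * gamma j.

Definition sym_form beta gamma : int := euler beta gamma + euler gamma beta.

Definition p_fun gamma : rat := 1 - 2%:R^-1 * (sym_form gamma gamma)%:~R.

Definition loop_free i : bool := #|arrow i i| == 0%N.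

Definition reflection i gamma : {ffun Q -> int} :=
  [ffun j => gamma j - sym_form gamma (unit_vec i) * unit_vec i j].

(* [delta] is in the orbit of [gamma] under the group generated by the
   reflections at loop-free vertices; as these are involutions, every element
   of that group is a word in them. *)
Definition weyl_conj gamma delta : Prop :=
  exists2 w : seq Q, all loop_free w & delta = foldr reflection gamma w.

Definition real_root gamma : Prop :=
  exists2 i, loop_free i & weyl_conj (unit_vec i) gamma.

Definition connected_support gamma : Prop :=
  forall i j, gamma i != 0 -> gamma j != 0 ->
    connect [rel u v | [&& gamma u != 0, gamma v != 0 & (0 < #|arrow u v|)%N]]
      i j.

Definition fundamental gamma : Prop :=
  [/\ gamma <> 0, forall i, 0 <= gamma i, connected_support gamma
    & forall i, sym_form gamma (unit_vec i) <= 0].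

Definition imaginary_root gamma : Prop :=
  exists2 delta, fundamental delta
    & weyl_conj delta gamma \/ weyl_conj delta (- gamma).

Definition is_root gamma : Prop := real_root gamma \/ imaginary_root gamma.

Definition pos_root gamma : Prop := is_root gamma /\ (forall i, 0 <= gamma i).

Definition Sigma0 gamma : Prop :=
  pos_root gamma /\
  forall s : seq {ffun Q -> int}, (1 < size s)%N ->
    (forall beta, beta \in s -> pos_root beta) ->
    gamma = \sum_(beta <- s) beta ->
    \sum_(beta <- s) p_fun beta < p_fun gamma.

End Roots.

Section DimensionVector.
Variables (Q : double_quiver) (alpha : Q -> nat).

Definition dim_vector : {ffun Q -> int} := [ffun i => (alpha i)%:Z].

Definition indivisible : Prop :=
  forall (m : nat) (beta : Q -> nat),
    (forall i, alpha i = m * beta i)%N -> m = 1%N.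

End DimensionVector.

Section Representations.
Variables (k : fieldType) (Q : double_quiver) (alpha : Q -> nat).

(* Hom(k^m, k^n) is 'M_(n, m), acting on column vectors. *)
Definition rep : Type :=
  forall i j : Q, arrow i j -> 'M[k]_(alpha j, alpha i).

Definition moment (B : rep) (i : Q) : 'M[k]_(alpha i) :=
  \sum_j \sum_(a : arrow j i) (sgn a)%:~R *: (B j i a *m B i j (star a)).

Definition moment_fibre : set rep := [set B | forall i, moment B i = 0].

Definition act (g : forall i : Q, 'M[k]_(alpha i)) (B : rep) : rep :=
  fun i j a => g j *m B i j a *m invmx (g i).

Definition chi (m : Q -> int) (g : forall i : Q, 'M[k]_(alpha i)) : k :=
  \prod_i (\det (g i)) ^ (m i).

Definition coordinate : finType :=
  {i : Q & {j : Q & (arrow i j * 'I_(alpha j) * 'I_(alpha i))%type}}.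

Definition rep_coord (B : rep) (c : coordinate) : k :=
  let: existT i (existT j (a, r, s)) := c in B i j a r s.

Definition eval_rep (f : {mpoly k[#|coordinate|]}) (B : rep) : k :=
  f.@[fun n => rep_coord B (enum_val n)].

(* Elements of G(alpha) = (\prod_i GL(alpha_i)) / k^* are represented by tuples
   of invertible matrices: the scalars k^* act trivially on representations,
   and chi m is trivial on them when m(alpha) = 0. Functions on the closed
   subset mu^-1(0) are restrictions of polynomials on Rep(Q, alpha). *)
Definition semi_invariant (m : Q -> int) (f : {mpoly k[#|coordinate|]}) :
    Prop :=
  forall (g : forall i : Q, 'M[k]_(alpha i)) (B : rep),
    (forall i, g i \in unitmx) -> moment_fibre B ->
    eval_rep f (act g B) = chi m g * eval_rep f B.

(* For rational theta, a positive multiple n theta = m is an integral weight. *)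
Definition semistable (theta : {ffun Q -> rat}) : set rep :=
  [set B | moment_fibre B /\
    exists (n : nat) (m : Q -> int) (f : {mpoly k[#|coordinate|]}),
      [/\ (0 < n)%N, forall i, (m i)%:~R = n%:R * theta i,
          semi_invariant m f & eval_rep f B != 0]].

End Representations.

Section Cones.
Variable I : finType.
Implicit Types (theta : {ffun I -> rat}) (gamma : {ffun I -> int}).
Implicit Types (sigma Theta : set {ffun I -> rat}).

(* Hom(Z^I, Q) is identified with Q^I by theta |-> (theta(e_i))_i. *)
Definition pairing theta gamma : rat := \sum_i theta i * (gamma i)%:~R.

Definition perp gamma : set {ffun I -> rat} :=
  [set theta | pairing theta gamma = 0].

Definition polyhedral_cone Theta sigma : Prop :=
  exists s : seq {ffun I -> int},
    sigma = Theta `&`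
      [set theta | forall gamma, gamma \in s -> 0 <= pairing theta gamma].

Definition affine_hull sigma : set {ffun I -> rat} :=
  [set theta | exists (n : nat) (c : 'I_n -> rat)
      (v : 'I_n -> {ffun I -> rat}),
    [/\ forall r, sigma (v r), \sum_r c r = 1
      & forall i, theta i = \sum_r c r * v r i]].

Definition relint sigma : set {ffun I -> rat} :=
  [set theta | sigma theta /\
    exists2 eps : rat, 0 < eps & forall theta', affine_hull sigma theta' ->
      (forall i, `|theta' i - theta i| < eps) -> sigma theta'].

(* The closed cones of the polyhedral decomposition of [Theta] cut out by the
   arrangement [A]: the cone containing theta0 in its relative interior is the
   intersection of all closed half-spaces of [Theta] that contain theta0 and
   are bounded by a member of [A]. As gamma and - gamma define the same
   hyperplane, a hyperplane through theta0 contributes both its half-spaces. *)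
Definition arrangement_fan Theta (A : set (set {ffun I -> rat})) :
    set (set {ffun I -> rat}) :=
  [set sigma | exists2 theta0, Theta theta0 &
    sigma = Theta `&` [set theta | forall gamma, A (perp gamma `&` Theta) ->
      0 <= pairing theta0 gamma -> 0 <= pairing theta gamma]].

End Cones.

Section GITFan.
Variables (k : fieldType) (Q : double_quiver) (alpha : Q -> nat).

Definition stability_space : set {ffun Q -> rat} := perp (dim_vector alpha).

Definition git_class (C : set {ffun Q -> rat}) : Prop :=
  exists2 theta0, stability_space theta0 &
    C = [set theta | stability_space theta /\
                     semistable theta
                     = semistable theta0 :> set (rep k alpha)].

Definition git_fan : set (set {ffun Q -> rat}) :=
  [set sigma | polyhedral_cone stability_space sigma
               /\ git_class (relint sigma)].

Definition root_arrangement : set (set {ffun Q -> rat}) :=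
  [set H | exists beta : {ffun Q -> int},
    [/\ pos_root beta, pos_root (dim_vector alpha - beta)
      & H = perp beta `&` stability_space]].

End GITFan.

(* Main.v *)
(* By King's criterion, [B] is semistable iff [theta] is nonnegative on the
   dimension vectors of all subrepresentations of [B]. Necessity is a
   one-parameter subgroup argument. For sufficiency, the criterion says that a
   space of matrices built from identities and from the arrows of [B] has no
   shrunk subspace; a blow-up of such a space then contains an invertible
   matrix (a regularity argument with a cyclic division algebra), and its
   determinant is a semi-invariant that does not vanish at [B].

   For alpha in Sigma_0 indivisible, (beta, alpha - beta) < 0 whenever
   0 < beta < alpha. The factors of a Jordan-Hoelder filtration by stable
   representations have positive roots as dimension vectors (reflection
   functors and a deformation of [theta]); summands with negative pairing merge
   to a root, so the class of any destabilising subrepresentation can be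
   replaced by one summand of a decomposition of alpha into two positive roots.
   Hence semistability of dimension alpha only depends on the face of the
   arrangement. Conversely, if the signs of [t] and [t'] differ on such a root,
   one moves from [t] to [t'] and uses nonsplit extensions, which exist because
   the pairing is negative, to produce a representation that is semistable for
   one of the two only. *)
From HB Require Import structures.
Require Import Defs.
From mathcomp Require Import all_boot all_order all_algebra.
From mathcomp Require Import boolp classical_sets mpoly.
From mathcomp Require Import perm cyclic separable cyclotomic.
From mathcomp Require Import ring lra zify.

Set Implicit Arguments.
Unset Strict Implicit.
Unset Printing Implicit Defensive.

Import Order.TTheory GRing.Theory Num.Theory.
Local Open Scope ring_scope.

(** * Roots and reflections *)

(** Semistability depends on a representation only through the dimension vectors of its
    subrepresentations, so each construction (subquotient, reflection, extension) is recorded by its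
    effect on that set. The combinatorial input is Kac's identity for [(b, a - b)]: for dominant [a]
    a nonnegative value forces [b] to be proportional to [a], and this is where [Sigma0] and
    indivisibility enter. One extension argument then serves twice: at the weight 0 it produces
    semistable representations for fundamental dimension vectors, and at a wall it produces the
    representation that separates the two sides. Reflection at [j] requires [t j != 0], since the
    sign of [t j] decides between kernel and cokernel; hence the perturbations inside a hyperplane.
    For semi-invariants, [c - m i] copies of the space at [i] on one side and [c] copies on the
    other give a square matrix whose determinant has weight [m]. A matrix space without shrunk
    subspace may still consist of singular matrices; this is why coefficients become matrices of
    size [d], which turns the weight into [d m]. *)

Section RootCombinatorics.
Variable Q : double_quiver.
Implicit Types (b c d : {ffun Q -> int}) (i j : Q).
Local Notation e_ i := (unit_vec i).

Lemma card_arrowC i j : #|arrow i j| = #|arrow j i|.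
Proof.
have inj u v : injective (@star Q u v) by apply: (can_inj (@starK Q u v)).
apply/eqP; rewrite eqn_leq; apply/andP; split.
  exact: (leq_card _ (inj i j)).
exact: (leq_card _ (inj j i)).
Qed.

(** [star] matches the arrows of sign -1 from [i] to [j] with those of sign 1 from [j] to [i]. This
    turns the symmetrised Euler form, defined with half of the arrows, into a sum over all of
    them. *)
Lemma card_arrow_sgn i j :
  #|arrow i j| = (#|[pred a : arrow i j | sgn a == 1]|
                 + #|[pred a : arrow j i | sgn a == 1]|)%N.
Proof.
have bij : bijective (@star Q i j).
  by exists (@star Q j i); [exact: (@starK Q i j)|exact: (@starK Q j i)].
rewrite -(cardC [pred a : arrow i j | sgn a == 1]); congr addn.
rewrite -(on_card_preimset (f := @star Q i j)
    (R := [pred a : arrow j i | sgn a == 1])); last exact: onW_bij.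
apply: eq_card => a; rewrite !inE sgn_star.
by case: (sgn_pm1 a) => ->.
Qed.

Lemma sym_formE b c :
  sym_form b c = 2 * (\sum_i b i * c i)
    - \sum_i \sum_j #|arrow i j|%:Z * (b i * c j).
Proof.
have E x y : euler x y = \sum_i x i * y i -
    \sum_i \sum_j #|[pred a : arrow i j | sgn a == 1]|%:Z * (x i * y j).
  rewrite /euler; congr (_ - _); apply: eq_bigr => i _; apply: eq_bigr => j _.
  by rewrite sumr_const -mulr_natl natz.
rewrite /sym_form !E.
rewrite [X in _ + (_ - X)]exchange_big /=.
rewrite [X in _ + (X - _)](eq_bigr (fun i => b i * c i)); last first.
  by move=> i _; rewrite mulrC.
have -> : \sum_i \sum_j #|arrow i j|%:Z * (b i * c j) =
  (\sum_i \sum_j #|[pred a : arrow i j | sgn a == 1]|%:Z * (b i * c j)) +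
  (\sum_i \sum_j #|[pred a : arrow j i | sgn a == 1]|%:Z * (c j * b i)).
  rewrite -big_split; apply: eq_bigr => i _; rewrite -big_split.
  apply: eq_bigr => j _ /=; rewrite card_arrow_sgn PoszD; ring.
ring.
Qed.

Lemma sym_formC b c : sym_form b c = sym_form c b.
Proof. by rewrite /sym_form addrC. Qed.

Lemma sym_formDl b c d : sym_form (b + c) d = sym_form b d + sym_form c d.
Proof.
rewrite !sym_formE.
have -> : \sum_i (b + c) i * d i = \sum_i b i * d i + \sum_i c i * d i.
  by rewrite -big_split; apply: eq_bigr => i _; rewrite ffunE mulrDl.
have -> : \sum_i \sum_j #|arrow i j|%:Z * ((b + c) i * d j) =
  \sum_i \sum_j #|arrow i j|%:Z * (b i * d j) +
  \sum_i \sum_j #|arrow i j|%:Z * (c i * d j).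
  rewrite -big_split; apply: eq_bigr => i _; rewrite -big_split.
  by apply: eq_bigr => j _; rewrite ffunE mulrDl mulrDr.
ring.
Qed.

Lemma sym_form0l d : sym_form 0 d = 0.
Proof. by apply: (addrI (sym_form 0 d)); rewrite -sym_formDl !addr0. Qed.

Lemma sym_formNl b d : sym_form (- b) d = - sym_form b d.
Proof. by apply: (addrI (sym_form b d)); rewrite -sym_formDl !subrr sym_form0l. Qed.

Lemma sym_formDr b c d : sym_form d (b + c) = sym_form d b + sym_form d c.
Proof. by rewrite !(sym_formC d) sym_formDl. Qed.

Lemma sym_formNr b d : sym_form d (- b) = - sym_form d b.
Proof. by rewrite !(sym_formC d) sym_formNl. Qed.

Lemma sym_form_suml (I : Type) (r : seq I) (F : I -> {ffun Q -> int}) d :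
  sym_form (\sum_(x <- r) F x) d = \sum_(x <- r) sym_form (F x) d.
Proof.
elim: r => [|x r IH]; first by rewrite !big_nil sym_form0l.
by rewrite !big_cons sym_formDl IH.
Qed.

Definition scale_vec (m : int) b : {ffun Q -> int} := [ffun i => m * b i].

Lemma sym_formZl m b d : sym_form (scale_vec m b) d = m * sym_form b d.
Proof.
rewrite !sym_formE mulrBr [m * (2 * _)]mulrCA !mulr_sumr.
congr (_ - _); apply: eq_bigr => i _; first by rewrite ffunE; ring.
by rewrite mulr_sumr; apply: eq_bigr => j _; rewrite ffunE; ring.
Qed.

Lemma sym_formZr m b d : sym_form d (scale_vec m b) = m * sym_form d b.
Proof. by rewrite sym_formC sym_formZl sym_formC. Qed.

Lemma reflectionE j b : reflection j b = b - scale_vec (sym_form b (e_ j)) (e_ j).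
Proof. by apply/ffunP => i; rewrite !ffunE. Qed.

Lemma sym_form_unitl i c : sym_form (e_ i) c =
  2 * c i - \sum_j #|arrow i j|%:Z * c j.
Proof.
rewrite sym_formE (bigD1 i) //= big1 ?addr0; last first.
  by move=> l /negPf hl; rewrite ffunE hl mul0r.
rewrite ffunE eqxx mul1r; congr (_ - _).
rewrite (bigD1 i) //= [X in _ + X]big1 ?addr0; last first.
  by move=> l /negPf hl; rewrite big1 // => j _; rewrite ffunE hl mul0r mulr0.
by apply: eq_bigr => j _; rewrite ffunE eqxx mul1r.
Qed.

Lemma sym_form_unit i j : sym_form (e_ i) (e_ j) =
  (i == j)%:Z *+ 2 - #|arrow i j|%:Z.
Proof.
rewrite sym_form_unitl ffunE (bigD1 j) //= big1 ?addr0; last first.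
  by move=> l /negPf hl; rewrite ffunE hl mulr0.
by rewrite ffunE eqxx mulr1 mulr_natl.
Qed.

Lemma sym_form_unit_sum b c : sym_form b c = \sum_i b i * sym_form (e_ i) c.
Proof.
rewrite sym_formE mulr_sumr -sumrB; apply: eq_bigr => i _.
rewrite sym_form_unitl mulrBr mulr_sumr; congr (_ - _); first by ring.
by apply: eq_bigr => j _; ring.
Qed.

Lemma loop_free_self j : loop_free j -> sym_form (e_ j) (e_ j) = 2.
Proof. by move=> /eqP h; rewrite sym_form_unit h eqxx subr0. Qed.

(** The sign rule makes [star a] a loop different from [a], so a vertex with a loop has at least two
    of them. *)
Lemma loopy_self j : ~~ loop_free j -> sym_form (e_ j) (e_ j) <= 0.
Proof.
rewrite /loop_free sym_form_unit eqxx => h.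
have : (1 < #|arrow j j|)%N.
  have /card_gt0P[a _] : (0 < #|arrow j j|)%N by rewrite lt0n.
  apply/card_gt1P; exists a, (star a); split=> //.
  apply/eqP => E; have := sgn_star a; rewrite -E.
  by case: (sgn_pm1 a) => ->.
lia.
Qed.

Lemma sym_form_unit_neq i j : i != j -> sym_form (e_ i) (e_ j) <= 0.
Proof. move=> /negPf h; rewrite sym_form_unit h; lia. Qed.

(** Vertices with loops never obstruct membership in the fundamental region; only reflections at
    loop-free vertices have to be examined. *)
Lemma sym_form_loopy j b :
  (forall i, 0 <= b i) -> ~~ loop_free j -> sym_form b (e_ j) <= 0.
Proof.
move=> hb hj; rewrite sym_form_unit_sum sumr_le0 // => i _.
rewrite mulr_ge0_le0 //.
by have [->|ne] := eqVneq i j; [exact: loopy_self|exact: sym_form_unit_neq].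
Qed.

Lemma reflectionK j : loop_free j -> involutive (@reflection Q j).
Proof.
move=> hj b; rewrite !reflectionE sym_formDl sym_formNl sym_formZl loop_free_self //.
by apply/ffunP => i; rewrite !ffunE; ring.
Qed.

Lemma reflection_isometry j b c : loop_free j ->
  sym_form (reflection j b) (reflection j c) = sym_form b c.
Proof.
move=> hj; rewrite !reflectionE !(sym_formDl, sym_formDr, sym_formNl, sym_formNr).
rewrite !(sym_formZl, sym_formZr) loop_free_self //.
by rewrite (sym_formC (e_ j) c); ring.
Qed.

Lemma reflectionD j b c : reflection j (b + c) = reflection j b + reflection j c.
Proof. by apply/ffunP => i; rewrite !ffunE sym_formDl; ring. Qed.

Lemma reflectionN j b : reflection j (- b) = - reflection j b.
Proof. by apply/ffunP => i; rewrite !ffunE sym_formNl; ring. Qed.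

Lemma reflection0 j : reflection j (0 : {ffun Q -> int}) = 0.
Proof. by apply/ffunP => i; rewrite !ffunE sym_form0l mul0r subr0. Qed.

Lemma reflection_neq i j b : i != j -> reflection j b i = b i.
Proof. by move=> /negPf h; rewrite !ffunE h mulr0 subr0. Qed.

Lemma reflection_at j b : loop_free j ->
  reflection j b j = \sum_i #|arrow i j|%:Z * b i - b j.
Proof.
move=> hj; rewrite !ffunE eqxx mulr1 sym_formC sym_form_unitl.
under [X in _ = X - _]eq_bigr do rewrite card_arrowC.
by ring.
Qed.

Lemma reflection_self j : loop_free j -> reflection j (e_ j) = - e_ j.
Proof. by move=> hj; apply/ffunP => i; rewrite !ffunE loop_free_self //; ring. Qed.

Lemma weyl_conj_cons j b c : loop_free j -> weyl_conj b c -> weyl_conj b (reflection j c).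
Proof. by move=> hj [w hw ->]; exists (j :: w) => //=; rewrite hj. Qed.

Lemma weyl_conj_isometry b c : weyl_conj b c -> sym_form c c = sym_form b b.
Proof.
case=> w + ->; elim: w => //= j w IH /andP[hj /IH <-].
exact: reflection_isometry.
Qed.

Lemma is_root_reflection j b : loop_free j -> is_root b -> is_root (reflection j b).
Proof.
move=> hj [[i hi h]|[d hd [h|h]]].
- by left; exists i => //; apply: weyl_conj_cons.
- by right; exists d => //; left; apply: weyl_conj_cons.
- by right; exists d => //; right; rewrite -reflectionN; apply: weyl_conj_cons.
Qed.

Lemma fundamental_sym_le0 b : fundamental b -> sym_form b b <= 0.
Proof.
case=> _ pos _ h; rewrite sym_form_unit_sum sumr_le0 // => i _.
by rewrite mulr_ge0_le0 // sym_formC.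
Qed.

(** The norm is invariant under reflections: 2 on orbits of loop-free unit vectors, at most 0 on
    orbits of the fundamental region. This later excludes multiples of [e_ j] other than itself. *)
Lemma is_root_sym b : is_root b -> sym_form b b = 2 \/ sym_form b b <= 0.
Proof.
case=> [[i hi /weyl_conj_isometry ->]|[d /fundamental_sym_le0 hd [] /weyl_conj_isometry]].
- by left; exact: loop_free_self.
- by move->; right.
- by rewrite sym_formNl sym_formNr opprK => ->; right.
Qed.

Lemma fundamental_root b : fundamental b -> pos_root b.
Proof.
move=> hb; split; last by case: hb.
by right; exists b => //; left; exists [::].
Qed.

Lemma unit_root j : loop_free j -> pos_root (e_ j).
Proof.
move=> hj; split; last by move=> i; rewrite ffunE.
by left; exists j => //; exists [::].
Qed.

Lemma p_funE b : p_fun b = 1 - (sym_form b b)%:~R / 2%:R.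
Proof. by rewrite /p_fun mulrC. Qed.

End RootCombinatorics.

(** * Weights, perturbations and finite boxes of vectors *)

Section Pairing.
Variable I : finType.
Implicit Types (t h : {ffun I -> rat}) (b c : {ffun I -> int}).

Lemma pairingDr t b c : pairing t (b + c) = pairing t b + pairing t c.
Proof.
rewrite /pairing -big_split; apply: eq_bigr => i _.
by rewrite ffunE intrD mulrDr.
Qed.

Lemma pairing0r t : pairing t 0 = 0.
Proof. by rewrite /pairing big1 // => i _; rewrite ffunE mulr0. Qed.

Lemma pairingNr t b : pairing t (- b) = - pairing t b.
Proof. by apply: (addrI (pairing t b)); rewrite -pairingDr !subrr pairing0r. Qed.

Lemma pairingDl t h b : pairing (t + h) b = pairing t b + pairing h b.
Proof.
rewrite /pairing -big_split; apply: eq_bigr => i _.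
by rewrite ffunE mulrDl.
Qed.

Definition scale_weight (x : rat) t : {ffun I -> rat} := [ffun i => x * t i].

Lemma pairingZl x t b : pairing (scale_weight x t) b = x * pairing t b.
Proof.
rewrite /pairing mulr_sumr; apply: eq_bigr => i _; rewrite ffunE; ring.
Qed.

Definition segment t h (x : rat) : {ffun I -> rat} :=
  [ffun i => (1 - x) * t i + x * h i].

Lemma pairing_segment t h x b :
  pairing (segment t h x) b = (1 - x) * pairing t b + x * pairing h b.
Proof.
rewrite /pairing !mulr_sumr -big_split; apply: eq_bigr => i _.
by rewrite ffunE /=; ring.
Qed.

Lemma pairing0l b : pairing 0 b = 0.
Proof. by rewrite /pairing big1 // => i _; rewrite ffunE mul0r. Qed.

Lemma pairing_sumr (J : Type) (r : seq J) t (F : J -> {ffun I -> int}) :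
  pairing t (\sum_(x <- r) F x) = \sum_(x <- r) pairing t (F x).
Proof.
elim: r => [|x r IH]; first by rewrite !big_nil pairing0r.
by rewrite !big_cons pairingDr IH.
Qed.

Lemma common_denominator t :
  exists (n : nat) (m : I -> int), (0 < n)%N /\ forall i, (m i)%:~R = n%:R * t i.
Proof.
exists (\prod_i `|denq (t i)|)%N.
exists (fun i => numq (t i) * (\prod_(l | l != i) `|denq (t l)|)%N%:Z); split.
  by rewrite prodn_gt0 // => i; rewrite absz_gt0 denq_neq0.
move=> i; rewrite [in RHS](bigD1 i) //= natrM intrM -{3}(divq_num_den (t i)).
have -> : `|denq (t i)|%N%:R = (denq (t i))%:~R :> rat.
  by rewrite -[LHS]/(`|denq (t i)|%N%:Z%:~R) gez0_abs ?denq_ge0.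
rewrite [RHS]mulrAC [X in _ = X * _]mulrC divfK ?intr_eq0 ?denq_neq0 //.
Qed.

(* A positive value of [t] on integer vectors is at least one over a common
   denominator, while [h] is bounded on a box. *)
Lemma perturbation t h (N : int) :
  exists2 eps : rat, 0 < eps & forall e b, 0 <= e <= eps ->
    (forall i, `|b i| <= N) -> 0 < pairing t b ->
    0 < pairing (t + scale_weight e h) b.
Proof.
have [n [m [n0 hm]]] := common_denominator t.
pose K := (\sum_i `|h i|) * `|N|%:~R + 1.
have K0 : 0 < K by rewrite ltr_wpDl // mulr_ge0 ?sumr_ge0 // ?ler0z.
have nn0 : (0 : rat) < n%:R by rewrite ltr0n.
exists (n%:R * K)^-1; first by rewrite invr_gt0 mulr_gt0.
move=> e b /andP[e0 e1] hb tb; rewrite pairingDl pairingZl.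
have hK : `|pairing h b| < K.
  rewrite /K ltr_pwDr // (le_trans (ler_norm_sum _ _ _)) // mulr_suml ler_sum // => i _.
  rewrite normrM ler_wpM2l // -intr_norm ler_int.
  by rewrite (le_trans (hb i)) // ler_norm.
have t1 : n%:R^-1 <= pairing t b.
  rewrite -(ler_pM2l nn0) mulfV ?gt_eqF //.
  have E : n%:R * pairing t b = (\sum_i m i * b i)%:~R.
    rewrite /pairing mulr_sumr rmorph_sum; apply: eq_bigr => i _ /=.
    by rewrite intrM hm mulrA.
  move: tb; rewrite -(pmulr_rgt0 _ nn0) E ltr0z => ?.
  by rewrite ler1z -gtz0_ge1.
have : e * `|pairing h b| < n%:R^-1.
  case: (ltgtP e 0) e0 => // [e0 _|-> _]; last by rewrite mul0r invr_gt0.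
  rewrite (@lt_le_trans _ _ (e * K)) ?ltr_pM2l //.
  rewrite (le_trans (ler_wpM2r (ltW K0) e1)) // invfM -mulrA mulVf ?mulr1 //.
  by rewrite gt_eqF.
have := ler_norm (- (e * pairing h b)); rewrite normrN normrM ger0_norm //.
lra.
Qed.

(** Dimension vectors of subrepresentations lie in a finite box, so extremal ones exist even for
    undecidable conditions. Every choice of a most destabilising vector or of a first wall below
    rests on this. *)
Lemma box_max (N : nat) (P : {ffun I -> int} -> Prop) (f : {ffun I -> int} -> rat) :
  (forall b, P b -> forall i, 0 <= b i <= N%:Z) -> (exists b, P b) ->
  exists2 b, P b & forall c, P c -> f c <= f b.
Proof.
move=> hP [b0 hb0].
pose g (x : {ffun I -> 'I_N.+1}) : {ffun I -> int} := [ffun i => (x i)%:Z].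
have lift b : P b -> exists x, b = g x.
  move=> /hP hb; exists [ffun i => inord `|b i|%N]; apply/ffunP => i.
  have /andP[h0 h1] := hb i.
  rewrite !ffunE inordK; last by lia.
  by rewrite gez0_abs.
have [x0 E0] := lift _ hb0.
pose p := [pred x | `[< P (g x) >]].
have p0 : p x0 by apply/asboolP; rewrite -E0.
case: (@arg_maxP _ _ _ x0 p (f \o g) p0) => x /asboolP hx hmax.
exists (g x) => // c hc; have [y E] := lift _ hc.
by rewrite E; apply: hmax; apply/asboolP; rewrite -E.
Qed.

End Pairing.

Section ReflectedWeight.
Variable Q : double_quiver.
Implicit Types (t : {ffun Q -> rat}) (b c : {ffun Q -> int}) (j : Q).
Local Notation e_ i := (unit_vec i).

Lemma pairing_unit t j : pairing t (e_ j) = t j.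
Proof.
rewrite /pairing (bigD1 j) //= big1 ?addr0; last first.
  by move=> i /negPf h; rewrite ffunE h mulr0.
by rewrite ffunE eqxx mulr1.
Qed.

Lemma pairing_scale_vec t m b : pairing t (scale_vec m b) = m%:~R * pairing t b.
Proof.
rewrite /pairing mulr_sumr; apply: eq_bigr => i _.
by rewrite ffunE intrM; ring.
Qed.

(** The contragredient action on weights: the transpose of [reflection j]. *)
Definition reflect_weight j t : {ffun Q -> rat} :=
  [ffun i => t i - (sym_form (e_ i) (e_ j))%:~R * t j].

Lemma pairing_reflect j t b :
  pairing (reflect_weight j t) b = pairing t (reflection j b).
Proof.
rewrite reflectionE pairingDr pairingNr pairing_scale_vec pairing_unit.
rewrite sym_form_unit_sum rmorph_sum mulr_suml /pairing -sumrB.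
by apply: eq_bigr => i _; rewrite ffunE /= intrM; ring.
Qed.

Lemma reflect_weight_at j t : loop_free j -> reflect_weight j t j = - t j.
Proof. by move=> hj; rewrite ffunE loop_free_self //; ring. Qed.

Lemma reflect_weightK j t : loop_free j ->
  reflect_weight j (reflect_weight j t) = t.
Proof.
by move=> hj; apply/ffunP => i; rewrite ffunE reflect_weight_at // ffunE; ring.
Qed.

End ReflectedWeight.

Section KacIdentity.
Variable Q : double_quiver.
Implicit Types (a b : {ffun Q -> int}) (i j : Q).
Local Notation e_ i := (unit_vec i).

(* With [x i = b i / a i], the form [(b, a - b)] equals
   [\sum_i (a, e_i) a_i x_i (1 - x_i)
    + 1/2 \sum_(i, j) (e_i, e_j) a_i a_j (x_i - x_j)^2]. *)
Lemma kac_identity a b :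
  (forall i, 0 <= b i <= a i) -> connected_support a ->
  (forall i, sym_form a (e_ i) <= 0) ->
  0 <= sym_form b (a - b) -> forall i j, b i * a j = b j * a i.
Proof.
move=> hab con neg hs.
(* Where [a i = 0] the bounds give [b i = 0], and division by zero returns 0, so [b i = x i * a i]
   holds at every vertex. *)
pose x i : rat := (b i)%:~R / (a i)%:~R.
pose A i : rat := (a i)%:~R.
pose g i j : rat := (sym_form (e_ i) (e_ j))%:~R.
have A0 i : 0 <= A i by rewrite ler0z; case/andP: (hab i) => /le_trans h /h.
have bE i : (b i)%:~R = x i * A i.
  rewrite /x /A; have [a0|a0] := eqVneq (a i) 0.
    by have := hab i; rewrite a0 -eq_le => /eqP <-; rewrite mulr0.
  by rewrite divfK ?intr_eq0.
have x01 i : 0 <= x i <= 1.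
  have /andP[h0 h1] := hab i; have aa := A0 i.
  rewrite divr_ge0 ?ler0z //=; last by rewrite -(ler0z rat).
  have [a0|a0] := eqVneq (a i) 0; first by rewrite /x a0 invr0 mulr0.
  by rewrite ler_pdivrMr ?mul1r ?ler_int // ltr0z lt_def a0 -(ler0z rat).
have gC i j : g i j = g j i by rewrite /g sym_formC.
have formE c d : (sym_form c d)%:~R =
    \sum_i \sum_j g i j * ((c i)%:~R * (d j)%:~R) :> rat.
  rewrite sym_form_unit_sum rmorph_sum; apply: eq_bigr => i _ /=.
  rewrite intrM sym_formC sym_form_unit_sum rmorph_sum mulr_sumr.
  by apply: eq_bigr => j _; rewrite /= intrM -/(g j i) gC; ring.
have sq_le0 i j : g i j * (A i * A j * (x i - x j) ^+ 2) <= 0.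
  have [<-|ne] := eqVneq i j; first by rewrite subrr expr0n !mulr0.
  apply: mulr_le0_ge0; first by rewrite lerz0 sym_form_unit_neq.
  by rewrite mulr_ge0 ?sqr_ge0 // mulr_ge0.
have E : (sym_form b (a - b))%:~R =
    \sum_i A i * (x i * (1 - x i)) * (sym_form a (e_ i))%:~R +
    2^-1 * \sum_i \sum_j g i j * (A i * A j * (x i - x j) ^+ 2).
  pose F i j := g i j * (A i * A j * (x i - x i * x i)).
  have EF : \sum_i A i * (x i * (1 - x i)) * (sym_form a (e_ i))%:~R =
      \sum_i \sum_j F i j.
    apply: eq_bigr => i _; rewrite sym_form_unit_sum rmorph_sum mulr_sumr.
    by apply: eq_bigr => j _; rewrite /F /= intrM -/(g j i) gC -/(A j); ring.
  pose G i j := g i j * (A i * A j * (x i - x i * x j)).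
  have EG : (sym_form b (a - b))%:~R = \sum_i \sum_j G i j.
    rewrite formE; apply: eq_bigr => i _; apply: eq_bigr => j _.
    by rewrite !ffunE intrB !bE -/(A j) /G; ring.
  rewrite EG EF.
  (* After doubling, one copy of each double sum is transposed; the identity then holds term by
     term, because [F i j + F j i] plus the square term at [(i, j)] equals [G i j + G j i]. *)
  apply: (mulfI (x := 2)) => //; rewrite mulrDr mulrA mulfV // mul1r !mulr_natl !mulr2n.
  rewrite [X in _ + X = _]exchange_big [X in _ = _ + X + _]exchange_big /=.
  rewrite -!big_split; apply: eq_bigr => i _ /=.
  rewrite -!big_split; apply: eq_bigr => j _ /=.
  by rewrite /F /G gC; ring.
have first_le0 : \sum_i A i * (x i * (1 - x i)) * (sym_form a (e_ i))%:~R <= 0.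
  rewrite sumr_le0 // => i _; have /andP[h0 h1] := x01 i.
  apply: mulr_ge0_le0; last by rewrite lerz0.
  by rewrite mulr_ge0 // mulr_ge0 // subr_ge0.
(* Both sums of the identity are at most 0 and their total is at least 0, so the sum of squares
   vanishes; an arrow joining two vertices of the support then forces [x i = x j]. *)
have sum0 : \sum_i \sum_j - (g i j * (A i * A j * (x i - x j) ^+ 2)) = 0.
  apply: le_anti; rewrite sumr_ge0 ?andbT; last first.
    by move=> i _; rewrite sumr_ge0 // => j _; rewrite oppr_ge0.
  under eq_bigr do rewrite sumrN.
  by move: hs; rewrite sumrN -(ler0z rat) E; lra.
have adj i j : a i != 0 -> a j != 0 -> (0 < #|arrow i j|)%N -> x i = x j.
  move=> ai aj hij; have [->//|ne] := eqVneq i j.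
  have := sum0; move/eqP; rewrite psumr_eq0; last first.
    by move=> l _; rewrite sumr_ge0 // => m _; rewrite oppr_ge0.
  move/allP/(_ i (mem_index_enum _)) => /=; rewrite psumr_eq0; last first.
    by move=> m _; rewrite oppr_ge0.
  move/allP/(_ j (mem_index_enum _)) => /=.
  rewrite oppr_eq0 !mulf_eq0 !intr_eq0 (negPf ai) (negPf aj) /= orbb subr_eq0.
  case/orP=> [|/eqP//]; rewrite sym_form_unit (negPf ne) mul0rn sub0r oppr_eq0.
  by rewrite eqz_nat (gtn_eqF hij).
have same i j : a i != 0 -> a j != 0 -> x i = x j.
  move=> ai aj; have /connectP[p + ->] := con i j ai aj.
  elim: p i ai => //= l p IH i ai /andP[/and3P[_ al hil] hp].
  by rewrite (adj i l) // (IH l).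
move=> i j; apply/eqP; rewrite -(eqr_int rat) !intrM !bE -/(A i) -/(A j).
have zero l : a l = 0 -> A l = 0 by rewrite /A => ->.
have [/zero ->|ai] := eqVneq (a i) 0; first by rewrite !mulr0 mul0r.
have [/zero ->|aj] := eqVneq (a j) 0; first by rewrite !mulr0 mul0r.
by rewrite (same i j) //; apply/eqP; ring.
Qed.

End KacIdentity.

(** * Representations as subquotients *)

Lemma dependent_choice (I : Type) (T : I -> Type) (P : forall i, T i -> Prop) :
  (forall i, exists x, P i x) -> exists f : forall i, T i, forall i, P i (f i).
Proof.
move=> h; exists (fun i => projT1 (cid (h i))) => i.
exact: projT2 (cid (h i)).
Qed.

Section LinearMaps.
Variable k : fieldType.

Lemma linear_lfun (aT rT : vectType k) (f : aT -> rT) :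
  linear f -> exists g : 'Hom(aT, rT), g =1 f.
Proof.
move=> fl; pose F : {linear aT -> rT} := HB.pack f (GRing.isLinear.Build _ _ _ _ f fl).
by exists (linfun F) => x; rewrite lfunE.
Qed.

Lemma colmx_sum_delta n (v : 'cV[k]_n) : v = \sum_s v s 0 *: delta_mx s 0.
Proof.
rewrite {1}[v]matrix_sum_delta; apply: eq_bigr => s _.
by rewrite big_ord1.
Qed.

Lemma lfun_colmx m n (f : 'Hom('cV[k]_m, 'cV[k]_n)) :
  exists A : 'M_(n, m), forall v, A *m v = f v.
Proof.
exists (\matrix_(t, s) f (delta_mx s 0) t 0) => v.
rewrite [v in RHS]colmx_sum_delta linear_sum; apply/matrixP => t z.
rewrite ord1 !mxE summxE; apply: eq_bigr => s _.
by rewrite linearZ !mxE mulrC.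
Qed.

Lemma mulmx_cv_inj m n (A B : 'M[k]_(m, n)) :
  (forall v : 'cV_n, A *m v = B *m v) -> A = B.
Proof.
move=> h; apply/trmx_inj/row_matrixP => s.
by apply: trmx_inj; rewrite !tr_row !trmxK !colE h.
Qed.

(** Coordinates on [V / W]: [f] is the basis map of a complement of [W] in [V], and [r] reads off
    coordinates after projecting along [W]. *)
Lemma quotient_coordinates (E : vectType k) (W V : {vspace E}) n :
  (W <= V)%VS -> \dim V = (\dim W + n)%N ->
  exists (f : 'Hom('cV[k]_n, E)) (r : 'Hom(E, 'cV[k]_n)),
    [/\ forall x, r (f x) = x, forall x, f x \in V,
        forall v, v \in W -> r v = 0 & forall v, v \in V -> v - f (r v) \in W].
Proof.
move=> sWV dV; pose C := (V :\: W)%VS.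
have dC : \dim C = n.
  have := dimv_cap_compl V W; rewrite (capv_idPr sWV) dV; exact: addnI.
subst n; pose X := vbasis C; have fX : free X := basis_free (vbasisP C).
have XC s : X`_s \in C.
  have [h|h] := ltnP s (size X); first by apply: vbasis_mem; rewrite mem_nth.
  by rewrite nth_default ?mem0v.
have CW : (C :&: W = 0)%VS := capv_diff V W.
have CV : (C + W = V)%VS by rewrite addv_diff (addv_idPl sWV).
have [|f fE] := @linear_lfun 'cV[k]_(\dim C) E (fun x => \sum_s x s 0 *: X`_s).
  move=> a x y; rewrite scaler_sumr -big_split; apply: eq_bigr => s _.
  by rewrite !mxE scalerDl scalerA.
have [|r rE] := @linear_lfun E 'cV[k]_(\dim C)
    (fun v => \col_s coord X s (daddv_pi C W v)).
  by move=> a x y; apply/matrixP => s z; rewrite !mxE !linearP.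
have fC x : f x \in C by rewrite fE rpred_sum // => s _; rewrite memvZ.
exists f, r; split.
- move=> x; apply/matrixP => s z; rewrite rE ord1 !mxE daddv_pi_id // fE.
  by rewrite coord_sum_free.
- by move=> x; rewrite -CV; apply: (subvP (addvSl _ _)).
- move=> v vW; rewrite rE; apply/matrixP => s z; rewrite !mxE.
  have vCW : v \in (C + W)%VS by apply: (subvP (addvSr _ _)).
  have := daddv_pi_add CW vCW; rewrite [X in _ + X]daddv_pi_id ?(capvC W) //.
  by move/(canRL (addrK v)); rewrite subrr => ->; rewrite linear0.
- move=> v; rewrite -CV => vCW; rewrite fE.
  have -> : \sum_s (r v) s 0 *: X`_s = daddv_pi C W v.
    rewrite [RHS](coord_vbasis (memv_pi C W v)).
    by apply: eq_bigr => s _; rewrite rE mxE.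
  by rewrite -{1}(daddv_pi_add CW vCW) addrC addKr memv_pi.
Qed.

End LinearMaps.

Section QuiverReps.
Variables (k : fieldType) (Q : double_quiver).

(* A representation of the double on the spaces [top i / bot i], given by
   subquotients of one ambient space; subrepresentations and quotients are
   then obtained by changing [top] or [bot]. *)
Record qrep := QRep {
  amb : vectType k;
  arr : forall i j : Q, arrow i j -> 'End(amb);
  bot : Q -> {vspace amb};
  top : Q -> {vspace amb};
  bot_top : forall i, (bot i <= top i)%VS;
  arr_top : forall i j (a : arrow i j) v, v \in top i -> arr a v \in top j;
  arr_bot : forall i j (a : arrow i j) v, v \in bot i -> arr a v \in bot j;
  moment_bot : forall i v, v \in top i ->
    \sum_j \sum_(a : arrow j i) (sgn a)%:~R *: arr a (arr (star a) v) \in bot i }.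

Implicit Types (M : qrep) (b : {ffun Q -> int}) (t h : {ffun Q -> rat}).

Definition is_sub M (U : Q -> {vspace amb M}) : Prop :=
  [/\ forall i, (bot M i <= U i)%VS, forall i, (U i <= top M i)%VS
    & forall i j (a : arrow i j) v, v \in U i -> arr M a v \in U j].

Definition qdim M (U : Q -> {vspace amb M}) : {ffun Q -> int} :=
  [ffun i => (\dim (U i))%:Z - (\dim (bot M i))%:Z].

Definition has_sub M b : Prop := exists2 U : Q -> {vspace amb M}, is_sub U & b = qdim U.

Definition dimq M : {ffun Q -> int} := qdim (@top M).

(** King's numerical form of semistability, in the convention that subrepresentations have
    nonnegative weight. *)
Definition semi t M : Prop :=
  pairing t (dimq M) = 0 /\ forall b, has_sub M b -> 0 <= pairing t b.

Definition stable t M : Prop :=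
  [/\ semi t M, dimq M <> 0
    & forall b, has_sub M b -> pairing t b = 0 -> b = 0 \/ b = dimq M].

Lemma is_sub_top M : is_sub (@top M).
Proof. split=> [i|i|i j a v]; [exact: bot_top|exact: subvv|exact: arr_top]. Qed.

Lemma has_sub_dimq M : has_sub M (dimq M).
Proof. exists (@top M) => //; exact: is_sub_top. Qed.

Lemma has_sub_bounds M b : has_sub M b -> forall i, 0 <= b i <= dimq M i.
Proof.
case=> U [h1 h2 _] -> i; rewrite !ffunE subr_ge0 lerD2r !lez_nat.
by rewrite !dimvS.
Qed.

Lemma dimq_ge0 M i : 0 <= dimq M i.
Proof. by have /andP[] := has_sub_bounds (has_sub_dimq M) i. Qed.

Lemma dimq_eq0 M i : dimq M i = 0 -> top M i = bot M i.
Proof.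
move/eqP; rewrite ffunE subr_eq0 eqz_nat => /eqP e.
by apply/esym/eqP; rewrite -(dimv_leqif_eq (bot_top M i)) e.
Qed.

Definition subq M U (hU : is_sub (M := M) U) : qrep.
Proof.
apply: (@QRep (amb M) (@arr M) (@bot M) U).
- by case: hU.
- by case: hU.
- exact: arr_bot.
- by move=> i v /(subvP (let: And3 _ h _ := hU in h i)); apply: moment_bot.
Defined.

Definition quotq M U (hU : is_sub (M := M) U) : qrep.
Proof.
apply: (@QRep (amb M) (@arr M) U (@top M)).
- by case: hU.
- exact: arr_top.
- by case: hU.
- by move=> i v /moment_bot; apply: (subvP (let: And3 h _ _ := hU in h i)).
Defined.

Lemma dimq_subq M U (hU : is_sub (M := M) U) : dimq (subq hU) = qdim U.
Proof. by apply/ffunP => i; rewrite !ffunE. Qed.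

Lemma dimq_quotq M U (hU : is_sub (M := M) U) :
  dimq (quotq hU) = dimq M - qdim U.
Proof. by apply/ffunP => i; rewrite !ffunE /=; lia. Qed.

Lemma has_sub_subq M U (hU : is_sub (M := M) U) b :
  has_sub (subq hU) b -> has_sub M b.
Proof.
case=> V [h1 h2 h3] ->; exists V => //; split=> // i.
by have [_ g2 _] := hU; apply: subv_trans (h2 i) (g2 i).
Qed.

Lemma has_sub_quotq M U (hU : is_sub (M := M) U) b :
  has_sub (quotq hU) b -> has_sub M (qdim U + b).
Proof.
case=> V [h1 h2 h3] ->; exists V.
  by have [g1 _ _] := hU; split=> // i; apply: subv_trans (g1 i) (h1 i).
by apply/ffunP => i; rewrite !ffunE /=; lia.
Qed.

Lemma semi_subq t M U (hU : is_sub (M := M) U) :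
  semi t M -> pairing t (qdim U) = 0 -> semi t (subq hU).
Proof.
by case=> _ h e; split=> [|b /has_sub_subq/h//]; rewrite dimq_subq.
Qed.

Lemma semi_quotq t M U (hU : is_sub (M := M) U) :
  semi t M -> pairing t (qdim U) = 0 -> semi t (quotq hU).
Proof.
case=> e0 h e; split=> [|b /has_sub_quotq/h].
  by rewrite dimq_quotq pairingDr pairingNr e0 e subrr.
by rewrite pairingDr e add0r.
Qed.

(** Arrows at a vertex of dimension zero induce the zero map on [top / bot], so only arrows inside
    the support have to preserve [C]. *)
Lemma has_sub_closed M (C : pred Q) :
  (forall i j, arrow i j -> dimq M i != 0 -> dimq M j != 0 -> C i -> C j) ->
  has_sub M [ffun i => if C i then dimq M i else 0].
Proof.
move=> hC; exists (fun i => if C i then top M i else bot M i); last first.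
  by apply/ffunP => i; rewrite !ffunE; case: ifP => _; rewrite ?subrr.
split=> [i|i|i j a v].
- by case: ifP => _; rewrite ?subvv ?bot_top.
- by case: ifP => _; rewrite ?subvv ?bot_top.
case: (boolP (C i)) => Ci vi; last first.
  by have := arr_bot a vi; case: ifP => // _; apply/subvP/bot_top.
case: ifP => Cj; first exact: arr_top.
have [/dimq_eq0 e|ni] := eqVneq (dimq M i) 0.
  by apply: arr_bot; rewrite -e.
have [/dimq_eq0 <-|nj] := eqVneq (dimq M j) 0; first exact: arr_top.
by rewrite (hC i j) in Cj.
Qed.

(** A destabilising value is bounded away from 0 by the common denominator of [t], so it survives a
    small perturbation; semistability therefore passes to the limit. The bound [eps] comes before
    [M], because later [M] is chosen for the perturbed weight. *)
Lemma semi_perturb t h (N : int) : exists2 eps : rat, 0 < eps &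
  forall e M, 0 <= e <= eps -> (forall i, dimq M i <= N) ->
    pairing t (dimq M) = 0 -> semi (t + scale_weight e h) M -> semi t M.
Proof.
have [eps e0 he] := perturbation t h N; exists eps => // e M hE hN tM [_ hM].
split=> // b hb; rewrite leNgt; apply/negP; rewrite -oppr_gt0 -pairingNr => neg.
have : 0 < pairing (t + scale_weight e h) (- b).
  apply: he => // i; have /andP[b0 b1] := has_sub_bounds hb i.
  by rewrite ffunE normrN ger0_norm // (le_trans b1).
by rewrite pairingNr oppr_gt0 ltNge hM.
Qed.

Lemma dimq_bound M : exists N : int, forall i, dimq M i <= N.
Proof.
exists (\sum_i dimq M i) => i; rewrite (bigD1 i) //= lerDl sumr_ge0 // => j _.
exact: dimq_ge0.
Qed.

(** Openness of stability: the values on proper nonzero subrepresentations are positive and stay so,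
    while [h] vanishes on the total dimension vector. *)
Lemma stable_perturb t h M : stable t M -> pairing h (dimq M) = 0 ->
  exists2 eps : rat, 0 < eps &
    forall e, 0 <= e <= eps -> stable (t + scale_weight e h) M.
Proof.
case=> [[tM ssM] nz stM] hM; have [N hN] := dimq_bound M.
have [eps e0 he] := perturbation t h N; exists eps => // e hE.
have pos b : has_sub M b -> [\/ b = 0, b = dimq M |
    0 < pairing (t + scale_weight e h) b].
  move=> hb; have [tb0|tb] := eqVneq (pairing t b) 0.
    by case: (stM b hb tb0); [constructor 1|constructor 2].
  constructor 3; apply: he; rewrite ?lt_def ?tb ?ssM // => i.
  have /andP[b0 b1] := has_sub_bounds hb i.
  by rewrite ger0_norm // (le_trans b1).
have z : pairing (t + scale_weight e h) (dimq M) = 0.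
  by rewrite pairingDl pairingZl tM hM mulr0 addr0.
split=> //; last by move=> b /pos[->|->|+ z0]; [left|right|rewrite z0 ltxx].
by split=> // b /pos[->|->|/ltW //]; rewrite ?pairing0r ?z.
Qed.

(** * Comparison with matrix representations *)

Section MatrixReps.
Variable alpha : Q -> nat.
Implicit Type B : rep k alpha.

Definition rep_sub B (Y : forall i : Q, {vspace 'cV[k]_(alpha i)}) : Prop :=
  forall i j (a : arrow i j) v, v \in Y i -> B i j a *m v \in Y j.

Definition rdim (Y : forall i : Q, {vspace 'cV[k]_(alpha i)}) : {ffun Q -> int} :=
  [ffun i => (\dim (Y i))%:Z].

Definition rep_has_sub B b : Prop := exists2 Y, rep_sub B Y & b = rdim Y.

(** The kernel of [r] on [top] is exactly [bot], so [U |-> r U] and [Y |-> top :&: r^-1 Y] match the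
    two kinds of subrepresentations, with the dimension of [bot] subtracted. *)
Lemma rep_coordinates_subs M B
    (f : forall i : Q, 'Hom('cV[k]_(alpha i), amb M))
    (r : forall i : Q, 'Hom(amb M, 'cV[k]_(alpha i))) :
  (forall i x, r i (f i x) = x) -> (forall i x, f i x \in top M i) ->
  (forall i v, v \in bot M i -> r i v = 0) ->
  (forall i v, v \in top M i -> v - f i (r i v) \in bot M i) ->
  (forall i j (a : arrow i j) x, B i j a *m x = r j (arr M a (f i x))) ->
  forall b, rep_has_sub B b <-> has_sub M b.
Proof.
move=> rf ft rb fr BE.
have dimE i (U : {vspace amb M}) : (bot M i <= U)%VS -> (U <= top M i)%VS ->
    \dim U = (\dim (bot M i) + \dim (r i @: U))%N.
  move=> sbU sUt; rewrite -(limg_ker_dim (r i) U); congr (_ + _)%N.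
  congr (\dim _); apply/eqP; rewrite eqEsubv; apply/andP; split.
    apply/subvP => v; rewrite memv_cap memv_ker => /andP[vU /eqP rv].
    by have := fr i v (subvP sUt _ vU); rewrite rv linear0 subr0.
  by apply/subvP => v vb; rewrite memv_cap memv_ker rb // eqxx (subvP sbU).
have rBE i j (a : arrow i j) v : v \in top M i ->
    r j (arr M a v) = B i j a *m r i v.
  move=> vt; rewrite BE -{1}(subrK (f i (r i v)) v) linearD linearD /=.
  by rewrite (rb _ _ (arr_bot a (fr _ _ vt))) add0r.
move=> b; split=> [[Y hY ->]|[U [h1 h2 h3] ->]].
  exists (fun i => top M i :&: (r i @^-1: Y i))%VS.
    split=> [i|i|i j a v].
    - rewrite subv_cap bot_top; apply/subvP => v /rb e.
      by rewrite -memv_preim e mem0v.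
    - exact: capvSl.
    - rewrite !memv_cap -!memv_preim => /andP[vt vY].
      by rewrite arr_top // rBE //; apply: hY.
  apply/ffunP => i; rewrite !ffunE.
  rewrite (dimE i (top M i :&: _)%VS) ?capvSl //; last first.
    rewrite subv_cap bot_top; apply/subvP => v /rb e.
    by rewrite -memv_preim e mem0v.
  suff -> : (r i @: (top M i :&: (r i @^-1: Y i)) = Y i)%VS.
    by rewrite PoszD addrC addKr.
  apply/eqP; rewrite eqEsubv; apply/andP; split; apply/subvP => y.
    by case/memv_imgP=> v; rewrite memv_cap -memv_preim => /andP[_ ?] ->.
  by move=> yY; rewrite -(rf i y) memv_img // memv_cap -memv_preim rf ft.
exists (fun i => r i @: U i)%VS.
  move=> i j a _ /memv_imgP[v vU ->].
  by rewrite -rBE ?(subvP (h2 i)) // memv_img // h3.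
by apply/ffunP => i; rewrite !ffunE (dimE i (U i)) // PoszD addrC addKr.
Qed.

Lemma rep_of_qrep M : dimq M = dim_vector alpha ->
  exists2 B : rep k alpha, moment_fibre B &
    forall b, rep_has_sub B b <-> has_sub M b.
Proof.
move=> dM.
have dim_top i : \dim (top M i) = (\dim (bot M i) + alpha i)%N.
  have := congr1 (fun d : {ffun Q -> int} => d i) dM.
  by rewrite !ffunE; have := dimvS (bot_top M i); lia.
have /dependent_choice[f] := fun i => quotient_coordinates (bot_top M i) (dim_top i).
move=> /dependent_choice[r hfr].
have rf i x : r i (f i x) = x by case: (hfr i).
have ft i x : f i x \in top M i by case: (hfr i).
have rb i v : v \in bot M i -> r i v = 0 by case: (hfr i) => _ _ + _; apply.
have fr i v : v \in top M i -> v - f i (r i v) \in bot M i.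
  by case: (hfr i) => _ _ _; apply.
have /dependent_choice[B1 hB1] (i : Q) : exists B' : forall j, arrow i j -> 'M[k]_(alpha j, alpha i),
    forall j a x, B' j a *m x = r j (arr M a (f i x)).
  have /dependent_choice[B2 hB2] (j : Q) : exists B' : arrow i j -> 'M[k]_(alpha j, alpha i),
      forall a x, B' a *m x = r j (arr M a (f i x)).
    have /dependent_choice[B3 hB3] (a : arrow i j) := lfun_colmx (r j \o arr M a \o f i)%VF.
    by exists B3 => a x; rewrite hB3 !comp_lfunE.
  by exists B2.
pose B : rep k alpha := fun i j a => B1 i j a.
exists B; last exact: (rep_coordinates_subs rf ft rb fr hB1).
move=> i; apply: mulmx_cv_inj => v; rewrite mul0mx.
rewrite -[RHS](rb i _ (moment_bot (ft i v))) /moment mulmx_suml !linear_sum.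
apply: eq_bigr => j _; rewrite mulmx_suml !linear_sum; apply: eq_bigr => a _ /=.
rewrite -scalemxAl linearZ -mulmxA /B !hB1 /=; congr (_ *: _).
have := rb _ _ (arr_bot a (fr _ _ (arr_top (star a) (ft i v)))).
by rewrite linearB linearB => /eqP; rewrite subr_eq0 => /eqP.
Qed.

Lemma qrep_of_rep B : moment_fibre B -> exists2 M, dimq M = dim_vector alpha &
  forall b, rep_has_sub B b <-> has_sub M b.
Proof.
(* One ambient space serves all vertices: the space at [i] becomes the first [alpha i] coordinates
   of [k^N]. These subspaces overlap, which is harmless because [top] keeps the vertices apart. *)
move=> mB; pose N := (\sum_i alpha i)%N.
have aN i : (alpha i <= N)%N by rewrite /N (bigD1 i) //= leq_addr.
have mull m n (A : 'M[k]_(m, n)) : exists g : 'Hom('cV[k]_n, 'cV[k]_m),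
    forall v, g v = A *m v.
  by apply: linear_lfun => c x y; rewrite mulmxDr scalemxAr.
pose P i : 'M[k]_(N, alpha i) := pid_mx (alpha i).
pose R i : 'M[k]_(alpha i, N) := pid_mx (alpha i).
have RP i : R i *m P i = 1%:M.
  by rewrite /R /P pid_mx_id ?aN // pid_mx_1.
have /dependent_choice[f fE] (i : Q) := mull _ _ (P i).
have /dependent_choice[r rE] (i : Q) := mull _ _ (R i).
have /dependent_choice[x1 hx1] (i : Q) : exists x' : forall j, arrow i j -> 'End('cV[k]_N),
    forall j a v, x' j a v = P j *m (B i j a *m (R i *m v)).
  have /dependent_choice[x2 hx2] (j : Q) : exists x' : arrow i j -> 'End('cV[k]_N),
      forall a v, x' a v = P j *m (B i j a *m (R i *m v)).
    have /dependent_choice[x3 hx3] (a : arrow i j) := mull _ _ (P j *m B i j a *m R i).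
    by exists x3 => a v; rewrite hx3 !mulmxA.
  by exists x2.
have fx i (x : 'cV_(alpha i)) : f i x \in limg (f i) by rewrite memv_img ?memvf.
have top_ok i v : v \in limg (f i) -> v = P i *m (R i *m v).
  by case/memv_imgP=> y _ ->; rewrite fE !mulmxA -(mulmxA _ (R i)) RP mulmx1.
have at_ i j (a : arrow i j) v : v \in limg (f i) -> x1 i j a v \in limg (f j).
  by move=> _; rewrite hx1 -fE.
have ab i j (a : arrow i j) v : v \in 0%VS -> x1 i j a v \in 0%VS.
  by rewrite !memv0 => /eqP ->; rewrite linear0.
have mb i v : v \in limg (f i) ->
    \sum_j \sum_(a : arrow j i) (sgn a)%:~R *: x1 j i a (x1 i j (star a) v) \in 0%VS.
  move=> _; rewrite memv0; apply/eqP.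
  transitivity (P i *m (moment B i *m (R i *m v))); last first.
    by rewrite mB mul0mx mulmx0.
  rewrite /moment mulmx_suml mulmx_sumr; apply: eq_bigr => j _.
  rewrite mulmx_suml mulmx_sumr; apply: eq_bigr => a _.
  rewrite !hx1 -scalemxAl -scalemxAr; congr (_ *: _).
  by rewrite !mulmxA -(mulmxA _ (R j)) RP mulmx1.
pose M := @QRep _ x1 (fun=> 0%VS) (fun i => limg (f i)) (fun=> sub0v _) at_ ab mb.
exists M.
  apply/ffunP => i; rewrite !ffunE /= dimv0 subr0; congr Posz.
  rewrite limg_dim_eq ?dimvf /dim /= ?muln1 //.
  apply/eqP; rewrite -subv0; apply/subvP => v; rewrite memv_cap memv_ker memv0.
  case/andP=> _ /eqP fv; rewrite -(mul1mx v) -(RP i) -mulmxA -fE fv mulmx0 //.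
apply: (@rep_coordinates_subs M B f r).
- by move=> i x; rewrite rE fE mulmxA RP mul1mx.
- exact: fx.
- by move=> i v; rewrite memv0 => /eqP ->; rewrite linear0.
- by move=> i v /= vt; rewrite memv0 subr_eq0 fE rE {1}(top_ok i v vt).
- by move=> i j a x; rewrite /= hx1 rE fE !mulmxA RP mul1mx -(mulmxA _ (R i)) RP mulmx1.
Qed.

End MatrixReps.
End QuiverReps.

(** * Reflection functors *)

Lemma fibre_arith (a b c d e f g : nat) :
  (a + b = d + c)%N -> (f + c = e)%N -> (f + b = g)%N -> (a + g = d + e)%N.
Proof. lia. Qed.

Section ProductSpace.
Variables (k : fieldType) (O : finType) (E : vectType k).
Local Notation E' := {ffun O -> E}.

Lemma ffun_inj_ex (o : O) :
  exists g : 'Hom(E, E'), forall x, g x = [ffun o' => if o' == o then x else 0].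
Proof.
apply: linear_lfun => a x y; apply/ffunP => o'; rewrite !ffunE.
by case: eqP => _ //; rewrite scaler0 addr0.
Qed.

Definition ffun_inj o : 'Hom(E, E') := projT1 (cid (ffun_inj_ex o)).

Lemma ffun_injE o x o' : ffun_inj o x o' = if o' == o then x else 0.
Proof. by rewrite /ffun_inj; case: cid => g /= ->; rewrite ffunE. Qed.

Lemma ffun_inj_sum (w : E') : w = \sum_o ffun_inj o (w o).
Proof.
apply/ffunP => o; rewrite sum_ffunE (bigD1 o) //= big1 => [|o' /negPf ne].
  by rewrite ffun_injE eqxx addr0.
by rewrite ffun_injE eq_sym ne.
Qed.

Lemma lker_ffun_inj o : lker (ffun_inj o) = 0%VS.
Proof.
apply/eqP/lker0P => x y /(congr1 (fun w : E' => w o)).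
by rewrite !ffun_injE eqxx.
Qed.

Lemma dim_ffun_inj o (U : {vspace E}) : \dim (ffun_inj o @: U) = \dim U.
Proof. by rewrite limg_dim_eq // lker_ffun_inj capv0. Qed.

Lemma mem_ffun_inj o (U : {vspace E}) x :
  (ffun_inj o x \in (ffun_inj o @: U)%VS) = (x \in U).
Proof.
apply/memv_imgP/idP => [[y yU]|xU]; last by exists x.
by move/eqP: (lker_ffun_inj o) => /lker0P inj /inj ->.
Qed.

Definition prodv (S : O -> {vspace E}) : {vspace E'} :=
  (\sum_o ffun_inj o @: S o)%VS.

Lemma mem_prodv (S : O -> {vspace E}) (w : E') : reflect (forall o, w o \in S o) (w \in prodv S).
Proof.
apply: (iffP idP) => [/memv_sumP[v hv ->] o|h].
  rewrite sum_ffunE rpred_sum // => o' _; have /memv_imgP[x xS ->] := hv o' isT.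
  by rewrite ffun_injE; case: eqP => [->|_]; rewrite ?mem0v.
rewrite (ffun_inj_sum w) rpred_sum // => o _.
by apply: (subvP (sumv_sup o _ (subvv _))) => //; rewrite memv_img.
Qed.

Lemma dim_prodv (S : O -> {vspace E}) : \dim (prodv S) = (\sum_o \dim (S o))%N.
Proof.
have /directvP -> : directv (\sum_o ffun_inj o @: S o).
  apply/directv_sum_independent => us hus sum0 o _.
  have [x _ e] := memv_imgP (hus o isT).
  have := congr1 (fun w : E' => w o) sum0; rewrite sum_ffunE ffunE (bigD1 o) //=.
  rewrite big1 ?addr0; first by rewrite e ffun_injE eqxx => ->; rewrite linear0.
  move=> o' ne; have [y _ ->] := memv_imgP (hus o' isT).
  by rewrite ffun_injE eq_sym (negPf ne).
by apply: eq_bigr => o _; rewrite /= dim_ffun_inj.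
Qed.

End ProductSpace.

Section Reflection.
Variables (k : fieldType) (Q : double_quiver) (M : qrep k Q) (j : Q).
Hypothesis hj : loop_free j.

Local Notation E := (amb M).

(** Labels for slots of the ambient space of a reflected representation. The slot [None] carries the
    old spaces at vertices other than [j]; the slots of arrows ending at [j] carry the direct sum
    out of which the new space at [j] is formed. *)
Definition all_arrows : finType := {l : Q & {i : Q & arrow l i}}.
Definition arrow_pt l i (a : arrow l i) : all_arrows :=
  existT _ l (existT _ i a).

Local Notation E' := {ffun option all_arrows -> E}.
Local Notation at_ a := (Some (arrow_pt a)).
Local Notation inj := (@ffun_inj k _ E).

Lemma no_loop (a : arrow j j) : False.
Proof. by have := hj; rewrite /loop_free => /eqP/card0_eq/(_ a). Qed.

Lemma arrow_pt_eq l i (a b : arrow l i) : (arrow_pt a == arrow_pt b) = (a == b).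
Proof. by rewrite /arrow_pt !(eq_Tagged (T_ := _)). Qed.

Lemma arrow_pt_ends l i l' i' (a : arrow l i) (b : arrow l' i') :
  at_ a = at_ b -> l = l' /\ i = i'.
Proof.
move/(congr1 (fun o : option all_arrows =>
  if o is Some p then Some (tag p, tag (tagged p)) else None)).
by case.
Qed.

Lemma sgn_sqr (l i : Q) (a : arrow l i) : (sgn a)%:~R * (sgn a)%:~R = 1 :> k.
Proof. by case: (sgn_pm1 a) => ->; rewrite ?rmorphN ?mulrNN mulr1. Qed.

(** With [pi_] below this gives maps from the space at [j] to the sum of the spaces at the tails of
    arrows into [j], and back. The composite is the moment map at [j], so they form a complex;
    reflection replaces the space at [j] by its cokernel or its kernel. *)
Lemma iota_ex : exists g : 'Hom(E, E'), forall v, g v =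
  [ffun o => if o is Some (existT l (existT i b)) then
               if i == j then arr M (star b) v else 0 else 0].
Proof.
apply: linear_lfun => a x y; apply/ffunP => -[[l [i b]]|]; rewrite !ffunE.
  by case: eqP => _; rewrite ?linearP // scaler0 addr0.
by rewrite scaler0 addr0.
Qed.

Definition iota_ := projT1 (cid iota_ex).

Lemma iotaE v : iota_ v =
  [ffun o => if o is Some (existT l (existT i b)) then
               if i == j then arr M (star b) v else 0 else 0].
Proof. by rewrite /iota_; case: cid => g /= ->. Qed.

Lemma iota_at v l (a : arrow l j) : iota_ v (at_ a) = arr M (star a) v.
Proof. by rewrite iotaE ffunE /= eqxx. Qed.

Lemma pi_ex : exists g : 'Hom(E', E), forall w, g w =
  \sum_l \sum_(a : arrow l j) (sgn a)%:~R *: arr M a (w (at_ a)).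
Proof.
apply: linear_lfun => c x y; rewrite scaler_sumr -big_split; apply: eq_bigr => l _.
rewrite scaler_sumr -big_split; apply: eq_bigr => a _ /=.
by rewrite !ffunE linearP scalerDr !scalerA mulrC.
Qed.

Definition pi_ := projT1 (cid pi_ex).

Lemma piE w : pi_ w =
  \sum_l \sum_(a : arrow l j) (sgn a)%:~R *: arr M a (w (at_ a)).
Proof. by rewrite /pi_; case: cid => g /= ->. Qed.

Lemma pi_inj l (a : arrow l j) v :
  pi_ (inj (at_ a) v) = (sgn a)%:~R *: arr M a v.
Proof.
rewrite piE (bigD1 l) //= (bigD1 a) //= ffun_injE eqxx big1 => [|b /negPf ne].
  rewrite addr0 big1 ?addr0 // => l' /negPf ne; rewrite big1 // => b _.
  rewrite ffun_injE; case: eqP => [/arrow_pt_ends[e _]|_]; last by rewrite linear0 scaler0.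
  by rewrite e eqxx in ne.
rewrite ffun_injE (inj_eq Some_inj) arrow_pt_eq ne.
by rewrite linear0 scaler0.
Qed.

Definition armv (S : Q -> {vspace E}) : {vspace E'} :=
  prodv (fun o => if o is Some (existT l (existT i b)) then
                    if i == j then S l else 0%VS else 0%VS).

Lemma armvP (S : Q -> {vspace E}) (w : E') : reflect
  [/\ w None = 0, forall l (a : arrow l j), w (at_ a) \in S l
    & forall l i (a : arrow l i), i != j -> w (at_ a) = 0] (w \in armv S).
Proof.
apply: (iffP (mem_prodv _ _)) => [h|[h1 h2 h3] [[l [i b]]|]].
- split=> [|l a|l i a /negPf ne].
  + by have := h None; rewrite memv0 => /eqP.
  + by have := h (at_ a); rewrite /= eqxx.
  + by have := h (at_ a); rewrite /= ne memv0 => /eqP.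
- case: eqP => [e|/eqP ne]; first by subst i; apply: h2.
  by rewrite -/(arrow_pt b) h3 ?mem0v.
- by rewrite h1 mem0v.
Qed.

Lemma armv_sum (S : Q -> {vspace E}) (w : E') : w \in armv S ->
  w = \sum_l \sum_(a : arrow l j) inj (at_ a) (w (at_ a)).
Proof.
case/armvP=> h1 h2 h3; apply/ffunP => -[[l [i b]]|]; rewrite sum_ffunE; last first.
  by rewrite big1 // => l _; rewrite sum_ffunE big1 // => a _; rewrite ffun_injE.
rewrite -/(arrow_pt b); have [e|ne] := eqVneq i j; last first.
  rewrite h3 // big1 // => l' _; rewrite sum_ffunE big1 // => a _.
  rewrite ffun_injE; case: eqP => // /arrow_pt_ends[_ e].
  by rewrite e eqxx in ne.
subst i; rewrite (bigD1 l) //= sum_ffunE (bigD1 b) //= ffun_injE eqxx.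
rewrite big1 ?addr0 => [|a /negPf ne]; last first.
  by rewrite ffun_injE (inj_eq Some_inj) arrow_pt_eq eq_sym ne.
rewrite big1 ?addr0 // => l' /negPf ne; rewrite sum_ffunE big1 // => a _.
rewrite ffun_injE; case: eqP => // /arrow_pt_ends[e _].
by rewrite e eqxx in ne.
Qed.

Lemma iota_armv (S : Q -> {vspace E}) v :
  reflect (forall l (a : arrow l j), arr M (star a) v \in S l)
          (iota_ v \in armv S).
Proof.
apply: (iffP (armvP _ _)) => [[_ h _] l a|h]; first by rewrite -iota_at.
split=> [|l a|l i a /negPf ne]; first by rewrite iotaE ffunE.
  by rewrite iota_at.
by rewrite iotaE ffunE /= ne.
Qed.

Lemma iota_sum v :
  iota_ v = \sum_l \sum_(a : arrow l j) inj (at_ a) (arr M (star a) v).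
Proof.
rewrite [LHS](@armv_sum (fun=> fullv)); last by apply/iota_armv => *; rewrite memvf.
by apply: eq_bigr => l _; apply: eq_bigr => a _; rewrite iota_at.
Qed.

Lemma inj_armv (S : Q -> {vspace E}) l (a : arrow l j) v : v \in S l -> inj (at_ a) v \in armv S.
Proof.
move=> vS; apply/armvP; split=> [|l' b|l' i b ne]; rewrite ffun_injE //.
  case: eqP => [/arrow_pt_ends[-> _]|_] //; exact: mem0v.
case: eqP => // /arrow_pt_ends[_ e].
by rewrite e eqxx in ne.
Qed.

Lemma armvS (S S' : Q -> {vspace E}) : (forall l, (S l <= S' l)%VS) -> (armv S <= armv S')%VS.
Proof.
move=> h; apply/subvP => w /armvP[h1 h2 h3]; apply/armvP; split=> // l a.
exact: (subvP (h l)).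
Qed.

Lemma dim_armv (S : Q -> {vspace E}) : \dim (armv S) = (\sum_l #|arrow l j| * \dim (S l))%N.
Proof.
rewrite dim_prodv (bigD1 None) //= dimv0 add0n.
rewrite (reindex_omap Some id) /=; last by case.
under eq_bigl do rewrite eqxx.
transitivity (\sum_l \sum_(q : {i : Q & arrow l i})
    \dim (if tag q == j then S l else 0%VS))%N.
  by rewrite sig_big_dep /=; apply: eq_bigr => -[l [i b]] _.
apply: eq_bigr => l _.
transitivity (\sum_i \sum_(b : arrow l i) \dim (if i == j then S l else 0%VS))%N.
  by rewrite sig_big_dep /=; apply: eq_bigr => -[i b] _.
rewrite (bigD1 j) //= eqxx sum_nat_const big1 ?addn0 // => i /negPf ->.
by rewrite big1 // => _ _; rewrite dimv0.
Qed.

Lemma pi_armv (S : Q -> {vspace E}) (V : {vspace E}) (w : E') :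
  (forall l (a : arrow l j) v, v \in S l -> arr M a v \in V) ->
  w \in armv S -> pi_ w \in V.
Proof.
move=> h /armvP[_ hw _]; rewrite piE rpred_sum // => l _; rewrite rpred_sum // => a _.
by rewrite memvZ // h.
Qed.

Lemma pi_iota v : v \in top M j -> pi_ (iota_ v) \in bot M j.
Proof.
move=> vt; rewrite piE.
under eq_bigr do under eq_bigr do rewrite iota_at.
exact: moment_bot.
Qed.

Lemma dim_iota_fibre (Tx : {vspace E'}) (V : {vspace E}) :
  (\dim (Tx + iota_ @: V) + \dim (V :&: (iota_ @^-1: Tx)) = \dim Tx + \dim V)%N.
Proof.
have e : (iota_ @: (V :&: (iota_ @^-1: Tx)) = Tx :&: iota_ @: V)%VS.
  apply/eqP; rewrite eqEsubv; apply/andP; split; apply/subvP => y.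
    case/memv_imgP=> v; rewrite memv_cap -memv_preim => /andP[vV vT] ->.
    by rewrite memv_cap vT memv_img.
  rewrite memv_cap => /andP[yT /memv_imgP[v vV e]]; rewrite e.
  by rewrite memv_img // memv_cap vV -memv_preim -e.
have kerE : (V :&: (iota_ @^-1: Tx) :&: lker iota_ = V :&: lker iota_)%VS.
  apply/vspaceP => v; rewrite !memv_cap memv_ker -memv_preim.
  by case: eqP => [->|]; rewrite ?mem0v ?andbT ?andbF.
have := limg_ker_dim iota_ (V :&: (iota_ @^-1: Tx)); rewrite e kerE.
exact: fibre_arith (dimv_sum_cap _ _) (limg_ker_dim iota_ V).
Qed.

Lemma mem_pi_preim (V : {vspace E}) (w : E') :
  (w \in (pi_ @^-1: V)%VS) = (pi_ w \in V).
Proof. by apply/esym; apply: memv_preim. Qed.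

Lemma dim_pi_fibre (Tx : {vspace E'}) (V : {vspace E}) :
  (\dim (Tx :&: (pi_ @^-1: V)) + \dim (pi_ @: Tx + V) = \dim Tx + \dim V)%N.
Proof.
have e : (pi_ @: (Tx :&: (pi_ @^-1: V)) = pi_ @: Tx :&: V)%VS.
  apply/eqP; rewrite eqEsubv; apply/andP; split; apply/subvP => y.
    case/memv_imgP=> v /memv_capP[vT]; rewrite mem_pi_preim => vV ->.
    by apply/memv_capP; rewrite memv_img.
  case/memv_capP=> /memv_imgP[v vT e] yV; rewrite e; apply/memv_img/memv_capP.
  by rewrite mem_pi_preim -e.
have kerE : (Tx :&: (pi_ @^-1: V) :&: lker pi_ = Tx :&: lker pi_)%VS.
  apply/eqP; rewrite eqEsubv; apply/andP; split; apply/subvP => v.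
    by case/memv_capP=> /memv_capP[vT _] vk; apply/memv_capP.
  case/memv_capP=> vT vk; apply/memv_capP; split=> //; apply/memv_capP; split=> //.
  by rewrite mem_pi_preim; move: vk; rewrite memv_ker => /eqP ->; rewrite mem0v.
have := limg_ker_dim pi_ (Tx :&: (pi_ @^-1: V)); rewrite e kerE.
move=> h; rewrite addnC [RHS]addnC.
apply: fibre_arith (limg_ker_dim pi_ Tx) h.
by rewrite dimv_sum_cap addnC.
Qed.

End Reflection.

Lemma Posz_sum (I : Type) (r : seq I) (P : pred I) (F : I -> nat) :
  (\sum_(i <- r | P i) F i)%N%:Z = \sum_(i <- r | P i) (F i)%:Z.
Proof. exact: (big_morph Posz PoszD). Qed.

Section ReflectionFunctors.
Variables (k : fieldType) (Q : double_quiver) (M : qrep k Q) (j : Q).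
Hypothesis hj : loop_free j.

Local Notation E := (amb M).
Local Notation E' := {ffun option (all_arrows Q) -> E}.
Local Notation at_ a := (Some (arrow_pt a)).
Local Notation inj := (@ffun_inj k _ E).
Local Notation io := (iota_ M j).
Local Notation pj := (pi_ M j).
Local Notation arm := (armv (M := M) j).

Lemma dim_arm_diff (S : Q -> {vspace E}) :
  (\dim (arm S))%:Z - (\dim (arm (bot M)))%:Z =
  \sum_i #|arrow i j|%:Z * qdim S i.
Proof.
rewrite !dim_armv !Posz_sum -sumrB; apply: eq_bigr => i _.
by rewrite ffunE !PoszM mulrBr.
Qed.

(** The number [c] is the defect at [j] between a subrepresentation of the reflected representation
    and the reflected vector of a subrepresentation of [M]; its sign is what semistability needs. *)
Lemma reflect_dims (U : Q -> {vspace E}) (b : {ffun Q -> int}) c :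
  (forall i, i != j -> b i = qdim U i) ->
  b j = \sum_i #|arrow i j|%:Z * qdim U i - qdim U j + c ->
  b = reflection j (qdim U) + scale_vec c (unit_vec j).
Proof.
move=> h1 h2; apply/ffunP => i; rewrite ffunE [scale_vec _ _ _]ffunE.
have -> : unit_vec j i = (i == j)%:Z by rewrite ffunE.
have [->|ne] := eqVneq i j; first by rewrite reflection_at // h2 mulr1.
by rewrite reflection_neq // h1 // mulr0 addr0.
Qed.

Lemma mem_none_img (S : {vspace E}) (w : E') :
  reflect (exists2 v, v \in S & w = inj None v) (w \in (inj None @: S)%VS).
Proof. exact: memv_imgP. Qed.

Lemma inj_none v : (inj None v : E') None = v.
Proof. by rewrite ffun_injE. Qed.

(** Structure maps when the space at [j] becomes the cokernel of [io]; arrows leaving [j] factor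
    through [pj], which kills the image of [io] modulo [bot]. The sign makes the new moment element
    at [j] equal to [io] after [pj], hence zero in the cokernel. *)
Definition low_arr_fun l i (b : arrow l i) (w : E') : E' :=
  if i == j then inj (at_ b) ((sgn b)%:~R *: w None)
  else inj None (if l == j then arr M b (pj w) else arr M b (w None)).

Lemma low_arr_ex l i (b : arrow l i) :
  exists g : 'End(E'), forall w, g w = low_arr_fun b w.
Proof.
apply: linear_lfun => a x y; rewrite /low_arr_fun !ffunE.
by do 2?[case: eqP => _]; rewrite ?scalerDr ?scalerA ?[_ * a]mulrC -?scalerA
  !linearP.
Qed.

(** The dual structure, with the kernel of [pj] at [j]: arrows into [j] factor through [io], and
    arrows leaving [j] read off a coordinate. *)
Definition high_arr_fun l i (b : arrow l i) (w : E') : E' :=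
  if i == j then io (arr M b (w None))
  else inj None (if l == j then w (at_ (star b)) else arr M b (w None)).

Lemma high_arr_ex l i (b : arrow l i) :
  exists g : 'End(E'), forall w, g w = high_arr_fun b w.
Proof.
apply: linear_lfun => a x y; rewrite /high_arr_fun !ffunE.
by do 2?[case: eqP => _]; rewrite !linearP.
Qed.

(** Injectivity of [io] modulo [bot] gives the cokernel the reflected dimension. At [j] a
    subrepresentation contains everything that arrives there from the other vertices, so it can only
    exceed the reflected dimension, whence [0 <= c]. *)
Lemma low_reflection :
  (forall v, v \in top M j ->
     (forall l (a : arrow l j), arr M (star a) v \in bot M l) -> v \in bot M j) ->
  exists2 M' : qrep k Q, dimq M' = reflection j (dimq M) &
    forall b', has_sub M' b' -> exists b c,
      [/\ has_sub M b, b' = reflection j b + scale_vec c (unit_vec j) & 0 <= c].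
Proof.
move=> hinj.
pose x' l i (b : arrow l i) := projT1 (cid (low_arr_ex b)).
have xE l i (b : arrow l i) w : x' l i b w = low_arr_fun b w.
  by rewrite /x'; case: cid => g /= ->.
pose top' i := if i == j then arm (top M) else (inj None @: top M i)%VS.
pose bot' i := if i == j then (arm (bot M) + io @: top M j)%VS
               else (inj None @: bot M i)%VS.
have io_top v : v \in top M j -> io v \in arm (top M).
  by move=> vt; apply/iota_armv => l a; apply: arr_top.
have bt i : (bot' i <= top' i)%VS.
  rewrite /bot' /top'; case: eqP => _; last exact/limgS/bot_top.
  rewrite subv_add armvS; last by move=> l; apply: bot_top.
  by apply/subvP => _ /memv_imgP[v vt ->]; apply: io_top.
have at_ok l i (b : arrow l i) w : w \in top' l -> x' l i b w \in top' i.
  rewrite xE /top' /low_arr_fun; have [ei|ni] := eqVneq i j.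
    subst i; have [el|nl] := eqVneq l j; first by subst l; case: (no_loop hj b).
    case/mem_none_img => v vt ->; rewrite inj_none.
    by apply: inj_armv; rewrite memvZ.
  have [el|nl] := eqVneq l j.
    subst l => wt; rewrite memv_img // arr_top // (pi_armv _ wt) // => l a v.
    exact: arr_top.
  by case/mem_none_img => v vt ->; rewrite inj_none memv_img // arr_top.
have ab_ok l i (b : arrow l i) w : w \in bot' l -> x' l i b w \in bot' i.
  rewrite xE /bot' /low_arr_fun; have [ei|ni] := eqVneq i j.
    subst i; have [el|nl] := eqVneq l j; first by subst l; case: (no_loop hj b).
    case/mem_none_img => v vt ->; rewrite inj_none.
    by apply/(subvP (addvSl _ _))/inj_armv; rewrite memvZ.
  have [el|nl] := eqVneq l j.
    subst l => /memv_addP[w1 w1b [_ /memv_imgP[v vt ->] ->]].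
    rewrite memv_img // arr_bot // linearD memvD ?pi_iota //.
    by apply: (pi_armv _ w1b) => l a u; apply: arr_bot.
  by case/mem_none_img => v vt ->; rewrite inj_none memv_img // arr_bot.
have mb_ok i w : w \in top' i ->
    \sum_l \sum_(a : arrow l i) (sgn a)%:~R *: x' l i a (x' i l (star a) w) \in bot' i.
  rewrite /top' /bot'; have [ei|ni] := eqVneq i j.
    subst i => wt; apply: (subvP (addvSr _ _)).
    have -> : \sum_l \sum_(a : arrow l j) (sgn a)%:~R *:
        x' l j a (x' j l (star a) w) = io (pj w).
      rewrite iota_sum; apply: eq_bigr => l _; apply: eq_bigr => a _.
      rewrite !xE /low_arr_fun eqxx; case: eqVneq => [el|nl].
        by subst l; case: (no_loop hj a).
      by rewrite inj_none -linearZ scalerA sgn_sqr scale1r.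
    rewrite memv_img // (pi_armv _ wt) // => l a v; exact: arr_top.
  case/mem_none_img => v vt ->.
  have -> : \sum_l \sum_(a : arrow l i) (sgn a)%:~R *:
      x' l i a (x' i l (star a) (inj None v)) =
      inj None (\sum_l \sum_(a : arrow l i) (sgn a)%:~R *:
        arr M a (arr M (star a) v)).
    rewrite linear_sum; apply: eq_bigr => l _.
    rewrite linear_sum; apply: eq_bigr => a _.
    rewrite !xE /low_arr_fun (negPf ni) [RHS]linearZ; congr (_ *: inj None _).
    have [el|nl] := eqVneq l j; last by rewrite !inj_none.
    by subst l; rewrite pi_inj inj_none [arr M (star a) (_ *: _)]linearZ scalerA sgn_sqr scale1r.
  by rewrite memv_img // moment_bot.
pose M' := QRep bt at_ok ab_ok mb_ok.
(* Dimension of the image of [Tx] in the cokernel; by injectivity, the part of [top M j] sent by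
   [io] into [arm (bot M)] is just [bot M j]. *)
have key (Tx : {vspace E'}) (b : int) :
    b = (\dim (Tx + io @: top M j)%VS)%:Z - (\dim (arm (bot M) + io @: top M j)%VS)%:Z ->
    b = (\dim Tx)%:Z - (\dim (arm (bot M)))%:Z -
        ((\dim (top M j :&: (io @^-1: Tx))%VS)%:Z - (\dim (bot M j))%:Z).
  have := dim_iota_fibre j Tx (top M j).
  have := dim_iota_fibre j (arm (bot M)) (top M j).
  have -> : (top M j :&: (io @^-1: arm (bot M)) = bot M j)%VS.
    apply/eqP; rewrite eqEsubv; apply/andP; split; apply/subvP => v.
      case/memv_capP=> vt; rewrite -memv_preim => /iota_armv; exact: hinj.
    move=> vb; apply/memv_capP; split; first exact: (subvP (bot_top M j)).
    by rewrite -memv_preim; apply/iota_armv => l a; apply: arr_bot.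
  move=> /(congr1 Posz) + /(congr1 Posz); rewrite !PoszD => e1 e2 ->.
  move: e1 e2; lra.
exists M'.
  apply/eqP; rewrite -[X in _ == X]addr0.
  have -> : (0 : {ffun Q -> int}) = scale_vec 0 (unit_vec j).
    by apply/ffunP => i; rewrite !ffunE mul0r.
  apply/eqP/reflect_dims => [i ni|].
    by rewrite !ffunE /= /top' /bot' (negPf ni) !dim_ffun_inj.
  rewrite addr0 -dim_arm_diff /dimq !ffunE /= /top' /bot' eqxx.
  have e : (arm (top M) + io @: top M j = arm (top M))%VS.
    by apply/addv_idPl/subvP => _ /memv_imgP[v vt ->]; apply: io_top.
  have e2 : (top M j :&: (io @^-1: arm (top M)) = top M j)%VS.
    by apply/capv_idPl/subvP => v vt; rewrite -memv_preim io_top.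
  by rewrite -{1}e (key _ _ erefl) e2.
move=> b' [U' [hb ht hs] ->].
pose A0 i := ((inj None) @^-1: U' i)%VS.
(* Off [j] the spaces are those of [U']; at [j] it is the largest subspace that all arrows leaving
   [j] send into them. *)
pose A i := if i == j then (top M j :&: (io @^-1: arm A0))%VS else A0 i.
have A0E i : i != j -> (U' i = inj None @: A0 i)%VS.
  move=> ni; apply/vspaceP => w; apply/idP/memv_imgP => [wU|[v vA ->]]; last first.
    by rewrite memv_preim.
  have := subvP (ht i) _ wU; rewrite /= /top' (negPf ni) => /mem_none_img[v _ e].
  by exists v => //; rewrite -memv_preim -e.
have A0t i : i != j -> (A0 i <= top M i)%VS.
  move=> ni; apply/subvP => v; rewrite -memv_preim => /(subvP (ht i)).
  by rewrite /= /top' (negPf ni) mem_ffun_inj.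
have A0b i : i != j -> (bot M i <= A0 i)%VS.
  move=> ni; apply/subvP => v vb; rewrite -memv_preim (subvP (hb i)) //=.
  by rewrite /bot' (negPf ni) mem_ffun_inj.
have armA : arm A0 = arm A.
  apply/eqP; rewrite eqEsubv; apply/andP; split; apply/subvP => w /armvP[h1 h2 h3];
  apply/armvP; split=> // l a; have := h2 l a; rewrite /A;
  by case: eqP => // e; subst l; case: (no_loop hj a).
have botA : (arm (bot M) <= arm A0)%VS.
  apply/subvP => w /armvP[h1 h2 h3]; apply/armvP; split=> // l a.
  have [e|nl] := eqVneq l j; first by subst l; case: (no_loop hj a).
  exact: (subvP (A0b l nl)).
have subA : is_sub A.
  split=> [i|i|l i b v].
  - rewrite /A; have [->|ni] := eqVneq i j; last exact: A0b.
    apply/subvP => v vb; apply/memv_capP; split; first exact: (subvP (bot_top M j)).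
    rewrite -memv_preim (subvP botA) //; apply/iota_armv => l a; exact: arr_bot.
  - by rewrite /A; have [->|ni] := eqVneq i j; [exact: capvSl|exact: A0t].
  - rewrite /A; have [el|nl] := eqVneq l j.
      subst l; have [ei|ni] := eqVneq i j; first by subst i; case: (no_loop hj b).
      case/memv_capP=> vt; rewrite -memv_preim => /iota_armv/(_ i (star b)).
      by rewrite starK.
    rewrite -memv_preim => vU; have := hs l i b _ vU; rewrite /= xE /low_arr_fun.
    rewrite (negPf nl) inj_none; have [ei|ni] := eqVneq i j; last by rewrite memv_preim.
    subst i => hU; apply/memv_capP; split.
      by apply: arr_top; apply: (subvP (A0t l nl)); rewrite -memv_preim.
    rewrite -memv_preim; apply/iota_armv => l' a.
    have := hs _ _ (star a) _ hU; rewrite /= xE /low_arr_fun eqxx.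
    have [el|nl'] := eqVneq l' j; first by subst l'; case: (no_loop hj a).
    by rewrite pi_inj [arr M b (_ *: _)]linearZ scalerA sgn_sqr scale1r memv_preim.
exists (qdim A).
exists (qdim (M := M') U' j - (\sum_i #|arrow i j|%:Z * qdim A i - qdim A j)).
split; first by exists A.
  apply: reflect_dims => [i ni|]; last by rewrite addrC subrK.
  by rewrite !ffunE /= /bot' /A (negPf ni) A0E // !dim_ffun_inj.
have := key (arm A0) _ erefl.
rewrite armA dim_arm_diff -armA => e.
have -> : qdim A j = (\dim (top M j :&: (io @^-1: arm A0))%VS)%:Z - (\dim (bot M j))%:Z.
  by rewrite ffunE /A eqxx.
rewrite -e ffunE /= /bot' eqxx subr_ge0 lerD2r lez_nat dimvS //.
rewrite subv_add; apply/andP; split; last first.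
  by apply: subv_trans (hb j); rewrite /= /bot' eqxx addvSr.
apply/subvP => w wA; rewrite (armv_sum wA) rpred_sum // => l _.
rewrite rpred_sum // => a _; have /armvP[_ h _] := wA.
have := h l a; rewrite -memv_preim => /(hs l j a); rewrite /= xE /low_arr_fun eqxx.
by rewrite inj_none linearZ => /(memvZ (sgn a)%:~R); rewrite scalerA sgn_sqr scale1r.
Qed.

(** Dual to the cokernel case: surjectivity of [pj] gives the kernel the reflected dimension, and a
    subrepresentation at [j] is confined to the vectors that arrows send into its other spaces,
    whence [c <= 0]. *)
Lemma high_reflection :
  (pj @: arm (top M) + bot M j = top M j)%VS ->
  exists2 M' : qrep k Q, dimq M' = reflection j (dimq M) &
    forall b', has_sub M' b' -> exists b c,
      [/\ has_sub M b, b' = reflection j b + scale_vec c (unit_vec j) & c <= 0].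
Proof.
move=> hsurj.
pose x' l i (b : arrow l i) := projT1 (cid (high_arr_ex b)).
have xE l i (b : arrow l i) w : x' l i b w = high_arr_fun b w.
  by rewrite /x'; case: cid => g /= ->.
pose top' i := if i == j then (arm (top M) :&: (pj @^-1: bot M j))%VS
               else (inj None @: top M i)%VS.
pose bot' i := if i == j then arm (bot M) else (inj None @: bot M i)%VS.
have pj_bot w : w \in arm (bot M) -> pj w \in bot M j.
  by apply: pi_armv => l a u; apply: arr_bot.
have io_bot v : v \in bot M j -> io v \in arm (bot M).
  by move=> vb; apply/iota_armv => l a; apply: arr_bot.
have bt i : (bot' i <= top' i)%VS.
  rewrite /bot' /top'; case: eqP => _; last exact/limgS/bot_top.
  apply/subvP => w wb; apply/memv_capP; split.
    by apply: (subvP (armvS j _)) wb => l; apply: bot_top.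
  by rewrite mem_pi_preim pj_bot.
have at_ok l i (b : arrow l i) w : w \in top' l -> x' l i b w \in top' i.
  rewrite xE /top' /high_arr_fun; have [ei|ni] := eqVneq i j.
    subst i; have [el|nl] := eqVneq l j; first by subst l; case: (no_loop hj b).
    case/mem_none_img => v vt ->; rewrite inj_none.
    have bvt := arr_top b vt; apply/memv_capP; split.
      by apply/iota_armv => l' a; apply: arr_top.
    by rewrite mem_pi_preim pi_iota.
  have [el|nl] := eqVneq l j.
    by subst l => /memv_capP[/armvP[_ h _] _]; rewrite memv_img.
  by case/mem_none_img => v vt ->; rewrite inj_none memv_img // arr_top.
have ab_ok l i (b : arrow l i) w : w \in bot' l -> x' l i b w \in bot' i.
  rewrite xE /bot' /high_arr_fun; have [ei|ni] := eqVneq i j.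
    subst i; have [el|nl] := eqVneq l j; first by subst l; case: (no_loop hj b).
    case/mem_none_img => v vt ->; rewrite inj_none.
    by apply: io_bot; apply: arr_bot.
  have [el|nl] := eqVneq l j.
    by subst l => /armvP[_ h _]; rewrite memv_img.
  by case/mem_none_img => v vt ->; rewrite inj_none memv_img // arr_bot.
have mb_ok i w : w \in top' i ->
    \sum_l \sum_(a : arrow l i) (sgn a)%:~R *: x' l i a (x' i l (star a) w) \in bot' i.
  rewrite /top' /bot'; have [ei|ni] := eqVneq i j.
    subst i => /memv_capP[wt]; rewrite mem_pi_preim => wb.
    have -> : \sum_l \sum_(a : arrow l j) (sgn a)%:~R *:
        x' l j a (x' j l (star a) w) = io (pj w).
      rewrite piE linear_sum; apply: eq_bigr => l _.
      rewrite linear_sum; apply: eq_bigr => a _.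
      rewrite !xE /high_arr_fun eqxx [RHS]linearZ; case: eqVneq => [el|nl].
        by subst l; case: (no_loop hj a).
      by rewrite inj_none starK.
    exact: io_bot.
  case/mem_none_img => v vt ->.
  have -> : \sum_l \sum_(a : arrow l i) (sgn a)%:~R *:
      x' l i a (x' i l (star a) (inj None v)) =
      inj None (\sum_l \sum_(a : arrow l i) (sgn a)%:~R *:
        arr M a (arr M (star a) v)).
    rewrite linear_sum; apply: eq_bigr => l _.
    rewrite linear_sum; apply: eq_bigr => a _.
    rewrite !xE /high_arr_fun (negPf ni) [RHS]linearZ; congr (_ *: inj None _).
    have [el|nl] := eqVneq l j; last by rewrite !inj_none.
    by subst l; rewrite iota_at starK inj_none.
  by rewrite memv_img // moment_bot.
pose M' := QRep bt at_ok ab_ok mb_ok.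
have key (Tx : {vspace E'}) :
    (\dim (Tx :&: (pj @^-1: bot M j))%VS)%:Z - (\dim (arm (bot M)))%:Z =
    (\dim Tx)%:Z - (\dim (arm (bot M)))%:Z -
        ((\dim (pj @: Tx + bot M j)%VS)%:Z - (\dim (bot M j))%:Z).
  have := dim_pi_fibre j Tx (bot M j).
  move=> /(congr1 Posz); rewrite !PoszD; lra.
exists M'.
  apply/eqP; rewrite -[X in _ == X]addr0.
  have -> : (0 : {ffun Q -> int}) = scale_vec 0 (unit_vec j).
    by apply/ffunP => i; rewrite !ffunE mul0r.
  apply/eqP/reflect_dims => [i ni|].
    by rewrite !ffunE /= /top' /bot' (negPf ni) !dim_ffun_inj.
  rewrite addr0 -dim_arm_diff /dimq !ffunE /= /top' /bot' eqxx.
  by rewrite key hsurj.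
move=> b' [U' [hb ht hs] ->].
pose A0 i := ((inj None) @^-1: U' i)%VS.
(* Here the space at [j] is the smallest one that contains [bot] and receives all arrows from the
   chosen spaces. *)
pose A i := if i == j then (pj @: arm A0 + bot M j)%VS else A0 i.
have A0E i : i != j -> (U' i = inj None @: A0 i)%VS.
  move=> ni; apply/vspaceP => w; apply/idP/memv_imgP => [wU|[v vA ->]]; last first.
    by rewrite memv_preim.
  have := subvP (ht i) _ wU; rewrite /= /top' (negPf ni) => /mem_none_img[v _ e].
  by exists v => //; rewrite -memv_preim -e.
have A0t i : i != j -> (A0 i <= top M i)%VS.
  move=> ni; apply/subvP => v; rewrite -memv_preim => /(subvP (ht i)).
  by rewrite /= /top' (negPf ni) mem_ffun_inj.
have A0b i : i != j -> (bot M i <= A0 i)%VS.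
  move=> ni; apply/subvP => v vb; rewrite -memv_preim (subvP (hb i)) //=.
  by rewrite /bot' (negPf ni) mem_ffun_inj.
have armA : arm A0 = arm A.
  apply/eqP; rewrite eqEsubv; apply/andP; split; apply/subvP => w /armvP[h1 h2 h3];
  apply/armvP; split=> // l a; have := h2 l a; rewrite /A;
  by case: eqP => // e; subst l; case: (no_loop hj a).
have topA w : w \in arm A0 -> w \in arm (top M).
  move=> /armvP[h1 h2 h3]; apply/armvP; split=> // l a.
  have [e|nl] := eqVneq l j; first by subst l; case: (no_loop hj a).
  exact: (subvP (A0t l nl)).
have arm_out i (b : arrow j i) w : i != j -> w \in arm A0 ->
    arr M b (pj w) \in A0 i.
  move=> ni /armvP[_ hw _]; rewrite piE linear_sum rpred_sum // => l _.
  rewrite linear_sum rpred_sum // => a _; rewrite linearZ memvZ //.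
  have := hw l a; rewrite -memv_preim => /(hs _ _ a).
  rewrite /= xE /high_arr_fun eqxx inj_none => /(hs _ _ b).
  rewrite /= xE /high_arr_fun (negPf ni) eqxx iota_at starK.
  by rewrite memv_preim.
have subA : is_sub A.
  split=> [i|i|l i b v].
  - by rewrite /A; have [->|ni] := eqVneq i j; [exact: addvSr|exact: A0b].
  - rewrite /A; have [->|ni] := eqVneq i j; last exact: A0t.
    rewrite subv_add bot_top andbT; apply/subvP => _ /memv_imgP[w wA ->].
    by apply: (pi_armv _ (topA _ wA)) => l a u; apply: arr_top.
  - rewrite /A; have [el|nl] := eqVneq l j.
      subst l; have [ei|ni] := eqVneq i j; first by subst i; case: (no_loop hj b).
      case/memv_addP=> _ /memv_imgP[w wA ->] [u ub ->].
      rewrite linearD memvD ?arm_out //.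
      by apply: (subvP (A0b i ni)); apply: arr_bot.
    have [ei|ni] := eqVneq i j; last first.
      rewrite -memv_preim => vU; have := hs l i b _ vU; rewrite /= xE /high_arr_fun.
      by rewrite (negPf nl) (negPf ni) inj_none memv_preim.
    subst i => vA; apply: (subvP (addvSl _ _)).
    have -> : arr M b v = pj (inj (at_ b) ((sgn b)%:~R *: v)).
      by rewrite pi_inj [arr M b (_ *: _)]linearZ scalerA sgn_sqr scale1r.
    by rewrite memv_img // inj_armv // memvZ.
exists (qdim A).
exists (qdim (M := M') U' j - (\sum_i #|arrow i j|%:Z * qdim A i - qdim A j)).
split; first by exists A.
  apply: reflect_dims => [i ni|]; last by rewrite addrC subrK.
  by rewrite !ffunE /= /bot' /A (negPf ni) A0E // !dim_ffun_inj.
have := key (arm A0).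
rewrite armA dim_arm_diff -armA => e.
have -> : qdim A j = (\dim (pj @: arm A0 + bot M j)%VS)%:Z - (\dim (bot M j))%:Z.
  by rewrite ffunE /A eqxx.
rewrite -e ffunE /= /bot' eqxx subr_le0 lerD2r lez_nat dimvS //.
have top_j w : w \in U' j -> pj w \in bot M j /\ w \in arm (top M).
  move/(subvP (ht j)); rewrite /= /top' eqxx => /memv_capP[? h]; split=> //.
  by rewrite -mem_pi_preim.
apply/subvP => w wU; have [wb wt] := top_j _ wU; apply/memv_capP; split; last first.
  by rewrite mem_pi_preim.
case/armvP: wt => h1 _ h3; apply/armvP; split=> // l a.
have := hs j l (star a) _ wU; rewrite /= xE /high_arr_fun eqxx starK.
have [el|nl] := eqVneq l j; first by subst l; case: (no_loop hj a).
by rewrite memv_preim.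
Qed.

(** The kernel of [io] is a subrepresentation concentrated at [j], so it vanishes if [t j < 0]; the
    cokernel of [pj] is a quotient concentrated at [j], so it vanishes if [0 < t j]. In both cases
    the defect [c] has the sign opposite to [t j]. *)
Lemma semi_reflection (t : {ffun Q -> rat}) : semi t M -> t j != 0 ->
  exists2 M' : qrep k Q, dimq M' = reflection j (dimq M) &
    forall b', has_sub M' b' -> exists b c,
      [/\ has_sub M b, b' = reflection j b + scale_vec c (unit_vec j)
        & c%:~R * t j <= 0].
Proof.
move=> hM tj0; have [_ hs] := hM; have [tj|tj] := ltP (t j) 0.
  have [v vt hv|M' dM' hM'] := low_reflection.
    pose U i := if i == j then (top M j :&: (io @^-1: arm (bot M)))%VS else bot M i.
    have subU : is_sub U.
      split=> [i|i|l i b u]; rewrite /U.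
      - have [->|ni] := eqVneq i j; last exact: subvv.
        apply/subvP => u ub; apply/memv_capP; split; first exact: (subvP (bot_top M j)).
        by rewrite -memv_preim; apply/iota_armv => l a; apply: arr_bot.
      - by have [->|ni] := eqVneq i j; [exact: capvSl|exact: bot_top].
      - have [el|nl] := eqVneq l j.
          subst l; have [ei|ni] := eqVneq i j; first by subst i; case: (no_loop hj b).
          case/memv_capP=> _; rewrite -memv_preim => /iota_armv/(_ i (star b)).
          by rewrite starK.
        have [ei|ni] := eqVneq i j; last exact: arr_bot.
        subst i => ub; have bub := arr_bot b ub; apply/memv_capP; split.
          exact: (subvP (bot_top M j)).
        by rewrite -memv_preim; apply/iota_armv => l' a; apply: arr_bot.
    have e : qdim U = scale_vec (qdim U j) (unit_vec j).
      apply/ffunP => i; rewrite [RHS]ffunE [unit_vec j i]ffunE.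
      have [->|ni] := eqVneq i j; first by rewrite mulr1.
      by rewrite ffunE /U (negPf ni) subrr mulr0.
    have := hs (qdim U); rewrite e pairing_scale_vec pairing_unit.
    rewrite nmulr_lge0 // -e lerz0 => /(_ (ex_intro2 _ _ U subU erefl)).
    rewrite ffunE subr_le0 lez_nat => dU.
    have sbU : (bot M j <= U j)%VS by case: subU.
    have /eqP -> : bot M j == U j by rewrite -(dimv_leqif_eq sbU) eqn_leq dU dimvS.
    rewrite /U eqxx; apply/memv_capP; split=> //.
    by rewrite -memv_preim; apply/iota_armv.
  exists M' => // b' /hM'[b [c [h1 h2 h3]]]; exists b, c; split=> //.
  by rewrite mulr_ge0_le0 ?ler0z // ltW.
have {tj}tj : 0 < t j by rewrite lt_def tj0.
have [|M' dM' hM'] := high_reflection.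
  pose U i := if i == j then (pj @: arm (top M) + bot M j)%VS else top M i.
  have subU : is_sub U.
    split=> [i|i|l i b u]; rewrite /U.
    - by have [->|ni] := eqVneq i j; [exact: addvSr|exact: bot_top].
    - have [->|ni] := eqVneq i j; last exact: subvv.
      rewrite subv_add bot_top andbT; apply/subvP => _ /memv_imgP[w wA ->].
      by apply: (pi_armv _ wA) => l a v; apply: arr_top.
    - have [ei|ni] := eqVneq i j.
        subst i; have [el|nl] := eqVneq l j; first by subst l; case: (no_loop hj b).
        move=> ut; apply: (subvP (addvSl _ _)).
        have -> : arr M b u = pj (inj (at_ b) ((sgn b)%:~R *: u)).
          by rewrite pi_inj [arr M b (_ *: _)]linearZ scalerA sgn_sqr scale1r.
        by rewrite memv_img // inj_armv // memvZ.
      have [el|nl] := eqVneq l j; last exact: arr_top.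
      subst l; case/memv_addP=> _ /memv_imgP[w wA ->] [v vb ->].
      rewrite linearD memvD //; last exact/(subvP (bot_top M i))/arr_bot.
      by apply/arr_top/(pi_armv _ wA) => l a v'; apply: arr_top.
  have e : qdim U = dimq M + scale_vec (qdim U j - dimq M j) (unit_vec j).
    apply/ffunP => i; rewrite [RHS]ffunE [scale_vec _ _ _]ffunE [unit_vec j i]ffunE.
    have [->|ni] := eqVneq i j; first by rewrite mulr1 addrC subrK.
    by rewrite !ffunE /U (negPf ni) mulr0 addr0.
  have := hs (qdim U) (ex_intro2 _ _ U subU erefl).
  rewrite e pairingDr pairing_scale_vec pairing_unit.
  have [-> _] := hM; rewrite add0r pmulr_lge0 // ler0z subr_ge0 !ffunE lerD2r lez_nat => dU.
  have sUt : (U j <= top M j)%VS by case: subU.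
  have /eqP : U j == top M j by rewrite -(dimv_leqif_eq sUt) eqn_leq dU dimvS.
  by rewrite /U eqxx.
exists M' => // b' /hM'[b [c [h1 h2 h3]]]; exists b, c; split=> //.
by rewrite mulr_le0_ge0 ?lerz0 // ltW.
Qed.

End ReflectionFunctors.

(** * Nonsplit extensions *)

Section Extensions.
Variables (k : fieldType) (Q : double_quiver) (a1 a2 : Q -> nat).
Variables (B1 : rep k a1) (B2 : rep k a2).
Arguments B1 : clear implicits.
Arguments B2 : clear implicits.
Implicit Types (b : {ffun Q -> int}).

Definition off_diag : Type := forall i j : Q, arrow i j -> 'M[k]_(a2 j, a1 i).

Definition ext_rep (xi : off_diag) : rep k (fun i => (a2 i + a1 i)%N) :=
  fun i j a => block_mx (B2 i j a) (xi i j a) 0 (B1 i j a).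

(** The off-diagonal block of the moment map of [ext_rep xi]. It is linear in [xi], so the moment
    equation cuts out a vector space of cocycles. *)
Definition ext_moment (xi : off_diag) (i : Q) : 'M[k]_(a2 i, a1 i) :=
  \sum_j \sum_(a : arrow j i) (sgn a)%:~R *:
    (B2 j i a *m xi i j (star a) + xi j i a *m B1 i j (star a)).

Lemma ext_rep_moment xi : moment_fibre B1 -> moment_fibre B2 ->
  (forall i, ext_moment xi i = 0) -> moment_fibre (ext_rep xi).
Proof.
move=> m1 m2 mx i; rewrite /moment.
transitivity (block_mx (moment B2 i) (ext_moment xi i) 0 (moment B1 i)); last first.
  by rewrite m1 m2 mx block_mx0.
have blockD m1' m2' n1 n2 (I : finType) (P : pred I) (F1 : I -> 'M[k]_(m1', n1))
    (F2 : I -> 'M[k]_(m1', n2)) (F4 : I -> 'M[k]_(m2', n2)) :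
    \sum_(x | P x) block_mx (F1 x) (F2 x) 0 (F4 x) =
    block_mx (\sum_(x | P x) F1 x) (\sum_(x | P x) F2 x) 0 (\sum_(x | P x) F4 x).
  elim: (index_enum I) => [|x r IH]; first by rewrite !big_nil block_mx0.
  by rewrite !big_cons IH; case: ifP => // _; rewrite add_block_mx addr0.
rewrite -blockD; apply: eq_bigr => j _; rewrite -blockD; apply: eq_bigr => a _.
by rewrite mulmx_block !mulmx0 !mul0mx !addr0 !add0r scale_block_mx scaler0.
Qed.

Lemma up_ex i : exists g : 'Hom('cV[k]_(a2 i), 'cV[k]_(a2 i + a1 i)),
  forall v, g v = col_mx v 0.
Proof.
by apply: linear_lfun => c x y; rewrite scale_col_mx add_col_mx scaler0 addr0.
Qed.

Lemma down_ex i : exists g : 'Hom('cV[k]_(a2 i + a1 i), 'cV[k]_(a1 i)),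
  forall v, g v = dsubmx v.
Proof. by apply: linear_lfun => c x y; rewrite linearP. Qed.

Lemma ext_rep_upper xi b : rep_has_sub B2 b -> rep_has_sub (ext_rep xi) b.
Proof.
case=> Y hY ->; have /dependent_choice[up upE] := up_ex.
exists (fun i => up i @: Y i)%VS.
  move=> i j a _ /memv_imgP[v vY ->].
  by rewrite upE mul_block_col !mulmx0 mul0mx !addr0 -upE memv_img // hY.
apply/ffunP => i; rewrite !ffunE limg_dim_eq //.
apply/eqP; rewrite -subv0; apply/subvP => v /memv_capP[_].
rewrite memv_ker memv0 upE -col_mx0 => /eqP/eq_col_mx[-> _]; exact: eqxx.
Qed.

(** Intersect with the lower representation and project to the upper one. If the intersection is
    zero and the projection onto, the subrepresentation is the graph of some [phi], and its
    invariance says that [xi] is the coboundary of [phi]. *)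
Lemma ext_rep_sub xi b : rep_has_sub (ext_rep xi) b -> exists b1 b2,
  [/\ rep_has_sub B1 b1, rep_has_sub B2 b2, b = b1 + b2 &
    b1 = dim_vector a1 -> b2 = 0 ->
    exists phi : forall i : Q, 'M[k]_(a2 i, a1 i),
      forall i j (a : arrow i j),
        xi i j a = phi j *m B1 i j a - B2 i j a *m phi i].
Proof.
case=> Y hY ->; have /dependent_choice[up upE] := up_ex.
have /dependent_choice[dn dnE] := down_ex.
pose Y2 i := (up i @^-1: Y i)%VS; pose Y1 i := (dn i @: Y i)%VS.
have up0 i : (Y2 i :&: lker (up i) = 0)%VS.
  apply/eqP; rewrite -subv0; apply/subvP => v /memv_capP[_].
  rewrite memv_ker memv0 upE -col_mx0 => /eqP/eq_col_mx[-> _]; exact: eqxx.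
have upY i : (up i @: Y2 i = Y i :&: lker (dn i))%VS.
  apply/eqP; rewrite eqEsubv; apply/andP; split; apply/subvP => v.
    case/memv_imgP=> x; rewrite -memv_preim => xY ->; apply/memv_capP; split=> //.
    by rewrite memv_ker dnE upE col_mxKd.
  case/memv_capP=> vY; rewrite memv_ker dnE => /eqP dv.
  have e : v = up i (usubmx v) by rewrite upE -{1}(vsubmxK v) dv.
  by rewrite e memv_img // -memv_preim -e.
have dimY i : \dim (Y i) = (\dim (Y2 i) + \dim (Y1 i))%N.
  by rewrite -(limg_ker_dim (dn i) (Y i)) -upY limg_dim_eq.
have actE i j a (v : 'cV_(a2 i + a1 i)) : ext_rep xi a *m v =
    col_mx (B2 i j a *m usubmx v + xi i j a *m dsubmx v) (B1 i j a *m dsubmx v).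
  by rewrite -{1}(vsubmxK v) mul_block_col mul0mx add0r.
exists (rdim Y1), (rdim Y2); split.
- exists Y1 => // i j a _ /memv_imgP[v vY ->].
  have -> : B1 i j a *m dn i v = dn j (ext_rep xi a *m v).
    by rewrite actE !dnE col_mxKd.
  by rewrite memv_img // hY.
- exists Y2 => // i j a v; rewrite -!memv_preim => /(hY i j a).
  by rewrite actE !upE col_mxKu col_mxKd !mulmx0 addr0.
- by apply/ffunP => i; rewrite !ffunE dimY PoszD addrC.
move=> h1 h2.
have full i (u : 'cV_(a1 i)) : exists2 v, v \in Y i & dn i v = u.
  have /eqP Y1f : Y1 i == fullv.
    rewrite -(dimv_leqif_eq (subvf _)) dimvf /dim /= muln1.
    by have := congr1 (fun d : {ffun Q -> int} => d i) h1; rewrite !ffunE => -[->].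
  have : u \in Y1 i by rewrite Y1f memvf.
  by case/memv_imgP=> v vY ->; exists v.
have zero i x : up i x \in Y i -> x = 0.
  have /eqP : \dim (Y2 i) = 0%N.
    by have := congr1 (fun d : {ffun Q -> int} => d i) h2; rewrite !ffunE => -[->].
  by rewrite dimv_eq0 memv_preim => /eqP; rewrite -/(Y2 i) => ->; rewrite memv0 => /eqP.
have graph i : exists p : 'M[k]_(a2 i, a1 i), forall u, col_mx (p *m u) u \in Y i.
  have /choice[g hg] : forall s, exists v, v \in Y i /\ dn i v = delta_mx s 0.
    by move=> s; have [v] := full i (delta_mx s 0); exists v.
  exists (\matrix_(x, s) usubmx (g s) x 0) => u.
  suff -> : col_mx ((\matrix_(x, s) usubmx (g s) x 0) *m u) u = \sum_s u s 0 *: g s.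
    by rewrite rpred_sum // => s _; rewrite memvZ //; case: (hg s).
  rewrite -[RHS]vsubmxK; congr col_mx.
    apply/matrixP => x z; rewrite ord1 linear_sum [LHS]mxE summxE; apply: eq_bigr => s _.
    by rewrite linearZ !mxE mulrC.
  rewrite {1}(colmx_sum_delta u) linear_sum; apply: eq_bigr => s _.
  by rewrite linearZ /= -dnE; case: (hg s) => _ ->.
have {graph}/dependent_choice[phi hphi] := graph.
exists phi => i j a; apply: mulmx_cv_inj => u; rewrite mulmxBl -!mulmxA.
have := hY i j a _ (hphi i u); rewrite actE col_mxKu col_mxKd => h.
have := memvB h (hphi j (B1 i j a *m u)).
rewrite opp_col_mx add_col_mx subrr -upE => /zero/eqP.
by rewrite subr_eq0 -(inj_eq (addrI (- (B2 i j a *m (phi i *m u))))) addKr addrC => /eqP.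
Qed.

Definition xi_index : finType := {l : Q & {i : Q & (arrow l i * 'I_(a2 i) * 'I_(a1 l))%type}}.
Definition phi_index : finType := {i : Q & ('I_(a2 i) * 'I_(a1 i))%type}.
Local Notation X0 := {ffun xi_index -> k^o}.
Local Notation Y0 := {ffun phi_index -> k^o}.

Definition xi_of (w : X0) : off_diag :=
  fun l i a => \matrix_(s, t) (w (existT _ l (existT _ i (a, s, t))) : k).
Definition phi_of (y : Y0) (i : Q) : 'M[k]_(a2 i, a1 i) :=
  \matrix_(s, t) (y (existT _ i (s, t)) : k).

Lemma xi_ofP c w w' l i (a : arrow l i) :
  xi_of (c *: w + w') a = c *: xi_of w a + xi_of w' a.
Proof. by apply/matrixP => s t; rewrite !mxE !ffunE. Qed.

Lemma phi_ofP c y y' i : phi_of (c *: y + y') i = c *: phi_of y i + phi_of y' i.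
Proof. by apply/matrixP => s t; rewrite !mxE !ffunE. Qed.

Lemma dim_ffun_regular (I : finType) : dim {ffun I -> k^o} = #|I|.
Proof. by rewrite /dim /= muln1. Qed.

(* The extensions of [B1] by [B2] form the middle cohomology of a complex
   Hom -> (+)_a Hom -> Hom; the outer terms are too small to kill it. *)
Lemma nonsplit_cocycle :
  sym_form (dim_vector a1) (dim_vector a2) < 0 ->
  exists2 xi : off_diag, forall i, ext_moment xi i = 0 &
    ~ exists phi : forall i : Q, 'M[k]_(a2 i, a1 i), forall i j (a : arrow i j),
        xi i j a = phi j *m B1 i j a - B2 i j a *m phi i.
Proof.
move=> neg.
have [|d1 d1E] := @linear_lfun k X0 Y0 (fun w =>
    [ffun p : phi_index => let: existT i q := p in ext_moment (xi_of w) i q.1 q.2]).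
  move=> c w w'; apply/ffunP => -[i [s t]]; rewrite !ffunE /=.
  suff -> : ext_moment (xi_of (c *: w + w')) i =
      c *: ext_moment (xi_of w) i + ext_moment (xi_of w') i by rewrite !mxE.
  rewrite /ext_moment scaler_sumr -big_split; apply: eq_bigr => j _.
  rewrite scaler_sumr -big_split; apply: eq_bigr => a _ /=.
  rewrite !xi_ofP mulmxDr mulmxDl -scalemxAr -scalemxAl addrACA -scalerDr [LHS]scalerDr.
  by congr (_ + _); rewrite !scalerA mulrC.
have [|d0 d0E] := @linear_lfun k Y0 X0 (fun y =>
    [ffun p : xi_index => let: existT l (existT i (a, s, t)) := p in
      (phi_of y i *m B1 l i a - B2 l i a *m phi_of y l) s t]).
  move=> c y y'; apply/ffunP => -[l [i [[a s] t]]]; rewrite !ffunE.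
  rewrite !phi_ofP mulmxDr mulmxDl -scalemxAr -scalemxAl !mxE.
  by rewrite /GRing.scale /=; ring.
have cX : #|xi_index| = (\sum_l \sum_i #|arrow l i| * (a2 i * a1 l))%N.
  rewrite card_tagged sumnE big_map big_enum; apply: eq_bigr => l _ /=.
  rewrite card_tagged sumnE big_map big_enum; apply: eq_bigr => i _ /=.
  by rewrite !card_prod !card_ord mulnA.
have cY : #|phi_index| = (\sum_i a2 i * a1 i)%N.
  rewrite card_tagged sumnE big_map big_enum; apply: eq_bigr => i _ /=.
  by rewrite !card_prod !card_ord.
(* The difference [2 * #|phi_index| - #|xi_index|] is the value of the symmetric form. *)
have lt_XY : (#|phi_index| + #|phi_index| < #|xi_index|)%N.
  move: neg; rewrite sym_formE subr_lt0 cX cY.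
  have -> : \sum_i dim_vector a1 i * dim_vector a2 i = (\sum_i a2 i * a1 i)%N%:Z.
    by rewrite Posz_sum; apply: eq_bigr => i _; rewrite !ffunE PoszM mulrC.
  have -> : \sum_i \sum_l #|arrow i l|%:Z * (dim_vector a1 i * dim_vector a2 l) =
      (\sum_i \sum_l #|arrow i l| * (a2 l * a1 i))%N%:Z.
    rewrite Posz_sum; apply: eq_bigr => i _; rewrite Posz_sum; apply: eq_bigr => l _.
    by rewrite !ffunE !PoszM [(a2 l)%:Z * _]mulrC.
  by rewrite -(PoszM 2) ltz_nat mul2n addnn.
(* The kernel of [d1] has dimension at least [#|xi_index| - #|phi_index|], which exceeds
   [#|phi_index|] and hence the dimension of the image of [d0]. *)
have /subvPn[w wk wi] : ~~ (lker d1 <= limg d0)%VS.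
  apply/negP => /dimvS le1.
  have := limg_ker_dim d1 fullv; rewrite capfv dimvf dim_ffun_regular => e1.
  have e2 := limg_ker_dim d0 fullv; rewrite capfv dimvf dim_ffun_regular in e2.
  have e3 : (\dim (limg d1) <= #|phi_index|)%N.
    by rewrite -dim_ffun_regular -dimvf dimvS ?subvf.
  move: e1 e2 e3 le1 lt_XY.
  move: (\dim _) (\dim _) (\dim _) (\dim _) => x1 x2 x3 x4; lia.
exists (xi_of w).
  move=> i; apply/matrixP => s t; move: wk; rewrite memv_ker d1E => /eqP.
  by move/(congr1 (fun y : Y0 => y (existT _ i (s, t)))); rewrite !ffunE mxE.
case=> phi hphi; case/negP: wi; apply/memv_imgP.
exists [ffun p : phi_index => let: existT i q := p in phi i q.1 q.2]; first exact: memvf.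
rewrite d0E; apply/ffunP => -[l [i [[a s] t]]]; rewrite ffunE.
have -> : w (existT _ l (existT _ i (a, s, t))) = xi_of w a s t by rewrite mxE.
rewrite hphi.
have phiE v : phi_of [ffun p : phi_index => let: existT i q := p in phi i q.1 q.2] v = phi v.
  by apply/matrixP => x z; rewrite mxE ffunE.
by rewrite !phiE.
Qed.

End Extensions.

Section QrepExtensions.
Variables (k : fieldType) (Q : double_quiver).
Implicit Types (M : qrep k Q) (b : {ffun Q -> int}).

Lemma dimq_vector M : exists a : Q -> nat, dimq M = dim_vector a.
Proof.
exists (fun i => `|dimq M i|%N); apply/ffunP => i.
by rewrite [RHS]ffunE gez0_abs // dimq_ge0.
Qed.

Lemma dim_vectorD (a1 a2 : Q -> nat) :
  dim_vector (fun i => (a2 i + a1 i)%N) = dim_vector a1 + dim_vector a2.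
Proof. by apply/ffunP => i; rewrite !ffunE PoszD addrC. Qed.

Lemma rep_has_sub_full (a : Q -> nat) (B : rep k a) : rep_has_sub B (dim_vector a).
Proof.
exists (fun i => fullv) => [i j x v _|]; first exact: memvf.
by apply/ffunP => i; rewrite !ffunE dimvf /dim /= muln1.
Qed.

Lemma direct_sum M1 M2 : exists M',
  [/\ dimq M' = dimq M1 + dimq M2, has_sub M' (dimq M2) &
    forall b, has_sub M' b -> exists b1 b2,
      [/\ has_sub M1 b1, has_sub M2 b2 & b = b1 + b2]].
Proof.
have [a1 e1] := dimq_vector M1; have [a2 e2] := dimq_vector M2.
have [B1 m1 s1] := rep_of_qrep e1; have [B2 m2 s2] := rep_of_qrep e2.
pose xi : off_diag k a1 a2 := fun i j a => 0.
have mxi i : ext_moment B1 B2 xi i = 0.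
  rewrite /ext_moment big1 // => j _; rewrite big1 // => a _.
  by rewrite mulmx0 mul0mx addr0 scaler0.
have [M' dM' sM'] := qrep_of_rep (ext_rep_moment m1 m2 mxi).
exists M'; split; first by rewrite dM' dim_vectorD e1 e2.
  by apply/sM'/ext_rep_upper; rewrite e2; apply: rep_has_sub_full.
move=> b /sM'/ext_rep_sub[b1 [b2 [/s1 h1 /s2 h2 e _]]].
by exists b1, b2.
Qed.

(** The pair excluded at the end is the dimension of a complement to [M2], which would split the
    cocycle. *)
Lemma nonsplit_extension M1 M2 : sym_form (dimq M1) (dimq M2) < 0 -> exists M',
  [/\ dimq M' = dimq M1 + dimq M2, has_sub M' (dimq M2) &
    forall b, has_sub M' b -> exists b1 b2,
      [/\ has_sub M1 b1, has_sub M2 b2, b = b1 + b2 & ~ (b1 = dimq M1 /\ b2 = 0)]].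
Proof.
have [a1 e1] := dimq_vector M1; have [a2 e2] := dimq_vector M2.
have [B1 m1 s1] := rep_of_qrep e1; have [B2 m2 s2] := rep_of_qrep e2.
rewrite e1 e2 => /(nonsplit_cocycle B1 B2)[xi mxi nxi].
have [M' dM' sM'] := qrep_of_rep (ext_rep_moment m1 m2 mxi).
exists M'; split; first by rewrite dM' dim_vectorD.
  by apply/sM'/ext_rep_upper; apply: rep_has_sub_full.
move=> b /sM'/ext_rep_sub[b1 [b2 [/s1 h1 /s2 h2 e hn]]].
by exists b1, b2; split=> // -[x y]; apply: nxi; apply: hn.
Qed.

End QrepExtensions.

(** * Semistable representations and positive roots *)

Section Existence.
Variables (k : fieldType) (Q : double_quiver).
Implicit Types (M : qrep k Q) (b c : {ffun Q -> int}) (t h : {ffun Q -> rat}).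

Definition height b : int := \sum_i b i.

Lemma heightD b c : height (b + c) = height b + height c.
Proof. by rewrite /height -big_split; apply: eq_bigr => i _; rewrite ffunE. Qed.

Lemma le_height_eq b c : (forall i, b i <= c i) -> height c <= height b -> b = c.
Proof.
move=> hle hh; have : \sum_i (c i - b i) == 0.
  by rewrite eq_le sumr_ge0 ?andbT ?sumrB ?subr_le0 // => i _; rewrite subr_ge0.
rewrite psumr_eq0 => [/allP h|i _]; last by rewrite subr_ge0.
apply/ffunP => i; have := h i (mem_index_enum _).
by rewrite /= subr_eq0 => /eqP.
Qed.

Lemma height_gt0 b : (forall i, 0 <= b i) -> b <> 0 -> 0 < height b.
Proof.
move=> h0 nz; rewrite ltNge; apply/negP => hb; apply: nz; symmetry.
apply: le_height_eq => [i|]; first by rewrite ffunE.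
by rewrite {2}/height big1 // => i _; rewrite ffunE.
Qed.

Lemma vec_bound b : exists N : nat, forall i, b i <= N%:Z.
Proof.
exists (\sum_i `|b i|)%N => i; rewrite (bigD1 i) //= PoszD.
by rewrite (le_trans (ler_norm _)) // -abszE lerDl.
Qed.

Lemma exists_dimq (a : Q -> nat) : exists M : qrep k Q, dimq M = dim_vector a.
Proof.
have [|M dM _] := @qrep_of_rep k Q a (fun i j x => 0); last by exists M.
move=> i; rewrite /moment big1 // => j _; rewrite big1 // => x _.
by rewrite mul0mx scaler0.
Qed.

Lemma exists_dimq_ge0 b : (forall i, 0 <= b i) -> exists M : qrep k Q, dimq M = b.
Proof.
move=> hb; have [M dM] := exists_dimq (fun i => `|b i|%N); exists M.
by rewrite dM; apply/ffunP => i; rewrite ffunE gez0_abs.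
Qed.

Section Improvement.
Variables (t0 t : {ffun Q -> rat}) (al : {ffun Q -> int}).
Hypothesis neg : forall b, (forall i, 0 <= b i <= al i) -> pairing t0 b = 0 ->
  pairing t b < 0 -> sym_form b (al - b) < 0.
Hypothesis tal : pairing t al = 0.

Let unstable M : Prop := [/\ semi t0 M, dimq M = al &
  exists b, [/\ has_sub M b, pairing t0 b = 0 & pairing t b < 0]].

Let lexmin M b : Prop := [/\ has_sub M b, pairing t0 b = 0, pairing t b < 0 &
  forall c, has_sub M c -> pairing t0 c = 0 ->
    pairing t b <= pairing t c /\
    (pairing t c = pairing t b -> height b <= height c)].

Let lexmin_ex M : unstable M -> exists b, lexmin M b.
Proof.
case=> ss dM [b0 [h1 h2 h3]]; have [N hN] := vec_bound al.
pose P b := has_sub M b /\ pairing t0 b = 0.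
have PN b : P b -> forall i, 0 <= b i <= N%:Z.
  case=> hb _ i; have /andP[-> hle] := has_sub_bounds hb i.
  by rewrite (le_trans hle) // dM.
have [|b1 [s1 z1] m1] := box_max (P := P) (fun b => - pairing t b) PN.
  by exists b0.
pose P' b := P b /\ pairing t b = pairing t b1.
have [b [hP _]||b2 [[s2 z2] e2] m2] :=
    box_max (P := P') (N := N) (fun b => - (height b)%:~R).
- exact: PN.
- by exists b1.
exists b2; split=> //.
  rewrite e2; apply: le_lt_trans h3; rewrite -lerN2; exact: m1.
move=> c sc zc; split; first by rewrite e2 -lerN2; apply: m1.
move=> ec; rewrite -(ler_int rat) -lerN2; apply: m2; split=> //.
by rewrite ec.
Qed.

(* Extend the most destabilising subrepresentation of smallest dimension by the
   corresponding quotient the other way round; among all unstable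
   representations this raises the pair ([t]-value, height) of that
   subrepresentation, so a representation where the pair is maximal is turned
   into a semistable one. *)
Lemma improvement : (exists M, unstable M) -> exists M,
  [/\ semi t0 M, dimq M = al,
      forall b, has_sub M b -> pairing t0 b = 0 -> 0 <= pairing t b &
      exists b, [/\ has_sub M b, pairing t0 b = 0 & 0 < pairing t b]].
Proof.
case=> M0 uM0; have [N hN] := vec_bound al.
pose P b := exists2 M, unstable M & lexmin M b.
have PN b : P b -> forall i, 0 <= b i <= N%:Z.
  case=> M [_ dM _] [hb _ _ _] i; have /andP[-> hle] := has_sub_bounds hb i.
  by rewrite (le_trans hle) // dM.
have [|b1 P1 m1] := box_max (P := P) (fun b => pairing t b) PN.
  by have [b hb] := lexmin_ex uM0; exists b, M0.
pose P' b := P b /\ pairing t b = pairing t b1.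
have [b [hP _]||b2 [[M uM [s2 z2 n2 min2]] e2] m2] :=
    box_max (P := P') (N := N) (fun b => (height b)%:~R).
- exact: PN.
- by exists b1.
have [ss dM _] := uM; case: (s2) => U sU eU.
have bd := has_sub_bounds s2; rewrite dM in bd.
have hneg : sym_form (dimq (subq sU)) (dimq (quotq sU)) < 0.
  by rewrite dimq_subq dimq_quotq -eU dM; apply: neg.
have [M' [dM' sM' hM']] := nonsplit_extension hneg.
have {}dM' : dimq M' = al by rewrite dM' dimq_subq dimq_quotq dM addrC subrK.
have {}sM' : has_sub M' (al - b2) by rewrite -dM eU -dimq_quotq.
have tz0 : pairing t0 al = 0 by rewrite -dM; case: ss.
have ss' : semi t0 M'.
  split=> [|b /hM'[c1 [c2 [/has_sub_subq h1 /has_sub_quotq h2 -> _]]]].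
    by rewrite dM'.
  have [_ ssM] := ss; have := ssM _ h2; rewrite -eU !pairingDr z2 add0r => ?.
  by rewrite addr_ge0 // ssM.
have [hall|] := pselect (forall b, has_sub M' b -> pairing t0 b = 0 -> 0 <= pairing t b).
  exists M'; split=> //; exists (al - b2); split=> //; rewrite pairingDr pairingNr.
    by rewrite z2 tz0 subrr.
  by rewrite tal sub0r oppr_gt0.
move=> /existsNP[b' /not_implyP[sb' /not_implyP[zb' /negP]]]; rewrite -ltNge => nb'.
have uM' : unstable M' by split=> //; exists b'.
have [b3 lb3] := lexmin_ex uM'; have P3 : P b3 by exists M'.
have le3 := m1 _ P3; case: lb3 => s3 z3 n3 _.
have [c1 [c2 [hc1 hc2 e3 nsp]]] := hM' _ s3.
have [_ ssM] := ss.
have h1 := has_sub_subq hc1; have h2 := has_sub_quotq hc2; rewrite -eU in h2.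
have p1 := ssM _ h1; have p2 := ssM _ h2.
rewrite pairingDr z2 add0r in p2.
have [q1 q2] : pairing t0 c1 = 0 /\ pairing t0 c2 = 0.
  by move: z3; rewrite e3 pairingDr; split; lra.
(* Minimality of [b2] in [M] gives [t(c1) >= t(b2)] and [t(c2) >= 0], so [b3] attains the maximal
   value. Then [c1] has value [t(b2)] and lies below [b2], so it equals [b2] by minimal height;
   maximality of the height leaves [c2 = 0], which a nonsplit extension forbids. *)
have [r1 r1'] := min2 _ h1 q1.
have [r2 _] := min2 _ h2 (etrans (pairingDr _ _ _) (etrans (congr2 +%R z2 q2) (addr0 _))).
rewrite pairingDr lerDl in r2.
have et : pairing t b3 = pairing t b1.
  by move: le3; rewrite -e2 e3 pairingDr; lra.
have hle : (height b3)%:~R <= (height b2)%:~R :> rat by apply: m2; split.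
have ec1 : pairing t c1 = pairing t b2.
  by move: et; rewrite -e2 e3 pairingDr; lra.
have /le_height_eq ec : forall i, c1 i <= b2 i.
  by move=> i; have /andP[_] := has_sub_bounds hc1 i; rewrite dimq_subq -eU.
have {}ec := ec (r1' ec1).
have c20 i : 0 <= c2 i by have /andP[] := has_sub_bounds hc2 i.
case: nsp; split; first by rewrite dimq_subq -eU.
apply: contrapT => /(height_gt0 c20); move: hle.
by rewrite ler_int e3 ec heightD; lia.
Qed.

End Improvement.

Lemma proportional_pairing t b c j : (forall i l, c i * b l = c l * b i) ->
  pairing t c * (b j)%:~R = (c j)%:~R * pairing t b.
Proof.
move=> h; rewrite /pairing mulr_suml mulr_sumr; apply: eq_bigr => i _.
by rewrite -mulrA -intrM h intrM; ring.
Qed.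

(** A property that reflections preserve up to sign, so that it can be carried from unit vectors and
    the fundamental region to all roots. *)
Definition admits b : Prop := (forall i, 0 <= b i) /\
  forall t, pairing t b = 0 -> exists2 M : qrep k Q, dimq M = b & semi t M.

(** Any representation is semistable for the weight 0, so improvement starts from an arbitrary one.
    Its negativity hypothesis is Kac's identity: a nonnegative form would make the vector
    proportional to [b], on which [t] vanishes. *)
Lemma admits_fundamental b : fundamental b -> admits b.
Proof.
case=> nz pos con le0; split=> // t tb; have [M dM] := exists_dimq_ge0 pos.
have sem0 M' : semi 0 M'.
  by split=> [|c _]; rewrite pairing0l.
have [h|] := pselect (forall c, has_sub M c -> 0 <= pairing t c).
  by exists M => //; split=> //; rewrite dM.
move=> /existsNP[c /not_implyP[sc /negP]]; rewrite -ltNge => nc.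
have [|||M' [_ dM' hM' _]] := @improvement 0 t b.
- move=> c' bc' _ tc'; rewrite ltNge; apply/negP => /(kac_identity bc' con le0) pr.
  have [j bj] : exists j, b j != 0.
    apply: contrapT => hn; apply: nz; apply/ffunP => j; rewrite ffunE.
    by apply/eqP; apply: contrapT => /negP bj; apply: hn; exists j.
  have := proportional_pairing t j pr; rewrite tb mulr0 => /eqP.
  by rewrite mulf_eq0 intr_eq0 (negPf bj) orbF lt_eqF.
- by [].
- by exists M; split=> //; exists c; rewrite pairing0l.
exists M' => //; split=> [|c' sc']; first by rewrite dM'.
by apply: hM'; rewrite ?pairing0l.
Qed.

Lemma admits_unit j : loop_free j -> admits (unit_vec j).
Proof.
move=> hj; have pos i : 0 <= unit_vec j i by rewrite ffunE.
split=> // t; rewrite pairing_unit => tj; have [M dM] := exists_dimq_ge0 pos.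
exists M => //; split=> [|c /has_sub_bounds hc]; first by rewrite dM pairing_unit.
suff -> : c = scale_vec (c j) (unit_vec j).
  by rewrite pairing_scale_vec pairing_unit tj mulr0.
apply/ffunP => i; have := hc i; rewrite dM !ffunE.
by have [->|_] := eqVneq i j; rewrite ?mulr1 // mulr0 -eq_le eq_sym => /eqP.
Qed.

Definition unit_weight (j : Q) : {ffun Q -> rat} := [ffun i => (i == j)%:R].

Lemma pairing_unit_weight j b : pairing (unit_weight j) b = (b j)%:~R.
Proof.
rewrite /pairing (bigD1 j) //= big1 ?addr0; last first.
  by move=> i /negPf h; rewrite ffunE h mul0r.
by rewrite ffunE eqxx mul1r.
Qed.

Definition wedge_weight b (i j : Q) : {ffun Q -> rat} :=
  scale_weight (b j)%:~R (unit_weight i) + scale_weight (- (b i)%:~R) (unit_weight j).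

Lemma pairing_wedge b i j c :
  pairing (wedge_weight b i j) c = (b j)%:~R * (c i)%:~R - (b i)%:~R * (c j)%:~R.
Proof. by rewrite pairingDl !pairingZl !pairing_unit_weight mulNr. Qed.

Lemma wedge_weight_at b i j : i != j -> wedge_weight b i j i = (b j)%:~R.
Proof. by move=> /negPf ne; rewrite !ffunE eqxx ne mulr1 mulr0 addr0. Qed.

Lemma only_at b j : (forall l, l != j -> b l = 0) -> b = scale_vec (b j) (unit_vec j).
Proof.
move=> h; apply/ffunP => i; rewrite !ffunE.
by have [->|ne] := eqVneq i j; rewrite ?mulr1 // mulr0 h.
Qed.

Lemma not_only_at b j : ~ (forall l, l != j -> b l = 0) -> exists2 l, l != j & b l != 0.
Proof.
move=> /existsNP[l /not_implyP[lj bl]]; exists l => //; exact/eqP.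
Qed.

Lemma reflect_semi t M j : loop_free j -> semi t M -> t j != 0 ->
  exists2 M' : qrep k Q, dimq M' = reflection j (dimq M) & semi (reflect_weight j t) M'.
Proof.
move=> hj ss tj; have [M' dM' hM'] := semi_reflection hj ss tj.
exists M' => //; have [z0 h0] := ss; split.
  by rewrite dM' pairing_reflect reflectionK.
move=> _ /hM'[b [c [/h0 hb -> hc]]].
rewrite pairingDr pairing_reflect reflectionK // pairing_scale_vec pairing_unit.
by rewrite reflect_weight_at // mulrN addr_ge0 // oppr_ge0.
Qed.

(** The reflection functor handles weights with [t j != 0]; the others are limits of such weights
    inside the hyperplane, and semistability passes to the limit. A vector supported at [j] alone is
    merely negated, which is the second alternative. *)
Lemma admits_reflection b j : loop_free j -> admits b ->
  admits (reflection j b) \/ admits (- reflection j b).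
Proof.
move=> hj ad; have [pos hM] := ad.
have [/only_at e|/not_only_at[l lj bl]] := pselect (forall l, l != j -> b l = 0).
  right; suff -> : - reflection j b = b by [].
  apply/ffunP => i; rewrite {1}e [in LHS]ffunE.
  have -> : reflection j (scale_vec (b j) (unit_vec j)) = - scale_vec (b j) (unit_vec j).
    rewrite reflectionE sym_formZl loop_free_self //.
    by apply/ffunP => i'; rewrite !ffunE; ring.
  by rewrite ffunE opprK -e.
left; set b' := reflection j b.
have b'l : b' l != 0 by rewrite /b' reflection_neq.
have gen t : pairing t b' = 0 -> t j != 0 -> exists2 M : qrep k Q, dimq M = b' & semi t M.
  move=> tb' tj; have tb : pairing (reflect_weight j t) b = 0 by rewrite pairing_reflect.
  have [M dM ss] := hM _ tb.
  have [|M' dM' ss'] := reflect_semi hj ss; first by rewrite reflect_weight_at // oppr_eq0.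
  by exists M'; rewrite ?dM' ?dM //; rewrite reflect_weightK in ss'.
pose h := wedge_weight b' j l.
have hb' : pairing h b' = 0 by rewrite pairing_wedge mulrC subrr.
have hj0 : h j != 0 by rewrite wedge_weight_at ?intr_eq0 // eq_sym.
(* Nonnegativity of [b'] is read off from a representation having it as dimension vector. *)
split; first by have [M <- _] := gen h hb' hj0; apply: dimq_ge0.
move=> t tb'; have [tj|tj] := eqVneq (t j) 0; last exact: gen.
have [N hN] := vec_bound b'; have [eps e0 he] := semi_perturb k t h N%:Z.
have [|//|M dM ss] := gen (t + scale_weight eps h).
- by rewrite pairingDl pairingZl tb' hb' mulr0 addr0.
- by rewrite 2!ffunE tj add0r mulf_neq0 // gt_eqF.
exists M => //; apply: (he eps) => //; rewrite ?lexx ?(ltW e0) ?dM //.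
Qed.

Lemma admits_weyl b c : weyl_conj b c -> admits b -> admits c \/ admits (- c).
Proof.
case=> w + ->; elim: w => [|j w IH] /=; first by left.
case/andP=> hj /IH{}IH /IH[] ad; first exact: admits_reflection.
by case: (admits_reflection hj ad); rewrite reflectionN ?opprK; [right|left].
Qed.

Lemma root_admits b : is_root b -> admits b \/ admits (- b).
Proof.
case=> [[i hi /admits_weyl h]|[d /admits_fundamental ad [/admits_weyl h|/admits_weyl h]]].
- exact/h/admits_unit.
- exact: h.
- by case: (h ad); rewrite ?opprK; [right|left].
Qed.

Lemma pos_root_admits b : pos_root b -> admits b.
Proof.
case=> /root_admits[//|[neg h]] pos; suff e : b = - b by rewrite e.
apply/ffunP => i; have n := neg i; rewrite ffunE oppr_ge0 in n.
have e : b i = 0 by apply: le_anti; rewrite n pos.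
by rewrite ffunE e oppr0.
Qed.

End Existence.

(** * Signs, connectedness and sums of positive roots *)

Section PositiveRoots.
Variable Q : double_quiver.
Implicit Types (b c : {ffun Q -> int}) (t h : {ffun Q -> rat}) (j : Q).
Local Notation e_ i := (unit_vec i).

Lemma weyl_conj_neq0 b c : weyl_conj b c -> c = 0 -> b = 0.
Proof.
case=> w + ->; elim: w => //= j w IH /andP[hj /IH{}IH] e; apply: IH.
by rewrite -[LHS](reflectionK hj) e reflection0.
Qed.

Lemma pos_root_neq0 b : pos_root b -> b <> 0.
Proof.
case=> -[[j hj /weyl_conj_neq0 w]|[d [nz _ _ _] [/weyl_conj_neq0 w|/weyl_conj_neq0 w]]] _ b0.
- by have /(congr1 (fun c : {ffun Q -> int} => c j)) := w b0; rewrite !ffunE eqxx.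
- exact: nz (w b0).
- by apply: nz; apply: w; rewrite b0 oppr0.
Qed.

(** Every root is of one sign, since it or its negative is the dimension vector of a representation,
    here over [rat]. If the reflection were negative, [b] would be a multiple of [e_ j], and the
    norm of a root leaves only [e_ j] itself. *)
Lemma pos_root_reflection j b : loop_free j -> pos_root b -> b <> e_ j ->
  pos_root (reflection j b).
Proof.
move=> hj [rb pos] ne; have rs := is_root_reflection hj rb; split=> //.
case: (root_admits rat rs) => -[] // neg _.
have at_j l : l != j -> b l = 0.
  move=> lj; have := neg l; rewrite ffunE reflection_neq // oppr_ge0 => n.
  by apply: le_anti; rewrite n pos.
have be := only_at at_j; have m0 := pos j.
have : sym_form b b = 2 * (b j * b j).
  by rewrite {1 2}be sym_formZl sym_formZr loop_free_self //; ring.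
have [m1|m1] := eqVneq (b j) 1.
  by case: ne; rewrite be m1; apply/ffunP => i; rewrite !ffunE mul1r.
case: (is_root_sym rb) => h h'.
  by exfalso; move: m1; rewrite h in h'; have : b j * b j = 1; [lia|nia].
have b0 : b = 0.
  have z : b j = 0 by nia.
  by rewrite be z; apply/ffunP => i; rewrite !ffunE mul0r.
by move=> i; rewrite b0 reflection0 ffunE.
Qed.

(** Take a semistable representation for the weight [wedge_weight b j i]. The component of [i] in
    the support is a subrepresentation; if it missed [j], its weight would be [- b j * b i < 0]. *)
Lemma pos_root_connected b : pos_root b -> connected_support b.
Proof.
move=> rb i j bi bj; apply/idP/idP; apply: contraT => nc.
set e := (X in connect X) in nc.
have [pos ad] := pos_root_admits rat rb.
have [|M dM [_ ss]] := ad (wedge_weight b j i).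
  by rewrite pairing_wedge mulrC subrr.
have := @has_sub_closed rat Q M (connect e i).
have bi0 : 0 < b i by rewrite lt_def bi pos.
have bj0 : 0 < b j by rewrite lt_def bj pos.
rewrite dM => /(_ _)/ss; rewrite pairing_wedge !ffunE connect0 (negPf nc) mulr0 sub0r.
move=> hc; suff : 0 <= - ((b j)%:~R * (b i)%:~R) :> rat.
  by rewrite oppr_ge0 leNgt mulr_gt0 // ltr0z.
apply: hc => u v a bu bv /connect_trans; apply; apply: connect1.
by rewrite /e /= bu bv; apply/card_gt0P; exists a.
Qed.

Lemma sym_form_lt0_arrow b c : (forall i, 0 <= b i) -> (forall i, 0 <= c i) ->
  sym_form b c < 0 -> exists i j, [/\ b i != 0, c j != 0 & (0 < #|arrow i j|)%N].
Proof.
move=> hb hc neg; apply: contrapT => hn; move: neg; rewrite ltNge => /negP; apply.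
rewrite sym_formE subr_ge0 (@le_trans _ _ 0) //; last first.
  by rewrite mulr_ge0 // sumr_ge0 // => i _; rewrite mulr_ge0.
rewrite sumr_le0 // => i _; rewrite sumr_le0 // => j _.
have [->|bi] := eqVneq (b i) 0; first by rewrite mul0r mulr0.
have [->|cj] := eqVneq (c j) 0; first by rewrite !mulr0.
have [->|ij] := posnP #|arrow i j|; first by rewrite mul0r.
by case: hn; exists i, j.
Qed.

Lemma height_reflection j b : height (reflection j b) = height b - sym_form b (e_ j).
Proof.
rewrite reflectionE heightD; congr (_ + _).
rewrite /height (bigD1 j) //= big1 ?addr0 => [|i /negPf ne].
  by rewrite !ffunE eqxx mulr1.
by rewrite !ffunE ne mulr0 oppr0.
Qed.

(** A negative value of the form needs an arrow joining the two supports, and [star] supplies the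
    way back. *)
Lemma connected_supportD b c : pos_root b -> pos_root c -> sym_form b c < 0 ->
  connected_support (b + c).
Proof.
move=> rb rc neg; have [_ pb] := rb; have [_ pc] := rc.
set e := fun d : {ffun Q -> int} =>
  [rel u v | [&& d u != 0, d v != 0 & (0 < #|arrow u v|)%N]].
have nzb u : b u != 0 -> (b + c) u != 0.
  by rewrite ffunE paddr_eq0 // negb_and => ->.
have nzc u : c u != 0 -> (b + c) u != 0.
  by rewrite ffunE paddr_eq0 // negb_and orbC => ->.
have subb u v : b u != 0 -> b v != 0 -> connect (e (b + c)) u v.
  move=> bu bv; apply: connect_sub (pos_root_connected rb bu bv) => x y /= /and3P[h1 h2 h3].
  by apply: connect1; rewrite /e /= nzb // nzb.
have subc u v : c u != 0 -> c v != 0 -> connect (e (b + c)) u v.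
  move=> bu bv; apply: connect_sub (pos_root_connected rc bu bv) => x y /= /and3P[h1 h2 h3].
  by apply: connect1; rewrite /e /= nzc // nzc.
have [i [j [bi cj hij]]] := sym_form_lt0_arrow pb pc neg.
have eij : connect (e (b + c)) i j by apply: connect1; rewrite /e /= nzb // nzc.
have eji : connect (e (b + c)) j i.
  by apply: connect1; rewrite /e /= (nzc j cj) (nzb i bi) -card_arrowC.
have or u : (b + c) u != 0 -> (b u != 0) || (c u != 0).
  by rewrite ffunE; have [->|] := eqVneq (b u) 0; rewrite ?add0r.
move=> u v /or hu /or hv; rewrite -/(e (b + c)).
case/orP: hu => hu; case/orP: hv => hv; try by [apply: subb|apply: subc].
  exact: connect_trans (connect_trans (subb _ _ hu bi) eij) (subc _ _ cj hv).
exact: connect_trans (connect_trans (subc _ _ hu cj) eji) (subb _ _ bi hv).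
Qed.

(** Induction on height: a loop-free [j] with [(b + c, e_ j) > 0] allows both summands to be
    reflected, which lowers the height and keeps their pairing. If there is none, [b + c] is
    fundamental. *)
Lemma pos_rootD b c : pos_root b -> pos_root c -> sym_form b c < 0 -> pos_root (b + c).
Proof.
have [n] := ubnP `|height (b + c)%R|%N; elim: n b c => // n IH b c hn rb rc neg.
have [_ pb] := rb; have [_ pc] := rc.
have pbc i : 0 <= (b + c) i by rewrite ffunE addr_ge0.
have hge0 : 0 <= height (b + c) by apply: sumr_ge0.
have [[j [hj sj]]|no] := pselect (exists j, loop_free j /\ 0 < sym_form (b + c) (e_ j)).
  (* A summand [e_ j] cannot be reflected to a positive root. Then [2 + (y, e_ j) > 0] and
     [(y, e_ j) < 0] force the value -1, so the sum is the reflection of [y]. *)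
  have special x y : pos_root y -> sym_form x y < 0 ->
      0 < sym_form (x + y) (e_ j) -> x = e_ j -> pos_root (x + y).
    move=> ry nxy sxy ex; rewrite sym_formDl ex loop_free_self // in sxy.
    have yj : sym_form y (e_ j) = -1 by move: nxy; rewrite ex sym_formC; lia.
    have -> : x + y = reflection j y.
      by apply/ffunP => i; rewrite ex !ffunE yj; ring.
    apply: pos_root_reflection => // ye; move: yj.
    by rewrite ye loop_free_self.
  have [be|nb] := pselect (b = e_ j); first exact: special.
  have [ce|nc] := pselect (c = e_ j).
    by rewrite addrC; apply: special => //; [rewrite sym_formC|rewrite addrC].
  have rs : pos_root (reflection j (b + c)).
    rewrite reflectionD; apply: IH; rewrite ?reflection_isometry //.
    - rewrite -reflectionD height_reflection.
      have h2 : 0 <= height (reflection j (b + c)).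
        rewrite reflectionD; apply: sumr_ge0 => i _; rewrite ffunE.
        have [_ h1] := pos_root_reflection hj rb nb.
        have [_ h2] := pos_root_reflection hj rc nc.
        by rewrite addr_ge0.
      by rewrite height_reflection in h2; lia.
    - exact: pos_root_reflection.
    - exact: pos_root_reflection.
  rewrite -(reflectionK hj (b + c)); apply: pos_root_reflection => // e.
  have := pbc j; rewrite -(reflectionK hj (b + c)) e reflection_self //.
  by rewrite !ffunE eqxx.
apply: fundamental_root; split=> //.
- move=> e; have bc : c = - b by rewrite -[c](addKr b) e addr0.
  have b0 : b = 0.
    apply/ffunP => i; rewrite ffunE; apply: le_anti; rewrite pb andbT.
    by have := pc i; rewrite bc ffunE oppr_ge0.
  exact: (pos_root_neq0 rb).
- exact: connected_supportD.
- move=> j; have [hj|hj] := boolP (loop_free j); last exact: sym_form_loopy.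
  by rewrite leNgt; apply/negP => sj; apply: no; exists j.
Qed.

End PositiveRoots.

(** * Dimension vectors of stable and semistable representations *)

Section StableDimensions.
Variables (k : fieldType) (Q : double_quiver).
Implicit Types (M : qrep k Q) (b c : {ffun Q -> int}) (t h : {ffun Q -> rat}) (j : Q).
Local Notation e_ i := (unit_vec i).

Lemma reflect_stable t M j : loop_free j -> stable t M -> t j != 0 ->
  exists2 M' : qrep k Q, dimq M' = reflection j (dimq M) &
    stable (reflect_weight j t) M'.
Proof.
move=> hj [ss nz st] tj; have [M' dM' hM'] := semi_reflection hj ss tj.
exists M' => //; have [z0 h0] := ss.
have E b (c : int) : pairing (reflect_weight j t) (reflection j b + scale_vec c (e_ j)) =
    pairing t b - c%:~R * t j.
  rewrite pairingDr pairing_reflect reflectionK // pairing_scale_vec pairing_unit.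
  by rewrite reflect_weight_at // mulrN.
split.
- split; first by rewrite dM' pairing_reflect reflectionK.
  by move=> _ /hM'[b [c [/h0 hb -> hc]]]; rewrite E; lra.
- rewrite dM' => e; apply: nz.
  by rewrite -[LHS](reflectionK hj) e reflection0.
- move=> _ /hM'[b [c [sb -> hc]]]; rewrite E => e; have tb := h0 b sb.
  have c0 : c = 0.
    have /eqP : c%:~R * t j = 0 by lra.
    by rewrite mulf_eq0 (negPf tj) orbF intr_eq0 => /eqP.
  have -> : scale_vec c (e_ j) = 0 by apply/ffunP => i; rewrite !ffunE c0 mul0r.
  rewrite addr0 dM'; have [|->|->] := st b sb; first by lra.
    by left; apply: reflection0.
  by right.
Qed.

(** Out of a loop-free vertex all arrows lead to zero spaces, so any line is a subrepresentation. *)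
Lemma has_sub_line M j : loop_free j -> (forall l, l != j -> dimq M l = 0) ->
  0 < dimq M j -> has_sub M (e_ j).
Proof.
move=> hj at_j pos.
have /subvPn[v vt vb] : ~~ (top M j <= bot M j)%VS.
  apply/negP => /dimvS h; move: pos; rewrite ffunE; lia.
pose U i := if i == j then (<[v]> + bot M j)%VS else bot M i.
exists U.
  split=> [i|i|i l a u]; rewrite /U.
  - by have [->|_] := eqVneq i j; [exact: addvSr|exact: subvv].
  - have [->|_] := eqVneq i j; last exact: bot_top.
    by rewrite subv_add -memvE vt bot_top.
  - have [ei|ni] := eqVneq i j; last first.
      move=> ub; have := arr_bot a ub; have [el|//] := eqVneq l j; subst.
      exact/(subvP (addvSr _ _)).
    subst i; have [el|nl] := eqVneq l j; first by subst l; case: (no_loop hj a).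
    rewrite -(dimq_eq0 (at_j l nl)) => uU; apply: arr_top.
    by apply: subvP uU; rewrite subv_add -memvE vt bot_top.
apply/ffunP => i; rewrite !ffunE /U; have [->|_] := eqVneq i j; last by rewrite subrr.
have d0 : \dim (<[v]> :&: bot M j) = 0%N.
  apply/eqP; rewrite dimv_eq0 -subv0; apply/subvP => u /memv_capP[/vlineP[x ->]].
  have [->|x0] := eqVneq x 0; first by rewrite scale0r !mem0v.
  by move=> xv; case/negP: vb; rewrite -(scalerK x0 v) memvZ.
have := dimv_sum_cap <[v]> (bot M j); rewrite d0 addn0 dim_vline.
have -> : v != 0 by apply: contraNneq vb => ->; rewrite mem0v.
by move=> ->; rewrite PoszD addrK.
Qed.

(** The component of [i] and the rest of the support both carry subrepresentations, of nonnegative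
    weights adding up to 0; stability does not allow two nonzero pieces of weight 0. *)
Lemma stable_connected t M : stable t M -> connected_support (dimq M).
Proof.
case=> [[z0 ss] nz st] i j bi bj; apply: contraT => nc.
set e := (X in connect X) in nc; set b := dimq M.
have eC u v : e u v -> e v u.
  by rewrite /e /= => /and3P[-> -> h]; rewrite -card_arrowC.
have sub1 : has_sub M [ffun u => if connect e i u then b u else 0].
  apply: has_sub_closed => u v a bu bv /connect_trans; apply; apply: connect1.
  by rewrite /e /= bu bv; apply/card_gt0P; exists a.
have sub2 : has_sub M [ffun u => if ~~ connect e i u then b u else 0].
  apply: has_sub_closed => u v a bu bv; apply: contra => /connect_trans; apply.
  apply: connect1; apply: eC; rewrite /e /= bu bv; apply/card_gt0P; by exists a.
have := ss _ sub1; have := ss _ sub2.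
have : b = [ffun u => if connect e i u then b u else 0] +
    [ffun u => if ~~ connect e i u then b u else 0].
  by apply/ffunP => u; rewrite !ffunE; case: ifP; rewrite ?addr0 ?add0r.
move/(congr1 (pairing t)); rewrite pairingDr [LHS]z0 => e0 h2 h1.
have [||] := st _ sub1; first by lra.
  move/(congr1 (fun c : {ffun Q -> int} => c i)); rewrite ffunE connect0 => e1.
  by exfalso; apply: (elimN eqP bi); rewrite -/b e1 ffunE.
move/(congr1 (fun c : {ffun Q -> int} => c j)); rewrite ffunE (negPf nc) => /esym/eqP.
by rewrite (negPf bj).
Qed.

(** Induction on height. If [(b, e_ j) > 0], perturb until [t j != 0] and reflect to a smaller
    stable representation; if this never happens, connectedness makes [b] fundamental. A
    representation concentrated at [j] has a line as subrepresentation, so stability makes it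
    one-dimensional. *)
Lemma stable_pos_root t M : stable t M -> pos_root (dimq M).
Proof.
have [n] := ubnP `|height (dimq M)|%N; elim: n t M => // n IH t M hn stM.
set b := dimq M; have pb i : 0 <= b i := dimq_ge0 M i.
have [ss nz st] := stM.
have [[j [hj sj]]|no] := pselect (exists j, loop_free j /\ 0 < sym_form b (e_ j)).
  have [at_j|/not_only_at[l lj bl]] := pselect (forall l, l != j -> b l = 0).
    have be := only_at at_j.
    have bj : 0 < b j.
      have := sj; have -> : sym_form b (e_ j) = b j * 2.
        by rewrite {1}be sym_formZl loop_free_self.
      by rewrite pmulr_lgt0.
    have tj : t j = 0.
      have [/eqP] := ss; rewrite -/b {1}be pairing_scale_vec pairing_unit.
      by rewrite mulf_eq0 intr_eq0 gt_eqF //= => /eqP.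
    case: (st _ (has_sub_line hj at_j bj)); first by rewrite pairing_unit.
      by move/(congr1 (fun c : {ffun Q -> int} => c j)); rewrite !ffunE eqxx.
    by rewrite -/b => <-; apply: unit_root.
  have [t' t'j stM'] : exists2 t' : {ffun Q -> rat}, t' j != 0 & stable t' M.
    have [tj|tj] := eqVneq (t j) 0; last by exists t.
    have hb : pairing (wedge_weight b j l) b = 0 by rewrite pairing_wedge mulrC subrr.
    have [eps e0 he] := stable_perturb stM hb.
    exists (t + scale_weight eps (wedge_weight b j l)); last first.
      by apply: he; rewrite lexx ltW.
    rewrite 2!ffunE tj add0r wedge_weight_at; last by rewrite eq_sym.
    by rewrite mulf_neq0 ?intr_eq0 // gt_eqF.
  have [M' dM' st'] := reflect_stable hj stM' t'j.
  have rM' : pos_root (dimq M').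
    apply: (IH _ _ _ st').
    have : 0 <= height (dimq M') by apply: sumr_ge0 => i _; apply: dimq_ge0.
    by rewrite dM' height_reflection -/b; move: hn; rewrite -/b; lia.
  rewrite -(reflectionK hj b) -dM'; apply: pos_root_reflection => // e.
  by case/eqP: bl; rewrite -(reflection_neq b lj) -dM' e ffunE (negPf lj).
apply: fundamental_root; split=> //; first exact: stable_connected stM.
move=> j; have [hj|hj] := boolP (loop_free j); last exact: sym_form_loopy.
by rewrite leNgt; apply/negP => sj; apply: no; exists j.
Qed.

(** A Jordan-Hoelder filtration: a subrepresentation of weight 0 and its quotient are again
    semistable. *)
Lemma semi_root_sum t M : semi t M -> exists2 s : seq {ffun Q -> int},
  forall b, b \in s -> pos_root b /\ pairing t b = 0 & dimq M = \sum_(b <- s) b.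
Proof.
have [n] := ubnP `|height (dimq M)|%N; elim: n M => // n IH M hn ss.
have [z|nz] := pselect (dimq M = 0); first by exists [::]; rewrite ?big_nil.
have [st|nst] := pselect (stable t M).
  exists [:: dimq M]; last by rewrite big_seq1.
  move=> b; rewrite inE => /eqP ->; split; [exact: stable_pos_root st|by case: ss].
have [b [sb [tb [b0 bM]]]] : exists b,
    has_sub M b /\ pairing t b = 0 /\ b <> 0 /\ b <> dimq M.
  apply: contrapT => hn'; apply: nst; split=> // b sb tb; apply: contrapT.
  by move=> /not_orP[? ?]; apply: hn'; exists b.
case: (sb) => U sU eU; have bd := has_sub_bounds sb; rewrite eU in tb b0 bM bd.
have g1 : 0 < height (qdim U).
  by apply: height_gt0 => // i; have /andP[] := bd i.
have g2 : 0 < height (dimq M - qdim U).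
  apply: height_gt0 => [i|/eqP]; last by rewrite subr_eq0 => /eqP/esym.
  by have /andP[_] := bd i; rewrite !ffunE subr_ge0.
have hs : height (dimq M) = height (qdim U) + height (dimq M - qdim U).
  by rewrite -heightD addrC subrK.
have [||s1 h1 e1] := IH (subq sU); [|exact: semi_subq|].
  by rewrite dimq_subq; lia.
have [||s2 h2 e2] := IH (quotq sU); [|exact: semi_quotq|].
  by rewrite dimq_quotq; lia.
exists (s1 ++ s2); first by move=> c; rewrite mem_cat => /orP[/h1|/h2].
by rewrite big_cat /= -e1 -e2 dimq_subq dimq_quotq addrC subrK.
Qed.

End StableDimensions.

(** * Decompositions of the dimension vector *)

Section Decompositions.
Variable Q : double_quiver.
Implicit Types (al b c : {ffun Q -> int}) (t h : {ffun Q -> rat}) (j : Q).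
Local Notation e_ i := (unit_vec i).

Definition parts_negative al : Prop := forall b,
  (forall i, 0 <= b i <= al i) -> b <> 0 -> b <> al -> sym_form b (al - b) < 0.

Lemma sum_vecE (s : seq {ffun Q -> int}) i : (\sum_(b <- s) b) i = \sum_(b <- s) b i.
Proof. by elim: s => [|b s IH]; rewrite ?big_nil ?big_cons ffunE ?IH. Qed.

(** The negative number [(z, al - z)] is the sum of the pairings of [z] with the other summands, so
    one of them is negative. *)
Lemma negative_partner al s z : parts_negative al ->
  (forall b, b \in s -> pos_root b) -> \sum_(b <- s) b = al -> z \in s ->
  (1 < size s)%N -> exists y s', perm_eq s [:: z, y & s'] /\ sym_form z y < 0.
Proof.
move=> star hs sal zs ssz; pose r := rem z s.
have pr : perm_eq s (z :: r) := perm_to_rem zs.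
have sr : al - z = \sum_(b <- r) b.
  by rewrite -sal (perm_big _ pr) /= big_cons addrAC subrr add0r.
have rpos b : b \in r -> pos_root b.
  by move=> br; apply: hs; rewrite (perm_mem pr) inE br orbT.
have [w wr] : exists w, w \in r.
  have : (0 < size r)%N by move: ssz; rewrite (perm_size pr).
  by case: (r) => // w r' _; exists w; rewrite mem_head.
have sum_ge i : w i <= (al - z) i.
  rewrite sr sum_vecE (big_rem w) //= lerDl big_seq sumr_ge0 // => b br.
  by have [_] := rpos b (mem_rem br).
have zpos := hs z zs; have wpos := rpos w wr.
have w0 i : 0 <= w i by have [_] := wpos.
have neg : sym_form z (al - z) < 0.
  apply: star => [i||]; last 2 first.
  - exact: pos_root_neq0.
  - move=> za; apply: (pos_root_neq0 wpos); apply/ffunP => i; rewrite ffunE.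
    apply: le_anti; rewrite w0 andbT; have := sum_ge i.
    by rewrite za subrr ffunE.
  have [_ -> /=] := zpos; have := le_trans (w0 i) (sum_ge i).
  by rewrite !ffunE subr_ge0.
have [y yr ny] : exists2 y, y \in r & sym_form z y < 0.
  apply: contrapT => hn; move: neg; rewrite ltNge => /negP; apply.
  rewrite sr sym_formC sym_form_suml big_seq sumr_ge0 // => b br.
  by rewrite leNgt; apply/negP => nb; apply: hn; exists b; rewrite // sym_formC.
exists y, (rem y r); split=> //.
by rewrite (perm_trans pr) // perm_cons perm_to_rem.
Qed.

(* Two summands pairing negatively add up to a root; one merges summands,
   always keeping one on which [h] does not vanish, until two are left. *)
Lemma merge_to_two_roots t h al s : parts_negative al -> pairing h al = 0 ->
  (forall b, b \in s -> pos_root b /\ pairing t b = 0) -> \sum_(b <- s) b = al ->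
  (exists2 b, b \in s & pairing h b != 0) ->
  exists b, [/\ pos_root b, pos_root (al - b), pairing t b = 0 & pairing h b != 0].
Proof.
move=> star hal; have [n] := ubnP (size s); elim: n s => // n IH s hn hs sal [w ws hw].
have rs b : b \in s -> pos_root b by case/hs.
have [s1|s1] := leqP (size s) 1.
  case: s ws sal s1 {hn rs hs} => [|x [|//]] //; rewrite inE => /eqP <-.
  by rewrite big_seq1 => e; rewrite e hal eqxx in hw.
have merge z : z \in s -> (forall y s', perm_eq s [:: z, y & s'] ->
      exists2 b, b \in (z + y) :: s' & pairing h b != 0) ->
    exists b, [/\ pos_root b, pos_root (al - b), pairing t b = 0 & pairing h b != 0].
  move=> zs hz; have [y [s' [pr ny]]] := negative_partner star rs sal zs s1.
  have [zr zt] := hs z zs.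
  have [yr yt] : pos_root y /\ pairing t y = 0.
    by apply: hs; rewrite (perm_mem pr) !inE eqxx orbT.
  apply: (IH ((z + y) :: s')).
  - by move: hn; rewrite (perm_size pr) /= !ltnS.
  - move=> b; rewrite inE => /orP[/eqP ->|bs'].
      by rewrite pairingDr zt yt addr0; split=> //; apply: pos_rootD.
    by apply: hs; rewrite (perm_mem pr) !inE bs' !orbT.
  - by rewrite -sal (perm_big _ pr) /= !big_cons addrA.
  - exact: hz pr.
have [s2|s2] := leqP (size s) 2.
  have [y [s' [pr _]]] := negative_partner star rs sal ws s1.
  have s'0 : s' = [::].
    by move: s2; rewrite (perm_size pr) /= !ltnS leqn0 size_eq0 => /eqP.
  rewrite s'0 in pr; have [wr wt] := hs w ws; exists w; split=> //.
  rewrite -sal (perm_big _ pr) /= !big_cons big_nil addr0 addrAC subrr add0r.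
  by apply: rs; rewrite (perm_mem pr) !inE eqxx orbT.
(* A summand on which [h] vanishes may be merged with any partner, even with [w], without losing a
   nonzero value. If there is none, [w] is merged and a third summand retains a nonzero value. *)
have [/hasP[z zs /eqP hz]|/hasPn none] := boolP (has (fun b => pairing h b == 0) s).
  apply: (merge z zs) => y s' pr; have := ws; rewrite (perm_mem pr) !inE.
  case/or3P=> [/eqP e|/eqP e|ws'].
  - by rewrite e hz eqxx in hw.
  - by exists (z + y); rewrite ?mem_head // pairingDr hz add0r -e.
  - by exists w; rewrite // inE ws' orbT.
apply: (merge w ws) => y s' pr.
move: s2; rewrite (perm_size pr); case: s' pr => // x s' pr _.
by exists x; [rewrite !inE eqxx orbT|apply: none; rewrite (perm_mem pr) !inE eqxx !orbT].
Qed.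

(** If [m = (al, e_ j) > 0], then [al] is its reflection plus [m] copies of [e_ j]. Since [p_fun] is
    reflection invariant and vanishes on [e_ j], this decomposition violates the strict inequality
    of [Sigma0] unless [al = e_ j]. *)
Lemma Sigma0_dominant al : Sigma0 al ->
  (exists2 j, loop_free j & al = e_ j) \/ fundamental al.
Proof.
case=> ra hS.
have [[j [hj sj]]|no] := pselect (exists j, loop_free j /\ 0 < sym_form al (e_ j)).
  left; exists j => //; apply: contrapT => ne.
  have rr := pos_root_reflection hj ra ne.
  pose s := reflection j al :: nseq `|sym_form al (e_ j)|%N (e_ j).
  have := hS s; rewrite /s /= size_nseq ltnS absz_gt0 gt_eqF // => /(_ isT).
  have hr b : b \in s -> pos_root b.
    rewrite inE => /orP[/eqP -> //|/nseqP[-> _]]; exact: unit_root.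
  move=> /(_ hr); rewrite !big_cons !big_nseq /= => H.
  have [] : ~ (p_fun al < p_fun al) by rewrite ltxx.
  apply: le_lt_trans (H _).
    have -> : p_fun (e_ j) = 0 by rewrite p_funE loop_free_self // divff // subrr.
    have -> : forall m, iter m (+%R (0 : rat)) 0 = 0.
      by elim=> //= m ->; rewrite addr0.
    by rewrite addr0 !p_funE reflection_isometry.
  rewrite reflectionE; apply/ffunP => i.
  have -> : forall m, iter m (+%R (e_ j)) 0 = scale_vec m%:Z (e_ j).
    elim=> [|m IHm]; first by apply/ffunP => l; rewrite !ffunE mul0r.
    by rewrite iterS IHm; apply/ffunP => l; rewrite !ffunE -addn1 PoszD; ring.
  by rewrite gez0_abs ?ltW // subrK.
right; have [_ pos] := ra; split=> //; first exact: pos_root_neq0.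
  exact: pos_root_connected.
move=> j; have [hj|hj] := boolP (loop_free j); last exact: sym_form_loopy.
by rewrite leNgt; apply/negP => sj; apply: no; exists j.
Qed.

(** With the ratio in lowest terms [m / n], the number [n] divides every [alpha i], so it is 1; then
    [b <= alpha] and [b <> 0] force [m = 1]. *)
Lemma indivisible_proportional (alpha : Q -> nat) b : indivisible alpha ->
  (forall i, 0 <= b i <= dim_vector alpha i) -> b <> 0 ->
  (forall i j, b i * dim_vector alpha j = b j * dim_vector alpha i) ->
  b = dim_vector alpha.
Proof.
move=> ind hb nz pr; pose b' i := `|b i|%N.
have bE i : b i = (b' i)%:Z by case/andP: (hb i) => h _; rewrite /b' gez0_abs.
have pr' i j : (b' i * alpha j = b' j * alpha i)%N.
  by apply/eqP; rewrite -eqz_nat !PoszM -!bE; have := pr i j; rewrite !ffunE => ->.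
have le' i : (b' i <= alpha i)%N.
  by have /andP[_] := hb i; rewrite ffunE bE.
have [j bj] : exists j, (0 < b' j)%N.
  apply: contrapT => hn; apply: nz; apply/ffunP => j; rewrite ffunE bE.
  by have [->//|bj] := posnP (b' j); case: hn; exists j.
have aj : (0 < alpha j)%N := leq_trans bj (le' j).
pose d := gcdn (alpha j) (b' j); have d0 : (0 < d)%N by rewrite gcdn_gt0 aj.
have /dvdnP[n en] : (d %| alpha j)%N := dvdn_gcdl _ _.
have /dvdnP[m em] : (d %| b' j)%N := dvdn_gcdr _ _.
have cop : coprime n m.
  by rewrite /coprime -(eqn_pmul2r d0) muln_gcdl -en -em mul1n.
have nm i : (b' i * n = m * alpha i)%N.
  by apply/eqP; rewrite -(eqn_pmul2r d0) -mulnA -en pr' em mulnAC.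
have n1 : n = 1%N.
  apply: (ind n (fun i => alpha i %/ n)%N) => i; rewrite mulnC divnK //.
  by rewrite -(Gauss_dvdr _ cop) -nm dvdn_mull.
have m1 : m = 1%N.
  apply/eqP; rewrite eqn_leq -(leq_pmul2r d0) -em mul1n.
  have -> : d = alpha j by rewrite en n1 mul1n.
  by rewrite le' /=; move: bj; rewrite em; case: (m).
by apply/ffunP => i; rewrite ffunE bE; have := nm i; rewrite n1 m1 muln1 mul1n => ->.
Qed.

(** The vector [e_ j] has no proper part. In the fundamental region, a nonnegative value would make
    [b] proportional to [alpha] by Kac's identity, hence equal to it by indivisibility. *)
Lemma Sigma0_parts_negative (alpha : Q -> nat) : Sigma0 (dim_vector alpha) ->
  indivisible alpha -> parts_negative (dim_vector alpha).
Proof.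
move=> /Sigma0_dominant[[j hj ->]|[_ _ con le0]] ind b hb b0 ba.
  exfalso; have be : b = scale_vec (b j) (e_ j).
    by apply: only_at => l /negPf lj; have := hb l; rewrite ffunE lj -eq_le => /eqP.
  have := hb j; rewrite ffunE eqxx => /andP[h1 h2].
  have [bj|bj] : b j = 0 \/ b j = 1 by lia.
    by apply: b0; rewrite be bj; apply/ffunP => i; rewrite !ffunE mul0r.
  by apply: ba; rewrite be bj; apply/ffunP => i; rewrite !ffunE mul1r.
rewrite ltNge; apply/negP => /(kac_identity hb con le0) pr.
by apply: ba; apply: indivisible_proportional.
Qed.

End Decompositions.

(** * Variation of the semistability condition *)

Section Chambers.
Variables (k : fieldType) (Q : double_quiver) (al : {ffun Q -> int}).
Hypothesis star : parts_negative al.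
Implicit Types (M : qrep k Q) (b c : {ffun Q -> int}) (t h : {ffun Q -> rat}).

Lemma semi_scale t M (x : rat) : 0 < x -> semi (scale_weight x t) M -> semi t M.
Proof.
move=> x0 [z h]; split=> [|b /h]; last by rewrite pairingZl pmulr_rge0.
by apply/eqP; rewrite -(mulrI_eq0 _ (lregP (lt0r_neq0 x0))) -pairingZl z.
Qed.

(** At the first point of the segment where some subrepresentation [b1] with [t' b1 < 0] becomes
    null, [M] is still semistable. Its root summands merge to a wall [b] null at that point with
    [t' b != 0], so [t b] is 0 or of the opposite sign, contrary to the equality of signs. *)
Lemma same_face_semi t t' M : pairing t' al = 0 ->
  (forall b, pos_root b -> pos_root (al - b) ->
     Num.sg (pairing t b) = Num.sg (pairing t' b)) ->
  dimq M = al -> semi t M -> semi t' M.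
Proof.
move=> tal' same dM ss; have [tal h] := ss; rewrite dM in tal.
split=> [|b0 sb0]; first by rewrite dM.
rewrite leNgt; apply/negP => nb0; have [N hN] := vec_bound al.
pose P b := has_sub M b /\ pairing t' b < 0.
(* The parameter at which the segment from [t] to [t'] meets the hyperplane of [b]. *)
pose f b := pairing t b / (pairing t b - pairing t' b).
have [|b1 [sb1 nb1] max1] := box_max (P := P) (N := N) (fun b => - f b) _ (ex_intro P b0 (conj sb0 nb0)).
  move=> b [hb _] i; have /andP[-> hle] := has_sub_bounds hb i.
  by rewrite (le_trans hle) // dM.
set s := f b1; have p1 := h _ sb1.
have fE c : P c -> f c * (pairing t c - pairing t' c) = pairing t c.
  case=> /h hc nc; rewrite divfK // subr_eq0 eq_sym lt_eqF //.
  exact: lt_le_trans nc hc.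
have s01 : 0 <= s < 1.
  have d0 : 0 < pairing t b1 - pairing t' b1 by lra.
  by rewrite divr_ge0 ?(ltW d0) //= ltr_pdivrMr // mul1r; lra.
have null1 : pairing (segment t t' s) b1 = 0.
  have := fE b1 (conj sb1 nb1); rewrite pairing_segment -/s; lra.
have ss0 : semi (segment t t' s) M.
  split=> [|c sc]; first by rewrite dM pairing_segment tal tal' !mulr0 addr0.
  have hc := h _ sc; rewrite pairing_segment.
  have [hc'|nc] := leP 0 (pairing t' c).
    by rewrite addr_ge0 // mulr_ge0 //; lra.
  have := max1 c (conj sc nc); rewrite lerN2 => sf.
  have := fE c (conj sc nc); have : 0 < pairing t c - pairing t' c by lra.
  by move: sf; rewrite -/s; nra.
have [U sU eU] := sb1; rewrite eU in null1 nb1.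
have [s1 h1 e1] := semi_root_sum (semi_subq sU ss0 null1).
have [s2 h2 e2] := semi_root_sum (semi_quotq sU ss0 null1).
have [|||b [rb rb' tb hb]] := @merge_to_two_roots Q (segment t t' s) t' al (s1 ++ s2) star tal'.
- by move=> c; rewrite mem_cat => /orP[/h1|/h2].
- by rewrite big_cat /= -e1 -e2 dimq_subq dimq_quotq addrC subrK dM.
- apply: contrapT => hn; move: nb1; rewrite -(dimq_subq sU) e1 pairing_sumr.
  rewrite big_seq big1 ?ltxx // => c c1; apply/eqP; apply: contrapT => /negP hc.
  by apply: hn; exists c; rewrite // mem_cat c1.
- have := same b rb rb'; move: tb; rewrite pairing_segment.
  have [] := sgrP (pairing t b); have [] := sgrP (pairing t' b) => //; nra.
Qed.

(** A direct sum of semistable representations of dimensions [al - b] and [b] is semistable for [t]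
    and has [b] as a subrepresentation. *)
Lemma wall_semi t t' b : pairing t al = 0 -> pos_root b -> pos_root (al - b) ->
  (forall M, dimq M = al -> semi t M -> semi t' M) ->
  pairing t b = 0 -> 0 <= pairing t' b.
Proof.
move=> tal /(pos_root_admits k)[_ adb] /(pos_root_admits k)[_ adc] hs tb.
have [|Mc dMc [zc sc]] := adc t; first by rewrite pairingDr pairingNr tal tb subrr.
have [Mb dMb [zb sb]] := adb t tb.
have [M [dM subM hM]] := direct_sum Mc Mb.
have {}dM : dimq M = al by rewrite dM dMc dMb subrK.
suff /(hs M dM)[_] : semi t M by rewrite dMb in subM; apply.
split=> [|c /hM[c1 [c2 [/sc h1 /sb h2 ->]]]]; first by rewrite dM.
by rewrite pairingDr addr_ge0.
Qed.

Section Crossing.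
Variables t t' : {ffun Q -> rat}.
Hypotheses (tal : pairing t al = 0) (tal' : pairing t' al = 0).

Let f b := pairing t b / (pairing t b - pairing t' b).

Let fE b : pairing t b < 0 -> 0 < pairing t' b ->
  f b * (pairing t b - pairing t' b) = pairing t b.
Proof. by move=> h1 h2; rewrite divfK //; lra. Qed.

Let f01 b : pairing t b < 0 -> 0 < pairing t' b -> 0 < f b < 1.
Proof. by move=> h1 h2; have := fE h1 h2; move: (f b) => x e; apply/andP; split; nra. Qed.

(** Walls where some representation, semistable at the crossing parameter, has a subrepresentation
    that destabilises it on the side of [t]. *)
Let P b := [/\ pairing t b < 0, 0 < pairing t' b &
  exists M, [/\ dimq M = al, semi (segment t t' (f b)) M & has_sub M b]].

(** Going from parameter [s] back to [t], the first hyperplane of a subrepresentation negative at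
    [t] is met while [M] is still semistable; it is the one of largest [f]. *)
Let wall_exists M s : 0 < s -> s < 1 -> dimq M = al -> semi (segment t t' s) M ->
  ~ semi t M -> exists2 b, P b & f b <= s.
Proof.
move=> s0 s1 dM [zs hs] ns; have [N hN] := vec_bound al.
pose P' b := has_sub M b /\ pairing t b < 0.
have pos c : P' c -> 0 < pairing t' c.
  by case=> /hs; rewrite pairing_segment; nra.
have le_s c : P' c -> f c <= s.
  move=> Pc; have c2 := pos c Pc; case: Pc => /hs; rewrite pairing_segment => h1 c1.
  by have := fE c1 c2; have /andP[] := f01 c1 c2; nra.
have [b0 hb0] : exists b, P' b.
  apply: contrapT => hn; apply: ns; split=> [|b sb]; first by rewrite dM.
  by rewrite leNgt; apply/negP => nb; apply: hn; exists b.
have [|b Pb maxb] := box_max (P := P') (N := N) f _ (ex_intro _ b0 hb0).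
  move=> b [hb _] i; have /andP[-> hle] := has_sub_bounds hb i.
  by rewrite (le_trans hle) // dM.
exists b; last exact: le_s.
have b2 := pos b Pb; have bs := le_s b Pb; have [sb b1] := Pb.
split=> //; exists M; split=> //; split=> [|c sc].
  by rewrite dM pairing_segment tal tal' !mulr0 addr0.
have := hs c sc; rewrite !pairing_segment; have /andP[g0 g1] := f01 b1 b2.
have [hc|nc] := leP 0 (pairing t c); first by nra.
have Pc : P' c by []; have c2 := pos c Pc; have := maxb c Pc.
by have := fE nc c2; nra.
Qed.

(** A direct sum along [b] shows that [P] is inhabited. At the wall of [P] nearest to [t],
    improvement yields [M'] semistable slightly towards [t], with a null subrepresentation [c] such
    that [t c > 0] and so [t' c < 0]. Having no nearer wall, [M'] is semistable for [t], but it is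
    not so for [t']. *)
Lemma crossing b : (forall M, dimq M = al -> semi t M -> semi t' M) ->
  pos_root b -> pos_root (al - b) -> 0 < pairing t b -> pairing t' b < 0 -> False.
Proof.
move=> hs rb rc tb tb'.
have [s [s0 s1 sb]] : exists s, [/\ 0 < s, s < 1 & pairing (segment t t' s) b = 0].
  have d0 : 0 < pairing t b - pairing t' b by lra.
  exists (pairing t b / (pairing t b - pairing t' b)); split.
  - by rewrite divr_gt0.
  - by rewrite ltr_pdivrMr // mul1r; lra.
  - by rewrite pairing_segment; field; lra.
have zs x : pairing (segment t t' x) al = 0.
  by rewrite pairing_segment tal tal' !mulr0 addr0.
have [b0 Pb0 _] : exists2 b, P b & f b <= s.
  have [_ adb] := pos_root_admits k rb; have [_ adc] := pos_root_admits k rc.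
  have [|Mc dMc [zc sc]] := adc (segment t t' s).
    by rewrite pairingDr pairingNr zs sb subrr.
  have [Mb dMb [zb sb']] := adb _ sb.
  have [M [dM subM hM]] := direct_sum Mb Mc.
  have {}dM : dimq M = al by rewrite dM dMc dMb addrC subrK.
  apply: (wall_exists s0 s1 dM).
    split=> [|c /hM[c1 [c2 [/sb' h1 /sc h2 ->]]]]; first by rewrite dM.
    by rewrite pairingDr addr_ge0.
  case=> _ /(_ _ subM); rewrite dMc pairingDr pairingNr tal; lra.
have [N hN] := vec_bound al.
have [|b1 Pb1 min1] := box_max (P := P) (N := N) (fun b => - f b) _ (ex_intro _ b0 Pb0).
  move=> b2 [_ _ [M [dM _ hb]]] i; have /andP[-> hle] := has_sub_bounds hb i.
  by rewrite (le_trans hle) // dM.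
have [n1 p1 [M [dM ssM sM]]] := Pb1.
have null1 : pairing (segment t t' (f b1)) b1 = 0.
  by have := fE n1 p1; rewrite pairing_segment; lra.
have /andP[g0 g1] := f01 n1 p1.
have [|||M' [ssM' dM' nM' [c [sc zc pc]]]] := @improvement k Q (segment t t' (f b1)) t al.
- move=> c hc _ nc; apply: star => // e; move: nc; rewrite e ?pairing0r ?tal ltxx //.
- exact: tal.
- by exists M; split=> //; exists b1.
have [eps e0 he] := perturbation (segment t t' (f b1)) t N%:Z.
have ss2 : semi (segment t t' (f b1 / (1 + eps))) M'.
  apply: (@semi_scale _ _ (1 + eps)); first by lra.
  split=> [|d sd]; first by rewrite dM' pairingZl zs mulr0.
  (* Up to the factor [1 + eps], dividing the parameter by [1 + eps] adds [eps] times [t] to the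
     weight at the wall. *)
  have -> : pairing (scale_weight (1 + eps) (segment t t' (f b1 / (1 + eps)))) d =
      pairing (segment t t' (f b1) + scale_weight eps t) d.
    rewrite pairingDl !pairingZl !pairing_segment; field; lra.
  have [_ /(_ d sd)] := ssM'; rewrite le_eqVlt => /orP[/eqP z|p].
    by rewrite pairingDl -z add0r pairingZl mulr_ge0 ?(ltW e0) // nM'.
  apply/ltW/he => // [|i]; first by rewrite lexx ltW.
  have /andP[d0 d1] := has_sub_bounds sd i.
  by rewrite ger0_norm // (le_trans d1) // dM'.
have lt1 : f b1 / (1 + eps) < f b1 by rewrite ltr_pdivrMr; nra.
have gt0' : 0 < f b1 / (1 + eps) by rewrite divr_gt0 //; lra.
have [ss3|ns] := pselect (semi t M'); last first.
  have [b2 /min1 h2 h3] := wall_exists gt0' (lt_trans lt1 g1) dM' ss2 ns.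
  by rewrite lerN2 in h2; lra.
have [_ /(_ c sc)] := hs M' dM' ss3.
by move: zc; rewrite pairing_segment; nra.
Qed.

End Crossing.

Lemma same_semi_same_face t t' b : pairing t al = 0 -> pairing t' al = 0 ->
  (forall M, dimq M = al -> semi t M <-> semi t' M) ->
  pos_root b -> pos_root (al - b) ->
  Num.sg (pairing t b) = Num.sg (pairing t' b).
Proof.
move=> tal tal' hs rb rc.
have rb' : pos_root (al - (al - b)) by rewrite opprB addrC subrK.
have hs1 M : dimq M = al -> semi t M -> semi t' M by move=> /hs[].
have hs2 M : dimq M = al -> semi t' M -> semi t M by move=> /hs[].
have cE x : pairing x al = 0 -> pairing x (al - b) = - pairing x b.
  by move=> e; rewrite pairingDr pairingNr e sub0r.
have z1 : pairing t b = 0 -> pairing t' b = 0.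
  move=> z; apply: le_anti; rewrite (wall_semi tal rb rc hs1 z) andbT.
  by have := wall_semi tal rc rb' hs1; rewrite !cE // z oppr0 oppr_ge0; apply.
have z2 : pairing t' b = 0 -> pairing t b = 0.
  move=> z; apply: le_anti; rewrite (wall_semi tal' rb rc hs2 z) andbT.
  by have := wall_semi tal' rc rb' hs2; rewrite !cE // z oppr0 oppr_ge0; apply.
have x1 := crossing tal tal' hs1 rb rc.
have x2 := crossing tal' tal hs2 rb rc.
have [e|p|n] := sgrP (pairing t b); have [e'|p'|n'] := sgrP (pairing t' b) => //.
- by have := z1 e; lra.
- by have := z1 e; lra.
- by have := z2 e'; lra.
- by case: (x1 p n').
- by have := z2 e'; lra.
- by case: (x2 p' n).
Qed.

End Chambers.

(** * Matrix spaces without shrunk subspaces *)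

Section Minors.
Variables (F : fieldType) (m n : nat) (A : 'M[F]_(m, n)).

Lemma minor_exists r : \rank A = r ->
  exists (f : 'I_r -> 'I_m) (g : 'I_r -> 'I_n), \det (mxsub f g A) != 0.
Proof.
move=> <-; pose B := (rowsub (maxrankfun A) A)^T.
have fB : row_full B by rewrite /row_full mxrank_tr; apply: maxrowsub_free.
exists (maxrankfun A), (fullrankfun fB).
have -> : mxsub (maxrankfun A) (fullrankfun fB) A = (rowsub (fullrankfun fB) B)^T.
  by apply/matrixP => i j; rewrite !mxE.
by rewrite det_tr -unitfE -unitmxE -row_full_unit fullrowsub_full.
Qed.

Lemma minor_rank r (f : 'I_r -> 'I_m) (g : 'I_r -> 'I_n) :
  \det (mxsub f g A) != 0 -> (r <= \rank A)%N.
Proof.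
rewrite -unitfE -unitmxE -row_free_unit => /eqP <-.
have -> : mxsub f g A = rowsub f 1%:M *m A *m colsub g 1%:M.
  by rewrite mul_rowsub_mx mul1mx mulmx_colsub mulmx1; apply/matrixP => i j; rewrite !mxE.
by rewrite (leq_trans (mxrankM_maxl _ _)) // mxrankM_maxr.
Qed.

End Minors.

(** * Elimination over a noncommutative domain of matrices *)

Section FractionFreeElimination.
Variables (R : idomainType) (n d : nat) (D : 'M[R]_d -> Prop).
Local Notation F := {fraction R}.
Local Notation frac := (map_mx (@tofrac R)).
Hypotheses (D_sub : forall a b, D a -> D b -> D (a - b))
  (D_mul : forall a b, D a -> D b -> D (a *m b))
  (D_adj : forall a, D a -> a != 0 -> D (\adj a))
  (D_det : forall a, D a -> a != 0 -> \det a != 0).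

Local Notation E := {ffun 'I_d -> 'rV[F]_n}.
Implicit Types u v : {ffun 'I_n -> 'M[R]_d}.

Lemma column_map_ex u : exists g : 'Hom('cV[F]_d, E), forall z,
  g z = [ffun o => \row_c (frac (u c) *m z) o 0].
Proof.
apply: linear_lfun => a x y; apply/ffunP => o; rewrite !ffunE; apply/rowP => c.
by rewrite !mxE mulr_sumr -big_split; apply: eq_bigr => i _; rewrite !mxE mulrDr mulrCA.
Qed.

Definition column_map u := projT1 (cid (column_map_ex u)).

Lemma column_mapE u z o c : column_map u z o 0 c = (frac (u c) *m z) o 0.
Proof. by rewrite /column_map; case: cid => g /= ->; rewrite ffunE mxE. Qed.

Lemma column_map_inj0 u c z : D (u c) -> u c != 0 ->
  (forall o, column_map u z o 0 c = 0) -> z = 0.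
Proof.
move=> Du nz h; have U : frac (u c) \in unitmx.
  by rewrite unitmxE det_map_mx unitfE tofrac_eq0 D_det.
rewrite -[z]mul1mx -(mulVmx U) -mulmxA.
suff -> : frac (u c) *m z = 0 by rewrite mulmx0.
by apply/colP => o; rewrite -column_mapE h mxE.
Qed.

(* Elements of [D] are invertible over the fraction field, so each pivot
   contributes a full block of size [d] to the dimension. *)
Lemma column_span_dim (J : finType) (P : {set J}) (u : J -> {ffun 'I_n -> 'M[R]_d}) :
  (forall j c, D (u j c)) ->
  exists q, \dim (\sum_(j in P) limg (column_map (u j)))%VS = (q * d)%N.
Proof.
have [N] := ubnP #|P|; elim: N P u => // N IH P u hN Du.
have [[j jP [c nz]]|no] :=
    pselect (exists2 j, j \in P & exists c, u j c != 0); last first.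
  exists 0; rewrite big1 ?dimv0 // => j jP.
  apply/eqP; rewrite -subv0; apply/subvP => _ /memv_imgP[z _ ->].
  rewrite memv0; apply/eqP/ffunP => o; apply/rowP => c; rewrite column_mapE.
  have -> : u j c = 0.
    by apply/eqP; apply: contrapT => /negP h; apply: no; exists j => //; exists c.
  by rewrite map_mx0 mul0mx ffunE !mxE.
(* Column [c] is cleared without division. The factor [det (u j c)] is kept as
   [u j c *m \adj (u j c)], which visibly stays in [D]. *)
pose v i : {ffun 'I_n -> 'M[R]_d} :=
  [ffun x => u i x *m (u j c *m \adj (u j c)) - u j x *m (\adj (u j c) *m u i c)].
have vE i z : column_map (v i) z =
    \det (frac (u j c)) *: column_map (u i) z -
    column_map (u j) (frac (\adj (u j c) *m u i c) *m z).
  apply/ffunP => o; apply/rowP => x.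
  have L1 (f g : E) a : (a *: f - g) o 0 x = a * f o 0 x - g o 0 x.
    by rewrite !ffunE !mxE.
  have L2 (A B : 'cV[F]_d) a : (a *: A - B) o 0 = a * A o 0 - B o 0.
    by rewrite !mxE.
  rewrite L1 !column_mapE -L2; congr (fun_of_matrix _ o 0).
  rewrite ffunE mul_mx_adj mul_mx_scalar map_mxB map_mxZ !map_mxM /= mulmxBl.
  by rewrite -scalemxAl -!mulmxA det_map_mx.
have v_c i z o : column_map (v i) z o 0 c = 0.
  rewrite column_mapE ffunE [u j c *m (_ *m _)]mulmxA mul_mx_adj mul_mx_scalar mul_scalar_mx.
  by rewrite subrr map_mx0 mul0mx mxE.
have [||q eq] := IH (P :\ j) v.
- by move: hN; rewrite (cardsD1 j) jP.
- move=> i x; rewrite ffunE; apply: D_sub; apply: D_mul => //.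
    by apply: D_mul => //; apply: D_adj.
  by apply: D_mul => //; apply: D_adj.
have dt0 : \det (frac (u j c)) != 0 by rewrite det_map_mx tofrac_eq0 D_det.
have inj0 z : (forall o, column_map (u j) z o 0 c = 0) -> z = 0.
  exact: column_map_inj0.
set L := limg (column_map (u j)); set W := (\sum_(i in P :\ j) _)%VS in eq.
have dL : \dim L = d.
  rewrite limg_dim_eq ?dimvf /dim /= ?muln1 //.
  apply/eqP; rewrite -subv0; apply/subvP => z /memv_capP[_].
  rewrite memv_ker memv0 => /eqP e; apply/eqP/inj0 => o.
  by rewrite e ffunE mxE.
have disj : (L :&: W = 0)%VS.
  apply/eqP; rewrite -subv0; apply/subvP => _ /memv_capP[/memv_imgP[z _ ->]].
  case/memv_sumP=> w hw e; rewrite memv0; suff -> : z = 0 by rewrite linear0.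
  apply: inj0 => o; rewrite e sum_ffunE summxE big1 // => i iP.
  by have /memv_imgP[y _ ->] := hw i iP; rewrite v_c.
have sum_eq : (\sum_(i in P) limg (column_map (u i)) = L + W)%VS.
  rewrite (big_setD1 j) //= -/L; apply/eqP; rewrite eqEsubv !subv_add !addvSl /=.
  apply/andP; split; apply/subv_sumP => i iP; apply/subvP => _ /memv_imgP[z _ ->].
    rewrite -[column_map (u i) z]scale1r -(mulVf dt0) -scalerA memvZ //.
    rewrite -(subrK (column_map (u j) (frac (\adj (u j c) *m u i c) *m z)) (_ *: _)) -vE.
    rewrite addrC memv_add ?memv_img ?memvf //.
    by apply: (subvP (sumv_sup i iP (subvv _))); rewrite memv_img ?memvf.
  rewrite vE addrC memv_add ?memvN ?memv_img ?memvf // memvZ //.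
  by apply: (subvP (sumv_sup i iP (subvv _))); rewrite memv_img ?memvf.
exists q.+1; rewrite sum_eq; have := dimv_disjoint_sum disj; rewrite dL eq => ->.
by rewrite mulSn.
Qed.

End FractionFreeElimination.

Section Twisted.
Variables (R : idomainType) (d : nat) (f : {rmorphism R -> R}) (U : 'M[R]_d).
Hypothesis detU : \det U != 0.

(** A descent condition: [a] is fixed by [a |-> U^-1 f(a) U], with the inverse cleared so that
    everything stays over [R]. *)
Definition twisted (a : 'M[R]_d) : Prop := map_mx f a *m U = U *m a.

Lemma twistedB a b : twisted a -> twisted b -> twisted (a - b).
Proof. by rewrite /twisted map_mxB mulmxBl mulmxBr => -> ->. Qed.

Lemma twistedM a b : twisted a -> twisted b -> twisted (a *m b).
Proof.
by rewrite /twisted map_mxM -mulmxA => ha ->; rewrite mulmxA ha -mulmxA.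
Qed.

Lemma twisted_sum (J : Type) (r : seq J) (G : J -> 'M[R]_d) :
  (forall j, twisted (G j)) -> twisted (\sum_(j <- r) G j).
Proof.
move=> h; elim: r => [|j r IH]; first by rewrite big_nil /twisted map_mx0 mul0mx mulmx0.
rewrite big_cons -[G j]opprK addrC; apply: twistedB => //.
by rewrite -sub0r; apply: twistedB => //; rewrite /twisted map_mx0 mul0mx mulmx0.
Qed.

Lemma twistedZ c a : f c = c -> twisted a -> twisted (c *: a).
Proof. by rewrite /twisted map_mxZ => ->; rewrite -scalemxAl -scalemxAr => ->. Qed.

(** The relation makes [det a] invariant under [f]; multiplying the claim by [a] turns both sides
    into [det a *: U], and [det a] is then cancelled. *)
Lemma twisted_adj a : \det a != 0 -> twisted a -> twisted (\adj a).
Proof.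
move=> da ta; have fda : f (\det a) = \det a.
  apply: (mulIf detU); rewrite -det_map_mx -det_mulmx ta det_mulmx mulrC //.
have e : (U *m \adj a) *m a = (map_mx f (\adj a) *m U) *m a.
  rewrite -mulmxA mul_adj_mx mul_mx_scalar -mulmxA -ta mulmxA -map_mxM mul_adj_mx.
  by rewrite map_scalar_mx /= fda mul_scalar_mx.
have : \det a *: (map_mx f (\adj a) *m U) = \det a *: (U *m \adj a).
  by rewrite -!mul_mx_scalar -mul_mx_adj !mulmxA -e.
move=> /matrixP h; apply/matrixP => i j; have := h i j; rewrite !mxE.
exact: mulfI.
Qed.

End Twisted.

Section PolynomialTools.

Lemma coef_comp_scaleX (R : comNzRingType) (p : {poly R}) (c : R) b :
  (p \Po (c *: 'X))`_b = p`_b * c ^+ b.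
Proof.
rewrite comp_polyE.
have -> : \sum_(i < size p) p`_i *: (c *: 'X) ^+ i = \poly_(i < size p) (p`_i * c ^+ i).
  by rewrite poly_def; apply: eq_bigr => i _; rewrite exprZn scalerA.
by rewrite coef_poly; case: ltnP => // /(nth_default 0) ->; rewrite mul0r.
Qed.

Lemma lagrange_interpolation (k : fieldType) d (x y : 'I_d -> k) : injective x ->
  exists q : {poly k}, forall i, q.[x i] = y i.
Proof.
move=> xI; pose L i := \prod_(l | l != i) ('X - (x l)%:P).
exists (\sum_i (y i / (L i).[x i]) *: L i) => i.
rewrite horner_sum (bigD1 i) //= big1 ?addr0 => [|j ji].
  rewrite hornerZ divfK // horner_prod; apply/prodf_neq0 => l li.
  by rewrite hornerXsubC subr_eq0 (inj_eq xI) eq_sym.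
rewrite hornerZ [X in _ * X]horner_prod (bigD1 i) 1?eq_sym //=.
by rewrite hornerXsubC subrr mul0r mulr0.
Qed.

Lemma coef_prod_top (R : nzRingType) (J : Type) (r : seq J) (p : J -> {poly R}) b :
  (forall j, (size (p j) <= b.+1)%N) ->
  (size (\prod_(j <- r) p j)%R <= (size r * b).+1)%N /\
  (\prod_(j <- r) p j)`_(size r * b)%N = \prod_(j <- r) (p j)`_b.
Proof.
move=> hp; elim: r => [|j r [IH1 IH2]].
  by rewrite !big_nil coef1 /= size_polyC oner_neq0.
rewrite !big_cons /= mulSn; split.
  rewrite (leq_trans (size_polyMleq _ _)) //.
  have := hp j; move: IH1; move: (size _) (size _) => x y; lia.
rewrite coefM (bigD1 (inord b)) //= inordK; last by rewrite ltnS leq_addr.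
rewrite addKn IH2 [X in _ + X]big1 ?addr0 // => i ib.
have [h|h] := ltnP b i; first by rewrite nth_default ?mul0r // (leq_trans (hp j)).
rewrite [X in _ * X]nth_default ?mulr0 // (leq_trans IH1) //.
have : (i < b)%N.
  rewrite ltn_neqAle h andbT; apply: contraNneq ib => eb.
  by apply/eqP/val_inj; rewrite /= inordK ?eb // ltnS leq_addr.
lia.
Qed.

Lemma coef_det_top (R : comNzRingType) d (a : 'M[{poly R}]_d) b :
  (forall i j, (size (a i j) <= b.+1)%N) ->
  (\det a)`_(d * b)%N = \det (\matrix_(i, j) (a i j)`_b).
Proof.
move=> ha; rewrite /determinant coef_sum; apply: eq_bigr => s _.
have -> : (-1) ^+ s * \prod_i a i (s i) = (-1) ^+ s *: \prod_i a i (s i) :> {poly R}.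
  by rewrite -mul_polyC rmorphXn rmorphN rmorph1.
rewrite coefZ; congr (_ * _).
have := @coef_prod_top R 'I_d (enum 'I_d) (fun i => a i (s i)) b (fun i => ha i _).
rewrite size_enum_ord !big_enum /= => -[_ ->].
by apply: eq_bigr => i _; rewrite mxE.
Qed.

End PolynomialTools.

(** * A cyclic algebra inside the matrices over [k[x][y]] *)

Section CyclicDomain.
Variables (k : fieldType) (d' : nat) (zeta : k).
Local Notation d := d'.+1.
Hypothesis prim : d.-primitive_root zeta.
Local Notation R := {poly {poly k}}.

Let one_ : 'I_d := inZp 1.
Definition shift_perm : {perm 'I_d} := perm (@addIr _ one_).

(** The outer variable of [R] is [y] and the inner one is [x]; the two twists multiply one of them
    by [zeta]. *)
Definition twist_y : R -> R := comp_poly (zeta%:P *: 'X).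
HB.instance Definition _ := GRing.RMorphism.on twist_y.
Definition twist_x : R -> R := map_poly (comp_poly (zeta *: 'X)).
HB.instance Definition _ := GRing.RMorphism.on twist_x.

Definition clock_mx : 'M[R]_d := diag_mx (\row_i (zeta ^+ i)%:P%:P).

(* Inside the matrices over [k[x][y]], the cyclic algebra generated by
   [diag(zeta^i x)] and the cyclic shift times [y]. *)
Definition cyclic_domain (a : 'M[R]_d) : Prop :=
  twisted twist_y clock_mx a /\ twisted twist_x (perm_mx shift_perm) a.

Lemma det_clock : \det clock_mx != 0.
Proof.
rewrite det_diag; apply/prodf_neq0 => i _; rewrite mxE !polyC_eq0.
rewrite expf_neq0 //; apply/eqP => z0; have := prim_expr_order prim.
by rewrite z0 expr0n => /eqP; rewrite eq_sym oner_eq0.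
Qed.

Lemma det_shift : \det (perm_mx shift_perm : 'M[R]_d) != 0.
Proof. by rewrite det_perm signr_eq0. Qed.

Lemma cyclic_domainB a b : cyclic_domain a -> cyclic_domain b -> cyclic_domain (a - b).
Proof. by case=> h1 h2 [h3 h4]; split; apply: twistedB. Qed.

Lemma cyclic_domainM a b : cyclic_domain a -> cyclic_domain b -> cyclic_domain (a *m b).
Proof. by case=> h1 h2 [h3 h4]; split; apply: twistedM. Qed.

Lemma shift_permE i : shift_perm i = i + one_.
Proof. by rewrite permE. Qed.

Lemma twist_yP a : twisted twist_y clock_mx a <->
  forall i j, twist_y (a i j) * (zeta ^+ j)%:P%:P = (zeta ^+ i)%:P%:P * a i j.
Proof.
rewrite /twisted mul_mx_diag mul_diag_mx; split=> [h i j|h].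
  by have := congr1 (fun A : 'M_d => A i j) h; rewrite /= !mxE.
by apply/matrixP => i j; rewrite !mxE; apply: h.
Qed.

Lemma twist_xP a : twisted twist_x (perm_mx shift_perm) a <->
  forall i j, twist_x (a i j) = a (shift_perm i) (shift_perm j).
Proof.
rewrite /twisted -row_permE -{1}(invgK shift_perm) -col_permE; split=> [h i j|h].
  have := congr1 (fun A : 'M_d => A i (shift_perm j)) h.
  by rewrite /= !mxE permK.
by apply/matrixP => i j; rewrite !mxE; apply: etrans (h _ _) _; rewrite permKV.
Qed.

(** Comparing coefficients of [y^b], the first twist gives [zeta^(b + j) = zeta^i] wherever the
    coefficient is nonzero: the degree in [y] determines the cyclic diagonal. *)
Lemma cyclic_domain_coef a i j b : cyclic_domain a ->
  (a i j)`_b != 0 -> i = j + inZp b.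
Proof.
case=> /twist_yP/(_ i j)/(congr1 (fun p : R => p`_b)) + _ nz.
rewrite coefMC coefCM /twist_y coef_comp_scaleX -polyC_exp -mulrA [RHS]mulrC.
move/(mulfI nz); rewrite -polyCM -exprD => /polyC_inj/eqP.
rewrite (eq_prim_root_expr prim) => /eqP e; apply: val_inj.
by rewrite /= modnDmr addnC e modn_small.
Qed.

(** The coefficients of the top power of [y] form a matrix [C] on a single cyclic diagonal, and the
    second twist carries a nonzero entry to the next one. So the whole diagonal is nonzero, and
    [det C] is a coefficient of [det a]. *)
Lemma cyclic_domain_det a : cyclic_domain a -> a != 0 -> \det a != 0.
Proof.
move=> Da nz.
case: (@arg_maxnP _ (ord0 : 'I_d, ord0 : 'I_d) xpredT (fun p => size (a p.1 p.2))) => //.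
move=> [i0 j0] _ hmax; pose b := (size (a i0 j0)).-1.
have s0 : (0 < size (a i0 j0))%N.
  rewrite lt0n; apply: contra nz => /eqP s0; apply/eqP/matrixP => i j.
  apply/eqP; rewrite mxE -size_poly_eq0 -leqn0 -s0; exact: (hmax (i, j)).
have hs i j : (size (a i j) <= b.+1)%N by rewrite prednK //; apply: (hmax (i, j)).
pose C : 'M[{poly k}]_d := \matrix_(i, j) (a i j)`_b.
have C0 i j : C i j != 0 -> i = j + inZp b.
  by rewrite mxE; apply: cyclic_domain_coef.
have Cs i j : C i j != 0 -> C (i + one_) (j + one_) != 0.
  have [_ /twist_xP/(_ i j)] := Da; rewrite !shift_permE => e.
  rewrite !mxE -e /twist_x coef_map /= => h; apply: contraNneq h => z.
  apply/eqP/polyP => m; have := congr1 (fun p : {poly k} => p`_m) z.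
  rewrite coef_comp_scaleX !coef0 => /eqP; rewrite mulf_eq0 expf_eq0.
  case/orP=> [/eqP//|/andP[_ /eqP z0]].
  have := prim_expr_order prim.
  by rewrite z0 expr0n => /eqP; rewrite eq_sym oner_eq0.
have Cij : C i0 j0 != 0 by rewrite mxE lead_coef_eq0 -size_poly_gt0.
have Cm m : C (i0 + one_ *+ m) (j0 + one_ *+ m) != 0.
  by elim: m => [|m IH]; rewrite ?mulr0n ?addr0 // !mulrSr !addrA Cs.
have ones (x : 'I_d) : x = one_ *+ x.
  by rewrite Zp_mulrn; apply: val_inj; rewrite /= modnMml mul1n modn_small.
have Ct i : C (i + inZp b) i != 0.
  have e1 : j0 + (i - j0) = i by rewrite addrC subrK.
  have e2 : i0 + (i - j0) = i + inZp b by rewrite (C0 _ _ Cij) addrAC e1.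
  by have := Cm (i - j0); rewrite -ones e1 e2.
pose t : {perm 'I_d} := perm (@addIr _ (inZp b : 'I_d)).
have diagC : row_perm t C = diag_mx (\row_i C (i + inZp b) i).
  apply/matrixP => i j; rewrite !mxE permE; have [<-|ne] := eqVneq i j.
    by rewrite mulr1n.
  rewrite mulr0n; apply/eqP; apply: contraTT ne => h.
  rewrite negbK; have := C0 (i + inZp b) j; rewrite mxE => /(_ h)/addIr ->.
  exact: eqxx.
have dC : \det C != 0.
  have : \det (row_perm t C) != 0.
    by rewrite diagC det_diag; apply/prodf_neq0 => i _; rewrite mxE.
  by rewrite row_permE det_mulmx mulf_eq0 negb_or => /andP[].
by apply: contraNneq dC => d0; rewrite -coef_det_top // d0 coef0.
Qed.

Lemma cyclic_domain_adj a : cyclic_domain a -> a != 0 -> cyclic_domain (\adj a).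
Proof.
move=> Da nz; have da := cyclic_domain_det Da nz; case: Da => h1 h2.
by split; apply: twisted_adj => //; [exact: det_clock|exact: det_shift].
Qed.

(** Entries [q_(i - j)(zeta^i x) y^(i - j)] satisfy both twists. At [x = y = 1] the polynomial [q_e]
    must take the value [T i (i - e)] at [zeta^i], and these points are distinct, so interpolation
    applies. *)
Lemma cyclic_domain_lift (T : 'M[k]_d) : exists2 a, cyclic_domain a &
  forall i j, (a i j).[1].[1] = T i j.
Proof.
have zI : injective (fun i : 'I_d => zeta ^+ i).
  move=> i j /eqP; rewrite (eq_prim_root_expr prim) !modn_small // => /eqP.
  exact: val_inj.
have /choice[q hq] (e : 'I_d) := lagrange_interpolation (fun i : 'I_d => T i (i - e)) zI.
exists (\matrix_(i, j) ((q (i - j) \Po (zeta ^+ i *: 'X)) *: 'X^(val (i - j)))).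
  split.
    apply/twist_yP => i j; rewrite !mxE /twist_y comp_polyZ comp_Xn_poly exprZn.
    rewrite [LHS]mulrC !mul_polyC !scalerA -polyC_exp; congr (_ *: _).
    rewrite [LHS]mulrAC -polyCM -exprD; congr (_%:P * _).
    have e : j + (i - j) = i by rewrite addrC subrK.
    apply/eqP; rewrite (eq_prim_root_expr prim); apply/eqP.
    transitivity (val (j + (i - j))%R %% d)%N; first by rewrite /= modn_mod.
    by rewrite e.
  apply/twist_xP => i j; rewrite !mxE !shift_permE.
  have -> : i + one_ - (j + one_) = i - j by rewrite opprD addrACA subrr addr0.
  rewrite /twist_x map_polyZ map_polyXn; congr (_ *: _).
  rewrite /= -comp_polyA; congr (_ \Po _).
  rewrite comp_polyZ comp_polyX scalerA -exprSr /= ; congr (_ *: _).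
  apply/eqP; rewrite (eq_prim_root_expr prim) /= modn_mod modnDmr addn1 //.
move=> i j; rewrite mxE hornerZ hornerXn expr1n mulr1 horner_comp hornerZ hornerX mulr1.
by rewrite hq opprB addrC subrK.
Qed.

End CyclicDomain.

(** * Blow-ups of matrix spaces *)

Section BlowUp.
Variables (K : fieldType) (I O : finType) (n : nat).
Variables (A : I -> 'M[K]_n) (T : I -> O -> O -> K).
Local Notation E := {ffun O -> 'rV[K]_n}.

Lemma blow_ex : exists g : 'End(E), forall Z, g Z =
  [ffun o => \sum_l \sum_p T l o p *: (Z p *m A l)].
Proof.
apply: linear_lfun => a x y; apply/ffunP => o; rewrite !ffunE scaler_sumr -big_split.
apply: eq_bigr => l _; rewrite scaler_sumr -big_split; apply: eq_bigr => p _ /=.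
by rewrite !ffunE mulmxDl -scalemxAl scalerDr !scalerA mulrC.
Qed.

(** The sum of the tensor products of [T l] with [A l]: a member of the blow-up of size [#|O|] of
    the space spanned by the [A l]. *)
Definition blow : 'End(E) := projT1 (cid blow_ex).

Lemma blowE Z o : blow Z o = \sum_l \sum_p T l o p *: (Z p *m A l).
Proof. by rewrite /blow; case: cid => g /= ->; rewrite ffunE. Qed.

End BlowUp.

Section BlowMatrix.
Variables (R : comNzRingType) (I O : finType) (n : nat).
Variables (A : I -> 'M[R]_n) (T : I -> O -> O -> R).

Definition blow_index : finType := (O * 'I_n)%type.

Definition blow_mx : 'M[R]_#|blow_index| :=
  \matrix_(x, y) \sum_l T l (enum_val y).1 (enum_val x).1 *
    A l (enum_val x).2 (enum_val y).2.

End BlowMatrix.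

Lemma map_blow_mx (R S : comNzRingType) (f : {rmorphism R -> S}) (I O : finType) n
    (A : I -> 'M[R]_n) (T : I -> O -> O -> R) :
  map_mx f (blow_mx A T) = blow_mx (fun l => map_mx f (A l)) (fun l o p => f (T l o p)).
Proof.
apply/matrixP => x y; rewrite !mxE rmorph_sum; apply: eq_bigr => l _.
by rewrite /= rmorphM mxE.
Qed.

Lemma dim_mulmxr (K : fieldType) m n (M : 'M[K]_(m, n)) (g : 'Hom('rV[K]_m, 'rV[K]_n)) :
  (forall w, g w = w *m M) -> \dim (limg g) = \rank M.
Proof.
move=> gE; have [|h hE] := @linear_lfun K 'rV[K]_(\rank M) 'rV[K]_n (fun w => w *m row_base M).
  by move=> c x y; rewrite mulmxDl scalemxAl.
have -> : limg g = limg h.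
  apply/eqP; rewrite eqEsubv; apply/andP; split; apply/subvP => _ /memv_imgP[w _ ->].
    have /submxP[D e] : (w *m M <= row_base M)%MS by rewrite eq_row_base submxMl.
    by rewrite gE e -hE memv_img ?memvf.
  have /submxP[D e] : (w *m row_base M <= M)%MS by rewrite -(eq_row_base M) submxMl.
  by rewrite hE e -gE memv_img ?memvf.
rewrite limg_dim_eq ?dimvf /dim /= ?mul1n //.
apply/eqP; rewrite -subv0; apply/subvP => w /memv_capP[_].
rewrite memv_ker hE memv0 => /eqP e.
by apply/eqP/(row_free_inj (row_base_free M)); rewrite e mul0mx.
Qed.

Lemma dim_limg_conj (K : fieldType) (V V' : vectType K) (e : 'Hom(V, V'))
    (e' : 'Hom(V', V)) (f : 'End(V)) (g : 'End(V')) :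
  cancel e' e -> cancel e e' -> (forall w, g w = e (f (e' w))) ->
  \dim (limg g) = \dim (limg f).
Proof.
move=> ee' e'e gE; have -> : limg g = (e @: limg f)%VS.
  apply/eqP; rewrite eqEsubv; apply/andP; split; apply/subvP => v.
    by case/memv_imgP=> w _ ->; rewrite gE !memv_img ?memvf.
  case/memv_imgP=> _ /memv_imgP[Z _ ->] ->.
  have -> : e (f Z) = g (e Z) by rewrite gE e'e.
  by rewrite memv_img ?memvf.
rewrite limg_dim_eq //; apply/eqP; rewrite -subv0; apply/subvP => Z /memv_capP[_].
by rewrite memv_ker memv0 => /eqP h; rewrite -(e'e Z) h linear0.
Qed.

Lemma dim_blow (K : fieldType) (I O : finType) n (A : I -> 'M[K]_n)
    (T : I -> O -> O -> K) : \dim (limg (blow A T)) = \rank (blow_mx A T).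
Proof.
pose X := blow_index O n.
have [|e eE] := @linear_lfun K {ffun O -> 'rV[K]_n} 'rV[K]_#|X|
    (fun Z => \row_x Z (enum_val x).1 0 (enum_val x).2).
  by move=> c x y; apply/rowP => i; rewrite !mxE !ffunE !mxE.
have [|e' e'E] := @linear_lfun K 'rV[K]_#|X| {ffun O -> 'rV[K]_n}
    (fun w => [ffun o => \row_c w 0 (enum_rank ((o, c) : X))]).
  by move=> c x y; apply/ffunP => o; rewrite !ffunE; apply/rowP => i; rewrite !mxE.
have ee' w : e (e' w) = w.
  rewrite eE e'E; apply/rowP => x; rewrite mxE ffunE mxE -surjective_pairing.
  by rewrite enum_valK.
have e'e Z : e' (e Z) = Z.
  by rewrite eE e'E; apply/ffunP => o; apply/rowP => c; rewrite ffunE !mxE enum_rankK.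
have gE w : (e \o blow A T \o e')%VF w = w *m blow_mx A T.
  rewrite !comp_lfunE eE; apply/rowP => y; rewrite !mxE blowE summxE.
  rewrite [RHS](reindex (@enum_rank X)) /=; last exact/onW_bij/enum_rank_bij.
  under [RHS]eq_bigr do rewrite mxE enum_rankK mulr_sumr.
  rewrite [RHS]exchange_big; apply: eq_bigr => l _ /=.
  rewrite summxE [RHS](eq_bigr (fun z : X => T l (enum_val y).1 z.1 *
    (w 0 (enum_rank z) * A l z.2 (enum_val y).2))); last by move=> z _; rewrite mulrCA.
  transitivity (\sum_p \sum_c T l (enum_val y).1 p *
    (w 0 (enum_rank ((p, c) : X)) * A l c (enum_val y).2)); last first.
    by rewrite pair_bigA; apply: eq_bigr => -[p c].
  apply: eq_bigr => p _; rewrite !mxE mulr_sumr; apply: eq_bigr => c _.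
  by rewrite e'E ffunE mxE.
rewrite -(dim_mulmxr gE); symmetry; apply: (dim_limg_conj ee' e'e) => w.
by rewrite !comp_lfunE.
Qed.

Section Regularity.
Variable k : closedFieldType.
Hypothesis char0 : [pchar k] =i pred0.

Lemma prim_root_exists d : (0 < d)%N -> exists z : k, d.-primitive_root z.
Proof.
move=> d0; have dn0 : d%:R != 0 :> k by have /pcharf0P-> := char0; rewrite -lt0n.
have [rs e] := closed_field_poly_normal ('X^d - 1 : {poly k}).
rewrite lead_coefDl ?size_polyXn ?size_polyN ?size_poly1 ?ltnS // lead_coefXn scale1r in e.
have u : uniq rs by rewrite -separable_prod_XsubC -e separable_Xn_sub_1.
have /hasP[z _ hz] : has d.-primitive_root rs.
  apply: has_prim_root => //.
    apply/allP => z zr; rewrite /root_of_unity /root e.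
    by rewrite -[_ == 0]/(root _ z) root_prod_XsubC.
  by rewrite -ltnS -(size_prod_XsubC rs id) -e size_Xn_sub_1.
by exists z.
Qed.

Lemma nonroot2 (p : {poly {poly k}}) : p != 0 -> exists x y : k, p.[y%:P].[x] != 0.
Proof.
move=> p0; have /closed_nonrootP[x hx] : lead_coef p != 0 by rewrite lead_coef_eq0.
have /closed_nonrootP[y hy] : map_poly (horner_eval x) p != 0.
  apply: contraNneq hx => /(congr1 (fun q : {poly k} => q`_(size p).-1)).
  by rewrite coef_map coef0 /= /horner_eval => /eqP.
exists x, y; have := horner_map (horner_eval x) p y%:P.
by rewrite /= {2}/horner_eval hornerC {2}/horner_eval => <-.
Qed.

Variables (I : finType) (n d : nat) (A : I -> 'M[k]_n).

(* Replacing an optimal [T] by a lift to the cyclic domain neither lowers the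
   rank (specialise at x = y = 1) nor raises it (specialise at a generic
   point), while ranks of matrices over the domain come in multiples of [d]. *)
Lemma regularity (T : I -> 'I_d.+1 -> 'I_d.+1 -> k) :
  (forall T' : I -> 'I_d.+1 -> 'I_d.+1 -> k, \dim (limg (blow A T')) <= \dim (limg (blow A T)))%N ->
  (d.+1 %| \dim (limg (blow A T)))%N.
Proof.
move=> maxT; have [zeta prim] := prim_root_exists (ltn0Sn d).
pose R : idomainType := {poly {poly k}}.
have /choice[a ha] (l : I) : exists a : 'M[R]_d.+1, cyclic_domain zeta a /\
    forall i j, (a i j).[1].[1] = T l i j.
  by have [b b1 b2] := cyclic_domain_lift prim (\matrix_(i, j) T l i j);
    exists b; split=> // i j; rewrite b2 mxE.
pose cst : {rmorphism k -> R} := polyC \o polyC.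
pose AR l := map_mx cst (A l); pose TR l i j : R := a l i j.
pose F := {fraction R}.
pose AF l := map_mx (@tofrac R) (AR l); pose TF l i j : F := tofrac (TR l i j).
have mapF : map_mx (@tofrac R) (blow_mx AR TR) = blow_mx AF TF by rewrite map_blow_mx.
pose ev x y : {rmorphism R -> k} := horner_eval x \o horner_eval y%:P.
have mapk x y : map_mx (ev x y) (blow_mx AR TR) = blow_mx A (fun l i j => ev x y (TR l i j)).
  rewrite map_blow_mx; congr blow_mx; apply/funext => l; apply/matrixP => i j.
  by rewrite !mxE /= /horner_eval !hornerC.
(* A nonzero minor over the fraction field is a nonzero polynomial in [x] and [y]; at a point where
   it survives it is a minor of a blow-up over [k], whose rank [maxT] bounds. *)
have rank_le : (\rank (blow_mx AF TF) <= \dim (limg (blow A T)))%N.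
  move Er: (\rank _) => r; have [f [g]] := minor_exists Er.
  rewrite -mapF -map_mxsub det_map_mx tofrac_eq0 => /nonroot2[x [y h]].
  apply: leq_trans (maxT (fun l i j => ev x y (TR l i j))); rewrite dim_blow -mapk.
  by apply: (@minor_rank _ _ _ _ _ f g); rewrite -map_mxsub det_map_mx.
have rank_ge : (\dim (limg (blow A T)) <= \rank (blow_mx AF TF))%N.
  rewrite dim_blow; move Er: (\rank (blow_mx A T)) => r; have [f [g]] := minor_exists Er.
  have -> : blow_mx A T = map_mx (ev 1 1) (blow_mx AR TR).
    rewrite mapk; congr blow_mx; apply/funext => l; apply/funext => i; apply/funext => j.
    by case: (ha l) => _ /(_ i j) <-.
  rewrite -map_mxsub det_map_mx => h; apply: (@minor_rank _ _ _ _ _ f g).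
  rewrite -mapF -map_mxsub det_map_mx tofrac_eq0.
  by apply: contraNneq h => ->; rewrite rmorph0.
have -> : \dim (limg (blow A T)) = \rank (blow_mx AF TF).
  by apply/eqP; rewrite eqn_leq rank_le rank_ge.
rewrite -dim_blow.
(* Regrouping by the rows of the [A l] gives rows of blocks in the cyclic domain, to which the
   elimination applies with block size [d.+1]. *)
pose u b : {ffun 'I_n -> 'M[R]_d.+1} := [ffun c => \sum_l cst (A l b c) *: a l].
have Du b c : cyclic_domain zeta (u b c).
  rewrite ffunE; split; apply: twisted_sum => l; apply: twistedZ; case: (ha l) => -[] //.
    by move=> _ _ _; rewrite /= /twist_y comp_polyC.
  by move=> _ _ _; rewrite /= /twist_x map_polyC /= comp_polyC.
have [q eq] := @column_span_dim R n d.+1 (cyclic_domain zeta) (@cyclic_domainB _ _ _)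
  (@cyclic_domainM _ _ _) (@cyclic_domain_adj _ _ _ prim)
  (@cyclic_domain_det _ _ _ prim) 'I_n (finset.setTfor 'I_n) u Du.
suff -> : limg (blow AF TF) = (\sum_(b in finset.setTfor 'I_n) limg (column_map (u b)))%VS.
  by rewrite eq dvdn_mull.
have colE b z : column_map (u b) z = blow AF TF [ffun p => z p 0 *: delta_mx 0 b].
  apply/ffunP => o; apply/rowP => c; rewrite column_mapE blowE mxE summxE.
  rewrite (eq_bigr (fun p => \sum_l TF l o p * (z p 0 * AF l b c))); last first.
    move=> p _; rewrite mxE ffunE summxE rmorph_sum mulr_suml; apply: eq_bigr => l _ /=.
    by rewrite mxE rmorphM /AF /AR !mxE /TF /TR; ring.
  rewrite exchange_big; apply: eq_bigr => l _; rewrite summxE; apply: eq_bigr => p _.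
  by rewrite [RHS]mxE ffunE -scalemxAl -rowE [in RHS]mxE [row b _ 0 c]mxE.
apply/eqP; rewrite eqEsubv; apply/andP; split; last first.
  by apply/subv_sumP => b _; apply/subvP => _ /memv_imgP[z _ ->]; rewrite colE memv_img ?memvf.
apply/subvP => _ /memv_imgP[Z _ ->].
have -> : Z = \sum_b [ffun p => Z p 0 b *: delta_mx 0 b].
  apply/ffunP => p; rewrite sum_ffunE [LHS]row_sum_delta; apply: eq_bigr => b _.
  by rewrite ffunE.
rewrite linear_sum rpred_sum // => b _ /=.
have -> : blow AF TF [ffun p => Z p 0 b *: delta_mx 0 b] =
    column_map (u b) (\col_p Z p 0 b).
  by rewrite colE; congr (blow _ _ _); apply/ffunP => p; rewrite !ffunE mxE.
by rewrite (subvP (sumv_sup b _ (subvv _))) ?inE // memv_img ?memvf.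
Qed.

End Regularity.

Lemma exists_max_nat (P : nat -> Prop) N : (exists x, P x) ->
  (forall x, P x -> (x <= N)%N) -> exists2 x, P x & forall y, P y -> (y <= x)%N.
Proof.
case=> x0 hx0 hN; pose p := [pred x | `[< P x >]].
have ex : exists x, p x by exists x0; apply/asboolP.
have bd x : p x -> (x <= N)%N by move/asboolP/hN.
case: (ex_maxnP ex bd) => x /asboolP hx hmax.
by exists x => // y hy; apply: hmax; apply/asboolP.
Qed.

(* If [f] has maximal rank in the pencil [f + c g], then [g] maps its kernel
   into its image: otherwise rank r + 1 is reached for some c <> 0. *)
Lemma max_rank_pencil (k : closedFieldType) (V V' : vectType k) (f g : 'Hom(V, V')) :
  (forall c : k, (\dim (limg (f + c *: g)%R) <= \dim (limg f))%N) ->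
  forall u, u \in lker f -> g u \in limg f.
Proof.
move=> hmax u; rewrite memv_ker => /eqP fu; apply: contraT => gu.
pose X := vbasis (limg f); pose r := \dim (limg f).
pose Y := [tuple of g u :: X].
have freeY : free Y.
  by rewrite /= free_cons (span_basis (vbasisP _)) gu (basis_free (vbasisP _)).
have /choice[x hx] (i : 'I_r) : exists v, f v = X`_i.
  have /memv_imgP[v _ ->] : X`_i \in limg f.
    by apply: vbasis_mem; rewrite mem_nth // size_tuple.
  by exists v.
pose w (i : 'I_r.+1) : V := if unlift ord0 i is Some i' then x i' else u.
pose M : 'M[{poly k}]_r.+1 := \matrix_(i, j)
  ((coord Y j (f (w i)))%:P * (if i == ord0 then 0 else 1) +
   (coord Y j (g (w i)))%:P * (if i == ord0 then 1 else 'X)).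
have M0 : map_mx (horner_eval 0) M = 1%:M.
  apply/matrixP => i j; rewrite !mxE /= /horner_eval hornerD !hornerM !hornerC.
  rewrite /w; case: unliftP => [i'|] ->.
    rewrite -(inj_eq (@ord_inj _)) /= !hornerC hornerX mulr0 mulr1 addr0.
    by rewrite hx -[X`_i']/(Y`_(lift ord0 i')) coord_free // eq_sym.
  by rewrite eqxx !hornerC mulr0 mulr1 add0r -[g u]/(Y`_(@ord0 r)) coord_free // eq_sym.
have dM : \det M * 'X != 0.
  rewrite mulf_neq0 ?polyX_eq0 //.
  have : (\det M).[0] != 0.
    by rewrite -[_.[0]]/(horner_eval 0 (\det M)) -det_map_mx M0 det1 oner_neq0.
  by apply: contraNneq => ->; rewrite horner0.
have /closed_nonrootP[c] := dM; rewrite /root hornerM hornerX mulf_eq0 negb_or.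
case/andP=> dc c0; have := hmax c; rewrite leqNgt => /negP; case.
pose z i := (f + c *: g) (w i).
have coordz i j : coord Y j (z i) =
    (if i == ord0 then c else 1) * (map_mx (horner_eval c) M) i j.
  rewrite /z add_lfunE scale_lfunE linearD linearZ !mxE /= /horner_eval.
  rewrite hornerD !hornerM !hornerC; case: eqP => [->|_].
    by rewrite /w unlift_none fu linear0 !hornerC mulr0 mulr1 !add0r.
  by rewrite hornerC hornerX mulr1 mul1r mulrC.
have freez : free [tuple z i | i < r.+1].
  apply/freeP => a sum0 i.
  have : (\row_i (a i * (if i == ord0 then c else 1))) *m map_mx (horner_eval c) M = 0.
    apply/rowP => j; rewrite !mxE; have := congr1 (coord Y j) sum0.
    rewrite linear0 linear_sum => e; rewrite -[RHS]e; apply: eq_bigr => l _.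
    by rewrite nth_mktuple linearZ /= coordz mxE mulrA.
  have U : map_mx (horner_eval c) M \in unitmx.
    by rewrite unitmxE det_map_mx unitfE.
  move/(congr1 (mulmx^~ (invmx (map_mx (horner_eval c) M)))).
  rewrite mulmxK // mul0mx => /rowP/(_ i); rewrite !mxE => /eqP.
  by rewrite mulf_eq0; case: (i == ord0); rewrite ?(negPf c0) ?oner_eq0 orbF => /eqP.
rewrite -/r -[r.+1](size_tuple [tuple z i | i < r.+1]) -(eqP (freez : _ == _)) dimvS //.
apply/span_subvP => v /mapP[i _ ->]; rewrite /z memv_img ?memvf //.
Qed.

Section ShrunkSubspace.
Variable k : closedFieldType.
Hypothesis char0 : [pchar k] =i pred0.
Variables (I : finType) (n : nat) (A : I -> 'M[k]_n).
Local Notation E O := {ffun O -> 'rV[k]_n}.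

Lemma blow_transfer (O : finType) (T : I -> O -> O -> k) :
  exists T' : I -> 'I_#|O| -> 'I_#|O| -> k,
    \dim (limg (blow A T')) = \dim (limg (blow A T)).
Proof.
exists (fun l i j => T l (enum_val i) (enum_val j)).
have [|e eE] := @linear_lfun k (E O) (E 'I_#|O|) (fun Z => [ffun i => Z (enum_val i)]).
  by move=> c x y; apply/ffunP => i; rewrite !ffunE.
have [|e' e'E] := @linear_lfun k (E 'I_#|O|) (E O) (fun Z => [ffun o => Z (enum_rank o)]).
  by move=> c x y; apply/ffunP => i; rewrite !ffunE.
apply: (@dim_limg_conj _ _ _ e e').
- by move=> Z; rewrite eE e'E; apply/ffunP => i; rewrite !ffunE enum_valK.
- by move=> Z; rewrite eE e'E; apply/ffunP => i; rewrite !ffunE enum_rankK.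
move=> Z; rewrite eE; apply/ffunP => i; rewrite ffunE !blowE; apply: eq_bigr => l _.
rewrite [RHS](reindex (@enum_val O predT)) /=; last first.
  by exists enum_rank => x _; rewrite ?enum_valK ?enum_rankK.
by apply: eq_bigr => j _; rewrite e'E ffunE enum_valK.
Qed.

Lemma dim_level (O : finType) : dim (E O) = (#|O| * n)%N.
Proof. by rewrite -[LHS]/(#|O| * dim 'rV[k]_n)%N dim_matrix mul1r. Qed.

Lemma level_eq0 (O : finType) (Z : E O) : (forall o, Z o = 0) -> Z = 0.
Proof. by move=> h; apply/ffunP => o; rewrite h ffunE. Qed.

Lemma dim_blow_le (O : finType) (T : I -> O -> O -> k) :
  (\dim (limg (blow A T)) <= #|O| * n)%N.
Proof. by rewrite (leq_trans (dimvS (subvf _))) // dimvf dim_level. Qed.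

(** By regularity the maximal rank at each level is a multiple of the level, so the quotient is a
    natural number at most [n] and attains a maximum over all levels. *)
Lemma ratio_max : exists (q : nat) (O : finType) (T : I -> O -> O -> k),
  [/\ (0 < #|O|)%N, \dim (limg (blow A T)) = (#|O| * q)%N &
    forall (O' : finType) (T' : I -> O' -> O' -> k),
      (\dim (limg (blow A T')) <= #|O'| * q)%N].
Proof.
have top d : exists (q : nat) (T : I -> 'I_d.+1 -> 'I_d.+1 -> k),
    \dim (limg (blow A T)) = (d.+1 * q)%N /\
    forall T' : I -> 'I_d.+1 -> 'I_d.+1 -> k, (\dim (limg (blow A T')) <= d.+1 * q)%N.
  have [||r [T <-] hr] := @exists_max_nat (fun r =>
      exists T : I -> 'I_d.+1 -> 'I_d.+1 -> k, \dim (limg (blow A T)) = r) (d.+1 * n).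
  - by exists (\dim (limg (blow A (fun _ (_ _ : 'I_d.+1) => 0)))); eexists.
  - by move=> _ [T <-]; have := dim_blow_le T; rewrite card_ord.
  have hT (T' : I -> 'I_d.+1 -> 'I_d.+1 -> k) :
      (\dim (limg (blow A T')) <= \dim (limg (blow A T)))%N by apply: hr; exists T'.
  have /dvdnP[q e] := regularity char0 hT.
  by exists q, T; rewrite e mulnC; split=> // T'; rewrite mulnC -e.
pose P q := exists d (T : I -> 'I_d.+1 -> 'I_d.+1 -> k),
  \dim (limg (blow A T)) = (d.+1 * q)%N.
have [||q [d [T e]] hq] := @exists_max_nat P n.
- by have [q [T [e _]]] := top 0; exists q, 0, T.
- move=> q [d [T e]]; rewrite -(leq_pmul2l (ltn0Sn d)) -e.
  by have := dim_blow_le T; rewrite card_ord.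
exists q, 'I_d.+1, T; rewrite card_ord; split=> // O' T'.
have [O0|O0] := posnP #|O'|.
  by rewrite (leq_trans (dim_blow_le T')) // O0.
have [T'' <-] := blow_transfer T'; move: T''; rewrite -(prednK O0) => T''.
have [q' [T3 [e3 h3]]] := top #|O'|.-1.
by rewrite (leq_trans (h3 _)) // leq_pmul2l // hq //; exists #|O'|.-1, T3.
Qed.

Lemma coordinate_ex (O : finType) (p : O) : exists g : 'Hom(E O, 'rV[k]_n),
  forall Z, g Z = Z p.
Proof. by apply: linear_lfun => c x y; rewrite !ffunE. Qed.

Definition coordinate_map (O : finType) (p : O) := projT1 (cid (coordinate_ex p)).

Lemma coordinate_mapE (O : finType) (p : O) Z : coordinate_map p Z = Z p.
Proof. by rewrite /coordinate_map; case: cid => g /= ->. Qed.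

Lemma mulmxr_ex (M : 'M[k]_n) : exists g : 'End('rV[k]_n), forall w, g w = w *m M.
Proof. by apply: linear_lfun => c x y; rewrite mulmxDl scalemxAl. Qed.

Definition mulmxr_map (M : 'M[k]_n) := projT1 (cid (mulmxr_ex M)).

Lemma mulmxr_mapE (M : 'M[k]_n) w : mulmxr_map M w = w *m M.
Proof. by rewrite /mulmxr_map; case: cid => g /= ->. Qed.

(** The smallest space [U] of rows for which [U^O] contains the kernel; a nonzero kernel would make
    it a shrunk subspace for an optimal [T]. *)
Definition kernel_rows (O : finType) (T : I -> O -> O -> k) : {vspace 'rV[k]_n} :=
  (\sum_p coordinate_map p @: lker (blow A T))%VS.

Lemma kernel_rowsP (O : finType) (T : I -> O -> O -> k) Z p :
  Z \in lker (blow A T) -> Z p \in kernel_rows T.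
Proof.
move=> hZ; apply: (subvP (sumv_sup p _ (subvv _))) => //.
by rewrite -coordinate_mapE memv_img.
Qed.

Definition image_span (U : {vspace 'rV[k]_n}) : {vspace 'rV[k]_n} :=
  (\sum_l mulmxr_map (A l) @: U)%VS.

(** Take [T] of maximal rank ratio and, among these, with [K = kernel_rows T] of maximal dimension.
    Maximal rank puts [blow A B Z], for [Z] in the kernel, into the image of [f], and maximality of
    [K] puts its preimages into [K^O]. Hence the image of [K^O] contains the power of
    [image_span K], and [dim K <= dim (image_span K)] leaves no room for a kernel. *)
Theorem nonsingular_blow_up :
  (forall U : {vspace 'rV[k]_n}, \dim U <= \dim (image_span U))%N ->
  exists (O : finType) (T : I -> O -> O -> k), (0 < #|O|)%N /\ lker (blow A T) = 0%VS.
Proof.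
move=> noshrunk; have [q [O0 [T0 [c0 e0 maxq]]]] := ratio_max.
pose P x := exists (O : finType) (T : I -> O -> O -> k),
  [/\ (0 < #|O|)%N, \dim (limg (blow A T)) = (#|O| * q)%N & \dim (kernel_rows T) = x].
have [||x [O [T [cO eT eK]]] maxK] := @exists_max_nat P n.
- by exists (\dim (kernel_rows T0)), O0, T0.
- move=> _ [O [T [_ _ <-]]]; rewrite (leq_trans (dimvS (subvf _))) //.
  by rewrite dimvf dim_matrix mul1r.
exists O, T; split=> //; set f := blow A T; set K := kernel_rows T.
have claim1 B (Z : E O) : Z \in lker f -> blow A B Z \in limg f.
  apply: max_rank_pencil => c; rewrite eT.
  apply: leq_trans (maxq O (fun l o p => T l o p + c * B l o p)); rewrite leq_eqVlt.
  apply/orP; left; apply/eqP; congr (\dim _); congr (lfun_img _ _).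
  apply/lfunP => W; rewrite add_lfunE scale_lfunE; apply/ffunP => o.
  rewrite !ffunE !blowE scaler_sumr -big_split; apply: eq_bigr => l _.
  rewrite scaler_sumr -big_split; apply: eq_bigr => p _ /=.
  by rewrite scalerA -scalerDl.
(* At the doubled level, the triangular [TT] with diagonal blocks [T] and corner [- B] has a kernel
   at most twice that of [f], so its ratio is still optimal. Its row space contains [K], hence
   equals [K], and the pair of [Z0] and [Z1] lies in its kernel. *)
have claim2 B (Z0 Z1 : E O) p : Z0 \in lker f -> f Z1 = blow A B Z0 -> Z1 p \in K.
  move=> hZ0 e1.
  pose TT l (a b : O + O) := match a, b with
    | inl o, inl p => T l o p | inr o, inr p => T l o p
    | inr o, inl p => - B l o p | inl o, inr p => 0 end.
  pose pair (X Y : E O) : E (O + O)%type :=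
    [ffun a => match a with inl o => X o | inr o => Y o end].
  have TTE X Y : blow A TT (pair X Y) = pair (f X) (f Y - blow A B X).
    apply/ffunP => -[o|o]; rewrite [RHS]ffunE blowE.
      rewrite /f blowE; apply: eq_bigr => l _; rewrite big_sumType /=.
      rewrite [X in _ + X]big1 ?addr0 => [|p' _]; last by rewrite scale0r.
      by apply: eq_bigr => p' _; rewrite ffunE.
    rewrite !ffunE /f !blowE -sumrB; apply: eq_bigr => l _.
    rewrite big_sumType /= addrC -sumrN; congr (_ + _); apply: eq_bigr => p' _;
    by rewrite ffunE ?scaleNr.
  have pairE (W : E (O + O)%type) : W = pair [ffun o => W (inl o)] [ffun o => W (inr o)].
    by apply/ffunP => -[o|o]; rewrite !ffunE.
  have [|pr prE] := @linear_lfun k (E (O + O)%type) (E O) (fun W => [ffun o => W (inl o)]).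
    by move=> c X Y; apply/ffunP => o; rewrite !ffunE.
  have [|ir irE] := @linear_lfun k (E O) (E (O + O)%type) (fun Y => pair 0 Y).
    move=> c X Y; apply/ffunP => -[o|o]; rewrite !ffunE //.
    by rewrite scaler0 addr0.
  have kerTT : (\dim (lker (blow A TT)) <= \dim (lker f) + \dim (lker f))%N.
    rewrite -(limg_ker_dim pr (lker (blow A TT))) leq_add //.
      have -> : \dim (lker f) = \dim (ir @: lker f).
        rewrite limg_dim_eq //; apply/eqP; rewrite -subv0; apply/subvP => Y /memv_capP[_].
        rewrite memv_ker memv0 irE => /eqP h; apply/eqP; apply: level_eq0 => o.
        by have := congr1 (fun W : E (O + O)%type => W (inr o)) h; rewrite !ffunE.
      apply/dimvS/subvP => W /memv_capP[]; rewrite !memv_ker => /eqP hW.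
      rewrite prE => /eqP h0.
      have eW : W = ir [ffun o => W (inr o)] by rewrite irE {1}(pairE W) h0.
      rewrite eW memv_img // memv_ker; apply/eqP; apply: level_eq0 => o.
      have := congr1 (fun W' : E (O + O)%type => W' (inr o)) hW.
      rewrite {1}(pairE W) h0 TTE linear0 ![in X in X -> _]ffunE.
      by rewrite linear0 ffunE subr0.
    apply/dimvS/subvP => _ /memv_imgP[W hW ->]; rewrite prE memv_ker.
    move: hW; rewrite memv_ker {1}(pairE W) TTE => /eqP h; apply/eqP; apply: level_eq0 => o.
    by have := congr1 (fun W' : E (O + O)%type => W' (inl o)) h; rewrite !ffunE.
  have rTT : \dim (limg (blow A TT)) = (#|{: O + O}| * q)%N.
    apply/eqP; rewrite eqn_leq maxq card_sum mulnDl -eT.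
    have := limg_ker_dim (blow A TT) fullv; have := limg_ker_dim f fullv.
    rewrite !capfv !dimvf !dim_level card_sum mulnDl -/f; move: kerTT.
    move: (\dim _) (\dim _) (\dim _) (\dim _) => x1 x2 x3 x4; lia.
  have sK : (K <= kernel_rows TT)%VS.
    apply/subv_sumP => o _; apply/subvP => _ /memv_imgP[Y hY ->].
    have -> : coordinate_map o Y = ir Y (inr o) by rewrite coordinate_mapE irE ffunE.
    apply: kernel_rowsP; rewrite memv_ker irE TTE !linear0 addr0.
    move: hY; rewrite memv_ker => /eqP ->; apply/eqP; apply: level_eq0 => -[o'|o']; by rewrite !ffunE.
  have /eqP -> : K == kernel_rows TT.
    rewrite -(dimv_leqif_eq sK) eqn_leq dimvS //= eK maxK //.
    exists (O + O)%type, TT; split=> //; rewrite card_sum addn_gt0 cO //.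
  have -> : Z1 p = pair Z0 Z1 (inr p) by rewrite ffunE.
  apply: kernel_rowsP; rewrite memv_ker TTE e1 subrr.
  move: hZ0; rewrite memv_ker => /eqP ->.
  by apply/eqP; apply: level_eq0 => -[o|o]; rewrite !ffunE.
pose KK := prodv (fun _ : O => K); pose WW := prodv (fun _ : O => image_span K).
have kerK : (lker f <= KK)%VS.
  by apply/subvP => Z hZ; apply/mem_prodv => o; apply: kernel_rowsP.
have WK : (WW <= f @: KK)%VS.
  apply/subvP => W /mem_prodv hW; rewrite (ffun_inj_sum W) rpred_sum // => o _.
  have /memv_sumP[y hy ->] := hW o; rewrite linear_sum rpred_sum // => l _.
  have /memv_imgP[z zK ->] := hy l isT; have /memv_sumP[z' hz' ->] := zK.
  rewrite !linear_sum rpred_sum // => p _.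
  have /memv_imgP[Z hZ ->] := hz' p isT; rewrite /= coordinate_mapE mulmxr_mapE.
  have {}hZ : (Z : E O) \in lker f by [].
  move: (Z : E O) hZ => {}Z hZ.
  (* The matrix unit that carries row [p] through [A l] to slot [o]; such vectors span [WW]. *)
  pose B l' o' p' : k := ((l' == l) && (o' == o) && (p' == p))%:R.
  have -> : ffun_inj 'rV[k]_n o (Z p *m A l) = blow A B Z.
    apply/ffunP => o'; rewrite ffun_injE blowE (bigD1 l) //= [X in _ + X]big1 ?addr0.
      rewrite (bigD1 p) //= [X in _ + X]big1 ?addr0 /B ?eqxx ?andbT.
        by case: eqP => _; rewrite ?scale1r ?scale0r.
      by move=> p' /negPf ->; rewrite andbF scale0r.
    by move=> l' /negPf ne; rewrite big1 // => p' _; rewrite /B ne scale0r.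
  have /memv_imgP[V _ eV] := claim1 B Z hZ; rewrite eV memv_img //.
  by apply/mem_prodv => p'; apply: (claim2 B Z); rewrite -?eV.
have := limg_ker_dim f KK; rewrite (capv_idPr kerK) dim_prodv sum_nat_const => e.
have := dimvS WK; rewrite dim_prodv sum_nat_const => le1.
apply/eqP; rewrite -dimv_eq0 -leqn0 -(leq_add2r (#|O| * \dim (image_span K))) add0n.
have le2 : (#|O| * \dim K <= #|O| * \dim (image_span K))%N.
  by rewrite leq_mul2l noshrunk orbT.
by apply: leq_trans le2; rewrite -e leq_add2l.
Qed.

End ShrunkSubspace.

(** * King's criterion *)

(** The first [dim Y] columns of [S] span [Y]; [S] is the transposed row factor of the rank
    factorisation of a matrix whose rows are a basis of [Y]. *)
Lemma adapted_basis (K : fieldType) n (Y : {vspace 'cV[K]_n}) :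
  exists2 S : 'M[K]_n, S \in unitmx &
    forall v, v \in Y <-> forall s : 'I_n, (\dim Y <= s)%N -> (invmx S *m v) s 0 = 0.
Proof.
set r := \dim Y; pose A : 'M[K]_(r, n) := \matrix_i ((vbasis Y)`_i)^T.
have mulA (u : 'rV_r) : (u *m A)^T = \sum_i u 0 i *: (vbasis Y)`_i.
  rewrite mulmx_sum_row linear_sum; apply: eq_bigr => i _.
  by rewrite linearZ /= rowK trmxK.
have rA : \rank A = r.
  apply/eqP/inj_row_free => u /(congr1 trmx); rewrite mulA trmx0 => h.
  apply/rowP => i; rewrite mxE.
  by have /freeP := basis_free (vbasisP Y); apply.
have memY v : v \in Y <-> exists u : 'rV_r, v^T = u *m A.
  split=> [vY|[u /(congr1 trmx)]]; last first.
    rewrite trmxK mulA => ->; rewrite rpred_sum // => i _; rewrite rpredZ //.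
    by apply: vbasis_mem; rewrite mem_nth // size_tuple.
  exists (\row_i coord (vbasis Y) i v); apply: trmx_inj; rewrite trmxK mulA.
  by rewrite {1}(coord_vbasis vY); apply: eq_bigr => i _; rewrite mxE.
have eA := mulmx_ebase A; rewrite rA in eA.
have := row_ebase_unit A; have := col_ebase_unit A.
move: (col_ebase A) (row_ebase A) eA => C E eA uC uE.
exists E^T; first by rewrite unitmx_tr.
move=> v; have -> : invmx E^T *m v = (v^T *m invmx E)^T.
  by rewrite trmx_mul trmxK trmx_inv.
split.
  case/memY=> u ->; rewrite -eA !mulmxA mulmxK // => s rs.
  rewrite !mxE big1 // => i _; rewrite [pid_mx _ _ _]mxE.
  by case: eqP => [e|_]; rewrite ?mulr0 //=; have := ltn_ord i; rewrite e ltnNge rs.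
move=> h; apply/memY; set x := v^T *m invmx E in h.
have rn : (r <= n)%N by rewrite -rA rank_leq_col.
have ex : x = x *m pid_mx r *m (pid_mx r : 'M_(r, n)).
  rewrite -mulmxA mul_pid_mx !minnn.
  apply/rowP => s; rewrite [RHS]mxE (bigD1 s) //= big1 ?addr0 => [|i ne].
    rewrite [pid_mx _ _ _]mxE eqxx /=; case: ltnP => hs; rewrite ?mulr1 // mulr0.
    by have := h s hs; rewrite mxE.
  by rewrite [pid_mx _ _ _]mxE (inj_eq (@ord_inj _)) (negPf ne) mulr0.
exists (x *m pid_mx r *m invmx C).
rewrite -eA !mulmxA mulmxKV // -ex /x mulmxKV //.
Qed.

Lemma prod_exprz (K : fieldType) (J : finType) (t : K) (e : J -> int) :
  t != 0 -> \prod_i t ^ (e i) = t ^ (\sum_i e i).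
Proof.
by move=> t0; elim/big_rec2: _ => [|i x y _ ->]; rewrite ?expr0z // expfzDr.
Qed.

Lemma det_diag_power (K : comNzRingType) n r (t : K) : (r <= n)%N ->
  \det (diag_mx (\row_(s < n) (if (s < r)%N then t else 1))) = t ^+ r.
Proof.
move=> rn; rewrite det_diag (eq_bigr (fun s : 'I_n => if (s < r)%N then t else 1)).
  by rewrite -big_mkcond -(big_ord_widen n (fun=> t) rn) prodr_const card_ord.
by move=> s _; rewrite mxE.
Qed.

Lemma mul_diag_power (K : fieldType) n r (t : K) : t != 0 ->
  diag_mx (\row_(s < n) (if (s < r)%N then t else 1)) *m
  diag_mx (\row_(s < n) (if (s < r)%N then t^-1 else 1)) = 1%:M.
Proof.
move=> t0; rewrite mulmx_diag; apply/matrixP => i j; rewrite !mxE.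
by case: ifP => _; rewrite ?mulfV ?mulr1.
Qed.

Lemma dim_cv_le (K : fieldType) n (U : {vspace 'cV[K]_n}) : (\dim U <= n)%N.
Proof.
have := dimvS (subvf U); rewrite dimvf dim_matrix.
by rewrite mulr1.
Qed.

Section OneParameter.
Variables (k : closedFieldType) (Q : double_quiver) (alpha : Q -> nat).

(* The one-parameter subgroup scaling a subrepresentation by [t] extends
   polynomially to [t = 0], so a semi-invariant that does not vanish at [B]
   cannot have negative weight on it. *)
Lemma semistable_rep_sub theta (B : rep k alpha) Y :
  semistable theta B -> rep_sub B Y -> 0 <= pairing theta (rdim Y).
Proof.
case=> momB [n [m [f [n0 mE finv fB]]]] subY.
have /dependent_choice[S hS] (i : Q) : exists S : 'M[k]_(alpha i), S \in unitmx /\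
    forall v, v \in Y i <->
      forall s : 'I_(alpha i), (\dim (Y i) <= s)%N -> (invmx S *m v) s 0 = 0.
  by have [S uS h] := adapted_basis (Y i); exists S.
have uS i : S i \in unitmx by case: (hS i).
have memY i v : v \in Y i <->
    forall s : 'I_(alpha i), (\dim (Y i) <= s)%N -> (invmx (S i) *m v) s 0 = 0.
  by case: (hS i).
pose low i (s : 'I_(alpha i)) := (s < \dim (Y i))%N.
pose D t i : 'M[k]_(alpha i) := diag_mx (\row_s (if low i s then t else 1)).
pose g t i := S i *m D t i *m invmx (S i).
pose C i j (a : arrow i j) := invmx (S j) *m B i j a *m S i.
have C0 i j a r s : ~~ low j r -> low i s -> C i j a r s = 0.
  rewrite /low -leqNgt => hr hs.
  have : B i j a *m (S i *m delta_mx s 0) \in Y j.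
    apply: subY; apply/memY => s' hs'; rewrite mulKmx // mxE.
    by case: eqP => // e; move: hs'; rewrite e leqNgt hs.
  by move/memY/(_ r hr); rewrite !mulmxA -colE mxE.
(* The subtraction is truncated: the case that would need the power -1 gets exponent 0, and there
   the entry is 0 by [C0]. *)
pose CP i j a : 'M[{poly k}]_(alpha j, alpha i) :=
  \matrix_(r, s) ((C i j a r s)%:P * 'X^(low j r - low i s)).
pose BP i j a := map_mx polyC (S j) *m CP i j a *m map_mx polyC (invmx (S i)).
have detg t i : \det (g t i) = t ^+ \dim (Y i).
  rewrite /g det_mulmx det_mulmx mulrAC -det_mulmx mulmxV // det1 mul1r.
  by rewrite det_diag_power // dim_cv_le.
have ug t i : t != 0 -> g t i \in unitmx by move=> t0; rewrite unitmxE detg unitfE expf_neq0.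
have actE t i j a : t != 0 -> act (g t) B a = map_mx (horner_eval t) (BP i j a).
  move=> t0; have gV : invmx (g t i) = S i *m D t^-1 i *m invmx (S i).
    have e : g t i *m (S i *m D t^-1 i *m invmx (S i)) = 1%:M.
      by rewrite /g !mulmxA mulmxKV // -[S i *m _ *m _]mulmxA mul_diag_power // mulmx1 mulmxV.
    by rewrite -[LHS]mulmx1 -e mulKmx // ug.
  have hC p q (x : 'M[k]_(p, q)) : map_mx (horner_eval t) (map_mx polyC x) = x.
    by apply/matrixP => r s; rewrite !mxE /horner_eval hornerC.
  rewrite /act gV /BP !map_mxM !hC.
  have -> : map_mx (horner_eval t) (CP i j a) = D t j *m C i j a *m D t^-1 i.
    rewrite /CP; move: (C i j a) (@C0 i j a) => c c0.
    apply/matrixP => r s; rewrite mul_mx_diag mul_diag_mx !mxE /horner_eval.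
    rewrite hornerM hornerC hornerXn.
    move: (c0 r s); move: (c r s) => x.
    case: (low j r) => [_|/(_ isT)]; case: (low i s) => //=; rewrite ?mul1r ?mulr1 ?expr1 ?expr0 //.
    - by rewrite mulrAC mulfV // mul1r.
    - by rewrite mulrC.
    - by move=> ->; rewrite ?mul0r.
  by rewrite /C /g !mulmxA.
pose h (c : coordinate alpha) : {poly k} :=
  let: existT i (existT j (a, r, s)) := c in BP i j a r s.
pose F := mmap polyC (fun x => h (enum_val x)) f.
have FE t : t != 0 -> F.[t] = eval_rep f (act (g t) B).
  move=> t0; rewrite /F /eval_rep /meval /mmap horner_sum; apply: eq_bigr => x _.
  rewrite hornerM hornerC; congr (_ * _); rewrite /mmap1 horner_prod; apply: eq_bigr => y _.
  rewrite horner_exp; congr (_ ^+ _); case: (enum_val y) => i [j [[a r] s]] /=.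
  by rewrite actE // [RHS]mxE.
pose w := \sum_i m i * (\dim (Y i))%:Z.
have chiE t : t != 0 -> chi m (g t) = t ^ w.
  move=> t0; rewrite /chi -prod_exprz //; apply: eq_bigr => i _.
  by rewrite detg mulrC exprnP exprz_exp.
have we : w%:~R = n%:R * pairing theta (rdim Y).
  rewrite rmorph_sum /pairing mulr_sumr; apply: eq_bigr => i _ /=.
  by rewrite intrM mE ffunE mulrA.
have : 0 <= w.
  rewrite leNgt; apply/negP => w0.
  have [e ew] : exists e, w = Negz e by case: (w) w0 => // e; exists e.
  (* For [t != 0] equivariance gives [F(t) = t^w f(B)] with [w = - e.+1], so [P] vanishes there,
     although [P(0) = - f(B)] is nonzero. The extra factor ['X] makes the chosen nonroot nonzero. *)
  pose P := F * 'X^(e.+1) - (eval_rep f B)%:P.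
  have : P * 'X != 0.
    rewrite mulf_neq0 ?polyX_eq0 //; apply: contraNneq fB => /(congr1 (horner_eval 0)).
    by rewrite /P /horner_eval hornerD hornerN hornerM hornerXn hornerC horner0 expr0n mulr0 add0r => /eqP; rewrite oppr_eq0.
  case/closed_nonrootP => t; rewrite /root hornerM hornerX mulf_eq0 negb_or => /andP[hP t0].
  case/negP: hP; rewrite /P hornerD hornerN hornerM hornerXn hornerC FE // finv //.
    by rewrite chiE // ew NegzE -exprnN mulrAC mulVf ?expf_neq0 // mul1r subrr.
  by move=> i; apply: ug.
by rewrite -(ler0z rat) we pmulr_rge0 // ltr0n.
Qed.

End OneParameter.

Theorem nonsingular_pencil (k : closedFieldType) (char0 : [pchar k] =i pred0)
    (I : finType) n1 n2 (A : I -> 'M[k]_(n1, n2)) : n1 = n2 ->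
  (forall (U : {vspace 'rV[k]_n1}) (V : {vspace 'rV[k]_n2}),
     (forall l u, u \in U -> u *m A l \in V) -> (\dim U <= \dim V)%N) ->
  exists (O : finType) (T : I -> O -> O -> k), (0 < #|O|)%N /\
    forall Z : O -> 'rV[k]_n1,
      (forall o, \sum_l \sum_p T l o p *: (Z p *m A l) = 0) -> forall o, Z o = 0.
Proof.
move=> e; case: n2 / e A => A noshrunk.
have [U|O [T [O0 kerT]]] := @nonsingular_blow_up k char0 I n1 A.
  apply: noshrunk => l u uU; apply: (subvP (sumv_sup l _ (subvv _))) => //.
  by rewrite -mulmxr_mapE memv_img.
exists O, T; split=> // Z hZ o; pose Z' : {ffun O -> 'rV[k]_n1} := [ffun o => Z o].
suff /ffunP/(_ o) : Z' = 0 by rewrite !ffunE.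
apply/eqP; rewrite -memv0 -kerT memv_ker; apply/eqP; apply: level_eq0 => p.
rewrite blowE -[RHS](hZ p); apply: eq_bigr => l _; apply: eq_bigr => q _.
by rewrite ffunE.
Qed.

Lemma det_mxdiag (R : comNzRingType) n (p : 'I_n -> nat) (D : forall i, 'M[R]_(p i)) :
  \det (\mxdiag_i D i) = \prod_i \det (D i).
Proof.
elim: n p D => [|n IH] p D.
  rewrite [RHS]big_ord0; have : (\sum_(i < 0) p i)%N = 0 by rewrite big_ord0.
  by move: (\mxdiag_i D i); case: (\sum_i _)%N => // M _; rewrite det_mx00.
rewrite [RHS]big_ord_recl -IH mxdiag_recl; move: mxsize_recl => e.
have <- := det_ublock (D ord0) 0 (\mxdiag_j D (lift ord0 j)).
by move: (block_mx _ _ _ _) => M; case: _ / e; rewrite castmx_id.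
Qed.

Lemma det_cast_mul (R : comNzRingType) n1 n2 (e : n1 = n2) (D1 : 'M[R]_n1)
    (W : 'M[R]_(n1, n2)) (D2 : 'M[R]_n2) :
  \det (castmx (erefl, esym e) (D1 *m W *m D2)) =
  \det D1 * \det (castmx (erefl, esym e) W) * \det D2.
Proof. by case: n2 / e W D2 => W D2; rewrite !castmx_id !det_mulmx. Qed.

Lemma det_cast_map (R S : comNzRingType) (f : {rmorphism R -> S}) n1 n2
    (e : n1 = n2) (W : 'M[R]_(n1, n2)) :
  f (\det (castmx (erefl, esym e) W)) = \det (castmx (erefl, esym e) (map_mx f W)).
Proof. by case: n2 / e W => W; rewrite !castmx_id det_map_mx. Qed.

Lemma det_cast_neq0 (K : fieldType) n1 n2 (e : n1 = n2) (W : 'M[K]_(n1, n2)) :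
  (forall w : 'rV_n1, w *m W = 0 -> w = 0) ->
  \det (castmx (erefl, esym e) W) != 0.
Proof.
case: n2 / e W => W h; rewrite castmx_id -unitfE -[_ \is a _]unitmxE -row_free_unit.
exact: inj_row_free.
Qed.

(** * Determinantal semi-invariants *)

Section Pencil.
Variables (Q : double_quiver) (alpha : Q -> nat).

(* The generic block between a copy of the space at [i] and one at [j]; all
   matrices are transposed, as row vectors are acted on from the right. *)
Definition pencil_block (R : comNzRingType)
    (B : forall i j : Q, arrow i j -> 'M[R]_(alpha j, alpha i))
    i j (y : R) (x : arrow i j -> R) : 'M[R]_(alpha i, alpha j) :=
  (if i == j then y *: pid_mx (alpha i) else 0) + \sum_a x a *: (B i j a)^T.

Lemma map_pencil_block (R S : comNzRingType) (f : {rmorphism R -> S}) B i j y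
    (x : arrow i j -> R) :
  map_mx f (pencil_block B y x) =
  pencil_block (fun i j a => map_mx f (B i j a)) (f y) (fun a => f (x a)).
Proof.
rewrite /pencil_block map_mxD map_mx_sum; congr (_ + _).
  by case: ifP => _; rewrite ?map_mx0 // map_mxZ map_pid_mx.
by apply: eq_bigr => a _; rewrite map_mxZ map_trmx.
Qed.

Variable k : fieldType.

Lemma pencil_block_act (g : forall i : Q, 'M[k]_(alpha i)) (B : rep k alpha) i j y
    (x : arrow i j -> k) : (forall i, g i \in unitmx) ->
  pencil_block (act g B) y x = (invmx (g i))^T *m pencil_block B y x *m (g j)^T.
Proof.
move=> ug; rewrite /pencil_block mulmxDr mulmxDl; congr (_ + _).
  case: eqP => [e|_]; last by rewrite mulmx0 mul0mx.
  case: j / e {x}; rewrite pid_mx_1 -scalemxAr -scalemxAl mulmx1 -trmx_mul mulmxV //.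
  by rewrite trmx1.
rewrite mulmx_sumr mulmx_suml; apply: eq_bigr => a _.
by rewrite -scalemxAr -scalemxAl /act !trmx_mul mulmxA.
Qed.

End Pencil.

Section Blocks.
Variables (K : fieldType) (n : nat) (p : 'I_n -> nat).

(** At [c = b] the matrix [pid_mx (p c)] is the identity; it avoids a cast between sizes that are
    equal only propositionally. *)
Lemma block_injection_ex b : exists g : 'Hom('cV[K]_(p b), 'rV[K]_(\sum_b p b)),
  forall v, g v = \mxrow_c (if c == b then v^T *m pid_mx (p c) else 0).
Proof.
apply: linear_lfun => t x y; apply/rowP => s; rewrite !mxE.
case: ifP => _; last by rewrite !mxE mulr0 addr0.
by rewrite linearD linearZ /= mulmxDl -scalemxAl !mxE.
Qed.

Definition block_injection b := projT1 (cid (block_injection_ex b)).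

Lemma block_injectionE b v c : submxrow (block_injection b v) c =
  if c == b then v^T *m pid_mx (p c) else 0.
Proof. by rewrite /block_injection; case: cid => g /= ->; rewrite mxrowK. Qed.

Lemma block_injectionK b v : submxrow (block_injection b v) b = v^T.
Proof. by rewrite block_injectionE eqxx pid_mx_1 mulmx1. Qed.

Lemma block_injection_sum (u : 'rV[K]_(\sum_b p b)) :
  u = \sum_b block_injection b (submxrow u b)^T.
Proof.
apply/mxrowP => c; rewrite submxrow_sum (bigD1 c) //= block_injectionK trmxK.
rewrite big1 ?addr0 // => b ne; by rewrite block_injectionE eq_sym (negPf ne).
Qed.

Lemma dim_blocks (W : forall b, {vspace 'cV[K]_(p b)}) :
  exists2 X : {vspace 'rV[K]_(\sum_b p b)}, \dim X = (\sum_b \dim (W b))%N &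
    forall u, u \in X <-> forall b, (submxrow u b)^T \in W b.
Proof.
have inj0 b : (W b :&: lker (block_injection b))%VS = 0%VS.
  apply/eqP; rewrite -subv0; apply/subvP => v /memv_capP[_].
  rewrite memv_ker memv0 => /eqP h; rewrite -[v]trmxK -block_injectionK h submxrow0.
  by rewrite trmx0.
exists (\sum_b block_injection b @: W b)%VS.
  have /directv_sum_independent dir : forall us : 'I_n -> 'rV[K]_(\sum_b p b),
      (forall b, true -> us b \in (block_injection b @: W b)%VS) ->
      \sum_b us b = 0 -> forall b, true -> us b = 0.
    move=> us hus sum0 b _; have /memv_imgP[v _ e] := hus b isT.
    have := congr1 (fun u => submxrow u b) sum0; rewrite submxrow_sum submxrow0.
    rewrite (bigD1 b) //= big1 ?addr0 => [|c ne].
      by rewrite e block_injectionK => h; rewrite -[v]trmxK h trmx0 linear0.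
    have /memv_imgP[w _ ->] := hus c isT.
    by rewrite block_injectionE eq_sym (negPf ne).
  rewrite (directvP dir) /=; apply: eq_bigr => b _.
  exact/limg_dim_eq/inj0.
move=> u; split=> [/memv_sumP[us hus ->] b|h].
  rewrite submxrow_sum (bigD1 b) //= big1 ?addr0 => [|c ne].
    by have /memv_imgP[v hv ->] := hus b isT; rewrite block_injectionK trmxK.
  have /memv_imgP[w _ ->] := hus c isT.
  by rewrite block_injectionE eq_sym (negPf ne).
rewrite (block_injection_sum u) rpred_sum // => b _.
by apply: (subvP (sumv_sup b isT (subvv _))); rewrite memv_img ?h.
Qed.

End Blocks.

Section Copies.
Variable (Q : finType) (a : Q -> nat).

Definition copies : finType := {i : Q & 'I_(a i)}.

Definition site (b : 'I_#|copies|) : Q := tag (enum_val b).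

Lemma big_site (R : Type) (idx : R) (op : Monoid.com_law idx) (F : Q -> R) :
  \big[op/idx]_b F (site b) = \big[op/idx]_i \big[op/idx]_(r < a i) F i.
Proof.
rewrite -(big_enum_val (fun z : copies => F (tag z))) /=.
by rewrite (sig_big_dep _ _ (fun i (r : 'I_(a i)) => F i)).
Qed.

Lemma sum_site (F : Q -> nat) : (\sum_b F (site b) = \sum_i a i * F i)%N.
Proof.
by rewrite (@big_site _ _ addn); apply: eq_bigr => i _; rewrite sum_nat_const card_ord.
Qed.

Lemma prod_site (R : comNzRingType) (F : Q -> R) :
  \prod_b F (site b) = \prod_i F i ^+ a i.
Proof.
by rewrite big_site; apply: eq_bigr => i _; rewrite prodr_const card_ord.
Qed.

End Copies.

Section KingWeights.
Variables (k : closedFieldType) (Q : double_quiver) (alpha : Q -> nat).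
Hypothesis char0 : [pchar k] =i pred0.
Variables (m : Q -> int) (c : nat) (a : Q -> nat).
Hypothesis aE : forall i, (a i)%:Z = c%:Z - m i.
Hypothesis c_ge : \sum_i `|m i| * (alpha i)%:Z <= c%:Z.
Hypothesis m_alpha : \sum_i m i * (alpha i)%:Z = 0.

Local Notation cc := (fun _ : Q => c).
Local Notation src := (@site Q a).
Local Notation tgt := (@site Q cc).
Local Notation N1 := (\sum_b alpha (src b))%N.
Local Notation N2 := (\sum_b alpha (tgt b))%N.

(** The difference [N1 - N2] is the sum of [(a i - c) * alpha i], which is [- m(alpha) = 0]. *)
Lemma pencil_square : N1 = N2.
Proof.
apply/eqP; rewrite -eqz_nat (sum_site a alpha) (sum_site cc alpha) !(big_morph Posz PoszD (erefl _)).
rewrite -subr_eq0 -sumrB -oppr_eq0 -sumrN -{2}m_alpha; apply/eqP.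
apply: eq_bigr => i _; rewrite !PoszM aE; ring.
Qed.

Definition any_arrow : finType := {i : Q & {j : Q & arrow i j}}.

Definition pack i j (x : arrow i j) : any_arrow :=
  Tagged (fun i => {j : Q & arrow i j}) (Tagged (fun j => arrow i j) x).

Lemma pack_inj i j : injective (@pack i j).
Proof. by move=> x y /eqP; rewrite /pack eq_Tagged /= eq_Tagged /= => /eqP. Qed.

(** A label selects a source copy, a target copy and either the identity ([None]) or an arrow;
    incompatible choices give the zero matrix. *)
Definition pencil_label : finType :=
  ('I_#|copies a| * 'I_#|copies cc| * option any_arrow)%type.

Definition id_coef (R : comNzRingType) (l : pencil_label) b b' : R :=
  ((l.1 == (b, b')) && (l.2 == None))%:R.

Definition arrow_coef (R : comNzRingType) (l : pencil_label) b b'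
    (x : arrow (src b) (tgt b')) : R :=
  ((l.1 == (b, b')) && (l.2 == Some (pack x)))%:R.

Definition pencil (R : comNzRingType)
    (B : forall i j : Q, arrow i j -> 'M[R]_(alpha j, alpha i))
    (l : pencil_label) : 'M[R]_(N1, N2) :=
  \mxblock_(b, b') pencil_block B (id_coef R l b b') (@arrow_coef R l b b').

Lemma map_pencil (R S : comNzRingType) (f : {rmorphism R -> S}) B l :
  map_mx f (pencil B l) = pencil (fun i j x => map_mx f (B i j x)) l.
Proof.
apply/mxblockP => b b'; rewrite mxblockK; transitivity (map_mx f (submxblock (pencil B l) b b')).
  by apply/matrixP => r s; rewrite !mxE.
rewrite mxblockK map_pencil_block /id_coef rmorph_nat; congr (pencil_block _ _ _).
by apply/funext => x; rewrite /arrow_coef rmorph_nat.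
Qed.

Lemma pencil_act (g : forall i : Q, 'M[k]_(alpha i)) (B : rep k alpha) l :
  (forall i, g i \in unitmx) ->
  pencil (act g B) l = (\mxdiag_b (invmx (g (src b)))^T) *m pencil B l *m
    (\mxdiag_b' (g (tgt b'))^T).
Proof.
move=> ug; rewrite mul_mxdiag_mxblock mul_mxblock_mxdiag; apply: eq_mxblock => b b'.
exact: pencil_block_act.
Qed.

Variable B : rep k alpha.

Lemma mul_pencil (u : 'rV_N1) l b' :
  submxrow (u *m pencil B l) b' =
  \sum_b submxrow u b *m pencil_block B (id_coef k l b b') (@arrow_coef k l b b').
Proof. by rewrite -{1}[u]submxrowK mul_mxrow_mxblock mxrowK. Qed.

Section Shrunk.
Variables (U : {vspace 'rV[k]_N1}) (V : {vspace 'rV[k]_N2}).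
Hypothesis UV : forall l u, u \in U -> u *m pencil B l \in V.
Local Notation inj := (@block_injection k _ (fun b => alpha (tgt b))).

Lemma pencil_id b b' u : src b = tgt b' -> u \in U ->
  inj b' (pid_mx (alpha (tgt b')) *m (submxrow u b)^T) \in V.
Proof.
move=> e /(UV (b, b', None)); congr (_ \in V); apply/mxrowP => d'.
rewrite mul_pencil block_injectionE (bigD1 b) //= big1 ?addr0 => [|d ne]; last first.
  rewrite /pencil_block /id_coef /arrow_coef /= xpair_eqE [b == d]eq_sym (negPf ne) /=.
  by rewrite scale0r if_same add0r big1 ?mulmx0 // => x _; rewrite scale0r.
rewrite /pencil_block /id_coef /arrow_coef /= xpair_eqE eqxx /= [b' == _]eq_sym.
rewrite [X in _ + X]big1 ?addr0 => [|x _]; last by rewrite andbF scale0r.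
case: (d' =P b') => [->|_]; last by rewrite scale0r if_same mulmx0.
rewrite (introT eqP e) scale1r trmx_mul trmxK tr_pid_mx pid_mx_1 mulmx1.
by congr (_ *m pid_mx _); rewrite e.
Qed.

Lemma pencil_arrow b b' (x : arrow (src b) (tgt b')) u : u \in U ->
  inj b' (B x *m (submxrow u b)^T) \in V.
Proof.
move=> /(UV (b, b', Some (pack x))); congr (_ \in V); apply/mxrowP => d'.
rewrite mul_pencil block_injectionE (bigD1 b) //= big1 ?addr0 => [|d ne]; last first.
  rewrite /pencil_block /id_coef /arrow_coef /= xpair_eqE [b == d]eq_sym (negPf ne) /=.
  by rewrite scale0r if_same add0r big1 ?mulmx0 // => z _; rewrite scale0r.
rewrite /pencil_block /id_coef /arrow_coef /= xpair_eqE eqxx /= [b' == _]eq_sym.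
rewrite andbF scale0r if_same add0r.
case: (d' =P b') => [->|_]; last by rewrite big1 ?mulmx0 // => z _; rewrite scale0r.
rewrite (bigD1 x) //= big1 ?addr0 => [|z ne]; last first.
  by rewrite (inj_eq Some_inj) (inj_eq (@pack_inj _ _)) eq_sym (negPf ne) scale0r.
by rewrite eqxx scale1r trmx_mul trmxK pid_mx_1 mulmx1.
Qed.

Lemma site_projection_ex (b : 'I_#|copies a|) i :
  exists g : 'Hom('rV[k]_N1, 'cV[k]_(alpha i)),
    forall u, g u = pid_mx (alpha i) *m (submxrow u b)^T.
Proof.
apply: linear_lfun => t x y; rewrite scalemxAr -mulmxDr; congr (_ *m _).
by apply/matrixP => r s; rewrite !mxE.
Qed.

Definition site_projection b i := projT1 (cid (site_projection_ex b i)).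

Lemma site_projectionE b i u :
  site_projection b i u = pid_mx (alpha i) *m (submxrow u b)^T.
Proof. by rewrite /site_projection; case: cid => g /= ->. Qed.

Lemma arrow_map_ex i j (x : arrow i j) : exists g : 'Hom('cV[k]_(alpha i), 'cV[k]_(alpha j)),
  forall v, g v = B x *m v.
Proof. by apply: linear_lfun => t y z; rewrite mulmxDr scalemxAr. Qed.

Definition arrow_map i j (x : arrow i j) := projT1 (cid (arrow_map_ex x)).

Lemma arrow_mapE i j (x : arrow i j) v : arrow_map x v = B x *m v.
Proof. by rewrite /arrow_map; case: cid => g /= ->. Qed.

Definition trace i : {vspace 'cV[k]_(alpha i)} :=
  (\sum_(b | src b == i) site_projection b i @: U)%VS.

(** Identity and arrow labels act independently on every target copy, so [V] contains this space at
    each of the [c] copies of [j]. *)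
Definition trace_closure j : {vspace 'cV[k]_(alpha j)} :=
  (trace j + \sum_i \sum_(x : arrow i j) arrow_map x @: trace i)%VS.

Lemma mem_trace b u : u \in U -> (submxrow u b)^T \in trace (src b).
Proof.
move=> uU; have /subvP : (site_projection b (src b) @: U <= trace (src b))%VS.
  by apply: (sumv_sup b).
by apply; rewrite -[_^T]mul1mx -pid_mx_1 -site_projectionE memv_img.
Qed.

Lemma traceP i v : v \in trace i -> exists2 u, (forall b, u b \in U) &
  v = \sum_(b | src b == i) pid_mx (alpha i) *m (submxrow (u b) b)^T.
Proof.
case/memv_sumP=> w hw ->.
have /choice[u hu] b : exists u, u \in U /\ (src b == i -> w b = site_projection b i u).
  case: (boolP (src b == i)) => [h|_]; last by exists 0; rewrite mem0v.
  by have /memv_imgP[u uU ->] := hw b h; exists u.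
exists u => [b|]; first by case: (hu b).
by apply: eq_bigr => b h; case: (hu b) => _ /(_ h) ->; rewrite site_projectionE.
Qed.

Lemma block_trace_closure b' v : v \in trace_closure (tgt b') -> inj b' v \in V.
Proof.
case/memv_addP=> v1 h1 [v2 h2 ->]; rewrite linearD memvD //.
  have [u uU ->] := traceP h1; rewrite linear_sum rpred_sum // => b /eqP e.
  exact: pencil_id.
have /memv_sumP[w hw ->] := h2; rewrite linear_sum rpred_sum // => i _.
have /memv_sumP[w' hw' ->] := hw i isT; rewrite linear_sum rpred_sum // => x _.
have /memv_imgP[z hz ->] := hw' x isT; rewrite arrow_mapE.
have [u uU ->] := traceP hz; rewrite mulmx_sumr linear_sum rpred_sum // => b /eqP e.
case: i / e x {z w' hw' hw w h2 hz} => x; rewrite pid_mx_1 mul1mx.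
exact: pencil_arrow.
Qed.

Hypothesis king : forall Y, rep_sub B Y -> 0 <= \sum_i m i * (\dim (Y i))%:Z.

(** [dim V - dim U] is at least [c] times the total growth from [trace] to [trace_closure], plus [m]
    evaluated on [trace]. Without growth [trace] is a subrepresentation and King's condition
    applies; otherwise the first term is at least [c], which outweighs the second by [c_ge]. *)
Lemma pencil_noshrunk : (\dim U <= \dim V)%N.
Proof.
have [X1 d1 h1] := dim_blocks (fun b => trace (src b)).
have [X2 d2 h2] := dim_blocks (fun b => trace_closure (tgt b)).
have U1 : (U <= X1)%VS by apply/subvP => u uU; apply/h1 => b; apply: mem_trace.
have V2 : (X2 <= V)%VS.
  apply/subvP => u /h2 hu; rewrite (block_injection_sum u) rpred_sum // => b _.
  by apply: block_trace_closure; apply: hu.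
apply: leq_trans (dimvS U1) (leq_trans _ (dimvS V2)); rewrite d1 d2.
rewrite (sum_site a (fun i => \dim (trace i))) (sum_site cc (fun i => \dim (trace_closure i))).
have sub i : (trace i <= trace_closure i)%VS by apply: addvSl.
rewrite -lez_nat !(big_morph Posz PoszD (erefl _)) -subr_ge0 -sumrB.
rewrite (eq_bigr (fun i => c%:Z * (\dim (trace_closure i) - \dim (trace i))%N%:Z +
    m i * (\dim (trace i))%:Z)); last first.
  by move=> i _; rewrite !PoszM aE -subzn ?dimvS //; ring.
rewrite big_split -mulr_sumr /=.
have [/forallP eqd|] := boolP [forall i, \dim (trace i) == \dim (trace_closure i)].
  apply: addr_ge0; first by rewrite mulr_ge0 // sumr_ge0.
  apply: (king (Y := trace)) => i j x v hv.
  have -> : trace j = trace_closure j by apply/eqP; rewrite eqEdim sub -(eqP (eqd j)) leqnn.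
  apply: (subvP (addvSr _ _)); apply: (subvP (sumv_sup i isT (subvv _))).
  by apply: (subvP (sumv_sup x isT (subvv _))); rewrite -arrow_mapE memv_img.
rewrite negb_forall => /existsP[j nej].
have big1 : 1 <= \sum_i (\dim (trace_closure i) - \dim (trace i))%N%:Z.
  rewrite (bigD1 j) //= ler_wpDr ?sumr_ge0 //.
  by rewrite lez_nat subn_gt0 ltn_neqAle nej dimvS.
have : - c%:Z <= \sum_i m i * (\dim (trace i))%:Z.
  rewrite lerNl -sumrN; apply: le_trans c_ge; apply: ler_sum => i _.
  apply: le_trans (ler_norm _) _; rewrite normrN normrM ler_wpM2l //.
  by rewrite lez_nat dim_cv_le.
by move=> h; have := lerD (ler_wpM2l (le0z_nat c) big1) h; rewrite mulr1 subrr.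
Qed.

End Shrunk.

Section Determinant.
Variables (d : nat).

Definition level_pencil (R : comNzRingType) (T : pencil_label -> 'I_d -> 'I_d -> R)
    (C : forall i j : Q, arrow i j -> 'M[R]_(alpha j, alpha i)) :
    'M[R]_(\sum_(p < d) N1, \sum_(o < d) N2) :=
  \mxblock_(p, o) \sum_l T l o p *: pencil C l.

Lemma level_square : (\sum_(p < d) N1 = \sum_(o < d) N2)%N.
Proof. by rewrite pencil_square. Qed.

Definition level_det (R : comNzRingType) T C : R :=
  \det (castmx (erefl, esym level_square) (@level_pencil R T C)).

Lemma map_level_det (R S : comNzRingType) (f : {rmorphism R -> S}) T C :
  f (level_det T C) = level_det (fun l o p => f (T l o p)) (fun i j x => map_mx f (C i j x)).
Proof.
rewrite /level_det det_cast_map; congr (\det (castmx _ _)).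
apply/mxblockP => p o; rewrite mxblockK.
transitivity (map_mx f (submxblock (level_pencil T C) p o)).
  by apply/matrixP => r s; rewrite !mxE.
rewrite mxblockK map_mx_sum; apply: eq_bigr => l _.
by rewrite map_mxZ map_pencil.
Qed.

(** The left factor contributes [det (g i)] to the power [- a i] and the right one to the power [c],
    in total [m i]; the [d] diagonal copies multiply this by [d]. *)
Lemma level_det_act T (g : forall i : Q, 'M[k]_(alpha i)) (C : rep k alpha) :
  (forall i, g i \in unitmx) ->
  level_det T (act g C) = chi (fun i => d%:Z * m i) g * level_det T C.
Proof.
move=> ug; pose D1 := \mxdiag_b (invmx (g (src b)))^T.
pose D2 := \mxdiag_b' (g (tgt b'))^T.
have e : level_pencil T (act g C) =
    (\mxdiag_(p < d) D1) *m level_pencil T C *m (\mxdiag_(o < d) D2).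
  rewrite mul_mxdiag_mxblock mul_mxblock_mxdiag; apply: eq_mxblock => p o.
  rewrite mulmx_sumr mulmx_suml; apply: eq_bigr => l _.
  by rewrite -scalemxAr -scalemxAl pencil_act.
rewrite /level_det e det_cast_mul mulrAC !det_mxdiag !prodr_const !card_ord.
rewrite -exprMn_comm; last exact: mulrC.
congr (_ * _).
rewrite (eq_bigr _ (fun b _ => det_tr _)) [X in _ * X](eq_bigr _ (fun b _ => det_tr _)).
rewrite (prod_site a (fun i => \det (invmx (g i)))) (prod_site cc (fun i => \det (g i))).
rewrite -big_split /chi -prodrXl; apply: eq_bigr => i _ /=.
have gi : \det (g i) != 0 by have := ug i; rewrite unitmxE unitfE.
rewrite det_inv mulrC; have -> : m i = c%:Z - (a i)%:Z by rewrite aE; ring.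
rewrite [d%:Z * _]mulrC -exprz_exp -exprnP; congr (_ ^+ d).
by rewrite expfzDr // -exprnP -exprnN exprVn.
Qed.

End Determinant.

Hypothesis king : forall Y, rep_sub B Y -> 0 <= \sum_i m i * (\dim (Y i))%:Z.

Lemma level_det_neq0 : exists d (T : pencil_label -> 'I_d -> 'I_d -> k),
  (0 < d)%N /\ level_det T B != 0.
Proof.
have [|O [T [O0 inj]]] := nonsingular_pencil char0 (A := pencil B) pencil_square.
  by move=> U V UV; apply: pencil_noshrunk.
exists #|O|, (fun l o p => T l (enum_val o) (enum_val p)); split=> //.
apply: det_cast_neq0 => w; rewrite -{1}[w]submxrowK mul_mxrow_mxblock => h0.
apply/mxrowP => p; rewrite submxrow0.
rewrite -[p]enum_valK; move: (enum_val p) => {}p.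
apply: (inj (fun p => submxrow w (enum_rank p))) => o.
have := congr1 (fun v => submxrow v (enum_rank o)) h0; rewrite mxrowK submxrow0 => {}h0.
rewrite exchange_big -[RHS]h0 (reindex (@enum_rank O)) /=; last exact/onW_bij/enum_rank_bij.
apply: eq_bigr => q _; rewrite mulmx_sumr; apply: eq_bigr => l _.
by rewrite !enum_rankK -scalemxAr.
Qed.

End KingWeights.

Section KingSemistable.
Variables (k : closedFieldType) (Q : double_quiver) (alpha : Q -> nat).
Hypothesis char0 : [pchar k] =i pred0.

Definition generic_rep i j (x : arrow i j) :
    'M[{mpoly k[#|coordinate alpha|]}]_(alpha j, alpha i) :=
  \matrix_(r, s) 'X_(enum_rank (existT _ i (existT _ j (x, r, s)) : coordinate alpha)).

Lemma king_semistable theta (B : rep k alpha) : moment_fibre B ->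
  pairing theta (dim_vector alpha) = 0 ->
  (forall Y, rep_sub B Y -> 0 <= pairing theta (rdim Y)) -> semistable theta B.
Proof.
move=> momB th0 king; split=> //.
have [n [m [n0 mE]]] := common_denominator theta.
have pairm (b : {ffun Q -> int}) : (\sum_i m i * b i)%:~R = n%:R * pairing theta b.
  rewrite rmorph_sum /pairing mulr_sumr; apply: eq_bigr => i _ /=.
  by rewrite intrM mE mulrA.
(* The successor guarantees [m i <= c] even where [alpha i = 0], so the absolute value in [a i]
   changes nothing; [c] also dominates the sum required by [c_ge]. *)
pose c := (\sum_i `|m i| * (alpha i).+1)%N; pose a i := `|c%:Z - m i|%N.
have cE : c%:Z = \sum_i `|m i| * (alpha i).+1%:Z.
  rewrite /c (big_morph Posz PoszD (erefl _)); apply: eq_bigr => i _.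
  by rewrite PoszM abszE.
have aE i : (a i)%:Z = c%:Z - m i.
  rewrite /a abszE ger0_norm // subr_ge0 cE (bigD1 i) //= ler_wpDr //.
    by rewrite sumr_ge0 // => j _; rewrite mulr_ge0.
  by rewrite (le_trans (ler_norm _)) // ler_peMr // lez_nat.
have c_ge : \sum_i `|m i| * (alpha i)%:Z <= c%:Z.
  by rewrite cE ler_sum // => i _; rewrite ler_wpM2l // lez_nat.
have m_alpha : \sum_i m i * (alpha i)%:Z = 0.
  have := pairm (dim_vector alpha); rewrite th0 mulr0 => /eqP; rewrite intr_eq0 => /eqP e.
  by rewrite -[RHS]e; apply: eq_bigr => i _; rewrite ffunE.
have [|d [T [d0 det0]]] := @level_det_neq0 k Q alpha char0 m c a aE c_ge m_alpha B.
  move=> Y /king; rewrite -(ler0z rat) => h.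
  have -> : \sum_i m i * (\dim (Y i))%:Z = \sum_i m i * rdim Y i.
    by apply: eq_bigr => i _; rewrite ffunE.
  by rewrite pairm mulr_ge0.
(* The same determinant at the generic representation is a polynomial, and evaluation commutes with
   determinants. *)
pose f : {mpoly k[#|coordinate alpha|]} :=
  level_det aE m_alpha (fun l o p => (T l o p)%:MP) generic_rep.
have fE (C : rep k alpha) : eval_rep f C = level_det aE m_alpha T C.
  rewrite /eval_rep /f map_level_det; congr level_det.
    by do 3!apply/funext => ?; rewrite /= mevalC.
  do 3!(apply: functional_extensionality_dep => ?); apply/matrixP => r s.
  by rewrite !mxE /= mevalXU enum_rankK.
exists (d * n)%N, (fun i => d%:Z * m i), f; split.
- by rewrite muln_gt0 d0.
- by move=> i; rewrite intrM mE natrM mulrA.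
- by move=> g C ug _; rewrite !fE level_det_act.
by rewrite fE.
Qed.

End KingSemistable.

(** * Polyhedral cones and the fan *)

Section PolyhedralCones.
Variable I : finType.
Implicit Types (sigma Theta : set {ffun I -> rat}) (gamma delta : {ffun I -> int}).
Implicit Types (u v w theta : {ffun I -> rat}).

Lemma pairing_combination n (c : 'I_n -> rat) (v : 'I_n -> {ffun I -> rat}) theta gamma :
  (forall i, theta i = \sum_r c r * v r i) ->
  pairing theta gamma = \sum_r c r * pairing (v r) gamma.
Proof.
move=> h; rewrite /pairing; under [RHS]eq_bigr do rewrite mulr_sumr.
rewrite exchange_big; apply: eq_bigr => i _; rewrite h mulr_suml.
by apply: eq_bigr => r _; rewrite mulrA.
Qed.

Lemma affine_hull_self sigma u : sigma u -> affine_hull sigma u.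
Proof.
move=> su; exists 1%N, (fun=> 1), (fun=> u); split=> //; first by rewrite big_ord1.
by move=> i; rewrite big_ord1 mul1r.
Qed.

Lemma affine_hull_segment sigma u v x : sigma u -> affine_hull sigma v ->
  affine_hull sigma (segment u v x).
Proof.
move=> su [n [c [w [sw c1 e]]]].
exists n.+1, (fun r => if unlift ord0 r is Some s then x * c s else 1 - x),
  (fun r => if unlift ord0 r is Some s then w s else u); split.
- by move=> r; case: unliftP => [s|] _.
- rewrite big_ord_recl unlift_none; under eq_bigr do rewrite liftK.
  by rewrite -mulr_sumr c1 mulr1 subrK.
- move=> i; rewrite ffunE big_ord_recl unlift_none; congr (_ + _).
  rewrite e mulr_sumr; apply: eq_bigr => r _; by rewrite liftK mulrA.
Qed.

Lemma relint_sub sigma : (relint sigma `<=` sigma)%classic.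
Proof. by move=> u []. Qed.

(** The homothety with centre [u] and ratio [x] carries the neighbourhood of [v] of radius [eps] to
    one of radius [x * eps] and stays in the convex cone. *)
Lemma relint_segment Theta sigma u v x : polyhedral_cone Theta sigma ->
  (forall a b y, Theta a -> Theta b -> Theta (segment a b y)) ->
  sigma u -> relint sigma v -> 0 < x <= 1 -> relint sigma (segment u v x).
Proof.
case=> s -> lin [Tu hu] [[Tv hv] [eps eps0 near]] /andP[x0 x1].
set S := (X in relint X).
have conv a b y : S a -> S b -> 0 <= y <= 1 -> S (segment a b y).
  move=> [Ta ha] [Tb hb] /andP[y0 y1]; split; first exact: lin.
  move=> gamma gs; rewrite pairing_segment addr_ge0 // mulr_ge0 ?subr_ge0 //.
    exact: ha.
  exact: hb.
split; first by apply: conv; rewrite ?(ltW x0).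
exists (x * eps) => [|w hw near_w]; first by rewrite mulr_gt0.
have -> : w = segment u (segment u w x^-1) x.
  apply/ffunP => i; rewrite !ffunE; field; exact: lt0r_neq0.
apply: conv; rewrite ?(ltW x0) //.
apply: near => [|i]; first exact: affine_hull_segment.
have -> : segment u w x^-1 i - v i = x^-1 * (w i - segment u v x i).
  rewrite !ffunE; field; exact: lt0r_neq0.
rewrite normrM gtr0_norm ?invr_gt0 // mulrC ltr_pdivrMr // mulrC.
exact: near_w.
Qed.

Lemma polyhedral_closed Theta sigma u v : polyhedral_cone Theta sigma -> Theta u ->
  (forall x, 0 < x <= 1 -> sigma (segment u v x)) -> sigma u.
Proof.
case=> s -> Tu h; split=> // gamma gs; rewrite leNgt; apply/negP => neg.
have [v0|v0] := lerP (pairing v gamma) 0.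
  have [|_ /(_ gamma gs)] := h 2%:R^-1; first by lra.
  by rewrite pairing_segment; lra.
(* At this parameter the value on [gamma] is half of its negative value at [u]. *)
pose x := - pairing u gamma / (2%:R * (pairing v gamma - pairing u gamma)).
have dp : 0 < pairing v gamma - pairing u gamma by rewrite subr_gt0 (lt_trans neg).
have x0 : 0 < x by rewrite divr_gt0 ?mulr_gt0 // oppr_gt0.
have x1 : x <= 1 by rewrite ler_pdivrMr ?mulr_gt0 // mul1r; lra.
have [_ /(_ gamma gs)] := h x (introT andP (conj x0 x1)).
rewrite pairing_segment.
have -> : (1 - x) * pairing u gamma + x * pairing v gamma = pairing u gamma / 2%:R.
  by rewrite /x; field; exact: lt0r_neq0.
by rewrite leNgt pmulr_llt0 // neg.
Qed.

(** A polyhedral cone is the closure of its relative interior once that is inhabited; segments from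
    any point towards [v] show it. *)
Lemma polyhedral_relint_inj Theta sigma sigma' v :
  (forall a b y, Theta a -> Theta b -> Theta (segment a b y)) ->
  polyhedral_cone Theta sigma -> polyhedral_cone Theta sigma' ->
  relint sigma = relint sigma' -> relint sigma v -> sigma = sigma'.
Proof.
move=> lin ps ps' e rv.
have sub s s' : polyhedral_cone Theta s -> polyhedral_cone Theta s' ->
    relint s = relint s' -> relint s v -> (s `<=` s')%classic.
  move=> h h' es hv u su; have Tu : Theta u by case: h su => l -> [].
  apply: (polyhedral_closed (v := v) h' Tu) => x hx.
  by apply: relint_sub; rewrite -es; apply: relint_segment h lin su hv hx.
by apply/seteqP; split; apply: sub; rewrite // -?e.
Qed.

Lemma perp_segment gamma a b y : perp gamma a -> perp gamma b -> perp gamma (segment a b y).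
Proof. by rewrite /perp /= pairing_segment => -> ->; rewrite !mulr0 addr0. Qed.

(** The fan quantifies over all integral [gamma] that cut out a member of the arrangement, not only
    over roots; proportionality on [perp delta] reduces it to roots. *)
Lemma perp_proportional gamma beta delta :
  (perp gamma `&` perp delta = perp beta `&` perp delta)%classic ->
  exists2 c : rat, c != 0 &
    forall theta, perp delta theta -> pairing theta gamma = c * pairing theta beta.
Proof.
move=> e; have same theta : perp delta theta ->
    (pairing theta gamma = 0 <-> pairing theta beta = 0).
  move=> h; have := congr1 (fun X : set _ => X theta) e; rewrite /setI /= => {}e.
  split=> h'.
    by have [] : (perp beta theta /\ perp delta theta) by rewrite -e.
  by have [] : (perp gamma theta /\ perp delta theta) by rewrite e.
(* If [beta] vanishes on [perp delta], then so does [gamma], and any nonzero factor works. *)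
have [all0|] := pselect (forall theta, perp delta theta -> pairing theta beta = 0).
  exists 1 => [|theta h]; first exact: oner_neq0.
  by rewrite mul1r all0 //; apply/same => //; apply: all0.
move/existsNP=> [t1 /not_implyP[h1 /eqP n1]].
have n1' : pairing t1 gamma != 0 by apply: contra n1 => /eqP /(same _ h1) ->.
exists (pairing t1 gamma / pairing t1 beta) => [|theta h].
  by rewrite mulf_neq0 ?invr_eq0.
pose x := pairing theta beta / pairing t1 beta.
pose w := theta + scale_weight (- x) t1.
have dw : perp delta w by rewrite /perp /= pairingDl pairingZl h h1 mulr0 addr0.
have : pairing w beta = 0 by rewrite pairingDl pairingZl /x; field.
move/(same _ dw); rewrite pairingDl pairingZl /x => /eqP.
rewrite mulNr subr_eq0 => /eqP ->; field; exact: n1.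
Qed.

End PolyhedralCones.

(** * GIT classes and faces of the arrangement *)

Section Chambers.
Variables (k : closedFieldType) (Q : double_quiver) (alpha : Q -> nat).
Hypothesis char0 : [pchar k] =i pred0.
Hypothesis sigma0 : Sigma0 (dim_vector alpha).
Hypothesis indiv : indivisible alpha.
Local Notation al := (dim_vector alpha).
Local Notation Theta := (stability_space alpha).
Implicit Types (t theta : {ffun Q -> rat}) (b : {ffun Q -> int}).

Definition wall b : Prop := pos_root b /\ pos_root (al - b).

Lemma wall_bounds b : wall b -> forall i, 0 <= b i <= (alpha i)%:Z.
Proof.
by case=> -[_ h] [_ h'] i; have := h' i; rewrite !ffunE subr_ge0 h.
Qed.

Lemma semistableP theta (B : rep k alpha) : Theta theta ->
  semistable theta B <-> moment_fibre B /\
    forall b, rep_has_sub B b -> 0 <= pairing theta b.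
Proof.
move=> th; split=> [sB|[mB h]].
  by split=> [|_ [Y sY ->]]; [case: sB | apply: semistable_rep_sub sB sY].
by apply: king_semistable => // Y sY; apply: h; exists Y.
Qed.

Definition same_face t t' : Prop :=
  forall b, wall b -> Num.sg (pairing t b) = Num.sg (pairing t' b).

(** King's criterion expresses semistability at a point of the zero fibre by its subrepresentations;
    passing between such points and subquotient representations of dimension [al] reduces the claim
    to the comparison of weights on walls. *)
Lemma git_equivalence t t' : Theta t -> Theta t' ->
  semistable t = semistable t' :> set (rep k alpha) <-> same_face t t'.
Proof.
move=> tt tt'; have star := Sigma0_parts_negative sigma0 indiv.
split=> [e b [rb rc]|same].
  apply: (@same_semi_same_face k Q al star) => // M dM.
  have [B mB sub] := rep_of_qrep dM.
  have hB u : Theta u -> semi u M <-> semistable u B.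
    move=> hu; rewrite semistableP // /semi dM; split=> [[_ h]|[_ h]]; split=> // c.
      by move/sub/h.
    by move/sub/h.
  by rewrite !hB // e.
have half u u' (B : rep k alpha) : Theta u -> Theta u' -> same_face u u' ->
    semistable u B -> semistable u' B.
  move=> hu hu' suu /semistableP[] // mB h; apply/(semistableP _ hu'); split=> // c.
  have [M dM sub] := qrep_of_rep mB.
  have su : semi u M by split=> [|x /sub/h //]; rewrite dM; exact: hu.
  have same' b : pos_root b -> pos_root (al - b) ->
    Num.sg (pairing u b) = Num.sg (pairing u' b) by move=> rb rc; apply: suu.
  have [_ h'] := same_face_semi star hu' same' dM su.
  by move=> /sub/h'.
apply/seteqP; split=> B; first exact: half.
by apply: half => // b wb; rewrite same.
Qed.

Definition wall_cone t : set {ffun Q -> rat} :=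
  [set theta | Theta theta /\ forall b, wall b ->
    (0 <= pairing t b -> 0 <= pairing theta b) /\
    (pairing t b <= 0 -> pairing theta b <= 0)].

Lemma arrangement_cone t : Theta t ->
  (Theta `&` [set theta | forall gamma, root_arrangement alpha (perp gamma `&` Theta) ->
      0 <= pairing t gamma -> 0 <= pairing theta gamma])%classic = wall_cone t.
Proof.
move=> tt; apply/seteqP; split=> theta [hth h]; split=> //.
  move=> b [rb rc]; split; first by apply: h; exists b.
  have := h (- b); rewrite !pairingNr !oppr_ge0; apply; exists b; split=> //.
  congr (_ `&` _)%classic; apply/seteqP; split=> u; rewrite /perp /= pairingNr => /eqP.
    by rewrite oppr_eq0 => /eqP.
  by move/eqP->; rewrite oppr0.
move=> gamma [b [rb rc /perp_proportional[c c0 e]]].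
have [h1 h2] := h b (conj rb rc).
rewrite !e //; case: (ltrgtP c 0) c0 => // c0 _.
  by rewrite !nmulr_rge0.
by rewrite !pmulr_rge0.
Qed.

(** Walls are bounded by [alpha], so a finite box lists them; negated vectors encode the opposite
    half-spaces. *)
Lemma wall_cone_polyhedral t : polyhedral_cone Theta (wall_cone t).
Proof.
pose N := (\sum_i alpha i)%N.
pose vec (x : {ffun Q -> 'I_N.+1}) : {ffun Q -> int} := [ffun i => (x i)%:Z].
have vecP b : wall b -> exists x, b = vec x.
  move=> /wall_bounds h; exists [ffun i => inord `|b i|%N]; apply/ffunP => i.
  have /andP[b0 b1] := h i; rewrite !ffunE inordK ?gez0_abs //.
  have : (alpha i <= N)%N by rewrite /N (bigD1 i) //= leq_addr.
  by move: b0 b1; lia.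
exists ([seq vec x | x <- enum {ffun Q -> 'I_N.+1} & `[< wall (vec x) >] && (0 <= pairing t (vec x))]
  ++ [seq - vec x | x <- enum {ffun Q -> 'I_N.+1} & `[< wall (vec x) >] && (pairing t (vec x) <= 0)]).
apply/seteqP; split=> theta [hth h]; split=> //.
  move=> gamma; rewrite mem_cat => /orP[] /mapP[x]; rewrite mem_filter => /andP[/andP[/asboolP w s] _] ->.
    by have [h1 _] := h _ w; apply: h1.
  by have [_ h1] := h _ w; rewrite pairingNr oppr_ge0; apply: h1.
move=> b wb; have [x eb] := vecP b wb; split=> s.
  apply: h; rewrite mem_cat; apply/orP; left; apply/mapP; exists x => //.
  by rewrite mem_filter mem_enum andbT -eb s andbT; apply/asboolP.
rewrite -oppr_ge0 -pairingNr; apply: h; rewrite mem_cat; apply/orP; right.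
apply/mapP; exists x; last by rewrite eb.
by rewrite mem_filter mem_enum andbT -eb s andbT; apply/asboolP.
Qed.

Lemma wall_cone_self t : Theta t -> wall_cone t t.
Proof. by split. Qed.

Lemma wall_cone_relint t : Theta t ->
  relint (wall_cone t) = [set theta | Theta theta /\ same_face theta t]%classic.
Proof.
move=> tt; have self := wall_cone_self tt.
apply/seteqP; split=> theta.
  move=> [[hth h] [eps eps0 near]]; split=> // b wb; have [h1 h2] := h b wb.
  (* Moving slightly past [theta] away from [t] must not leave the cone. *)
  pose M := 1 + \sum_i `|t i - theta i|; have M0 : 0 < M by rewrite ltr_pwDl // sumr_ge0.
  pose d := eps / (2%:R * M); have d0 : 0 < d by rewrite divr_gt0 // mulr_gt0.
  have [_ /(_ b wb)] : wall_cone t (segment t theta (1 + d)).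
    apply: near => [|i].
      by apply: affine_hull_segment => //; apply: affine_hull_self.
    have -> : segment t theta (1 + d) i - theta i = - (d * (t i - theta i)).
      by rewrite ffunE; ring.
    rewrite normrN normrM (gtr0_norm d0) /d mulrAC ltr_pdivrMr ?mulr_gt0 // ltr_pM2l //.
    have : `|t i - theta i| <= \sum_i `|t i - theta i|.
      by rewrite (bigD1 i) //= lerDl sumr_ge0.
    have S0 : 0 <= \sum_i `|t i - theta i| by apply: sumr_ge0.
    by rewrite /M; lra.
  rewrite pairing_segment => -[h3 h4].
  have [z|p|p] := ltrgtP (pairing t b) 0.
  - have := h2 (ltW z); have := h4 (ltW z).
    case: (ltrgtP (pairing theta b) 0) => // [y _ _|-> ]; first by rewrite !ltr0_sg.
    by nra.
  - have := h1 (ltW p); have := h3 (ltW p).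
    case: (ltrgtP (pairing theta b) 0) => // [y _ _|-> ]; first by rewrite !gtr0_sg.
    by nra.
  - move: h1 h2; rewrite p lexx => /(_ isT) h1 /(_ isT) h2.
    by congr Num.sg; apply/eqP; rewrite eq_le h1 h2.
move=> [hth same].
have sgn_ge b : wall b -> (0 <= pairing theta b) = (0 <= pairing t b).
  by move=> wb; rewrite -[LHS]sgr_ge0 same // sgr_ge0.
have sgn_le b : wall b -> (pairing theta b <= 0) = (pairing t b <= 0).
  by move=> wb; rewrite -[LHS]sgr_le0 same // sgr_le0.
split; first by split=> // b wb; rewrite sgn_ge // sgn_le.
have [n [m [n0 mE]]] := common_denominator theta.
have n0' : 0 < n%:R :> rat by rewrite ltr0n.
have int_pairing b : exists z : int, n%:R * pairing theta b = z%:~R.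
  exists (\sum_i m i * b i); rewrite rmorph_sum /pairing mulr_sumr.
  by apply: eq_bigr => i _ /=; rewrite intrM mE mulrA.
pose M : rat := 1 + \sum_i (alpha i)%:R.
have M0 : 0 < M by rewrite ltr_pwDl // sumr_ge0.
(* With [n] a common denominator of [theta], nonzero values on walls are at least [1 / n], and a
   move within this radius changes a value by less than that. Walls through [theta] contain the
   whole cone, hence its affine hull. *)
exists (n%:R * M)^-1 => [|u [l [c [v [hv c1 hu]]]] near].
  by rewrite invr_gt0 mulr_gt0.
have uE gamma := pairing_combination gamma hu.
have zero gamma : (forall r, pairing (v r) gamma = 0) -> pairing u gamma = 0.
  by move=> h; rewrite uE big1 // => r _; rewrite h mulr0.
have close b : wall b -> `|pairing u b - pairing theta b| < n%:R^-1.
  move=> wb; have -> : pairing u b - pairing theta b = \sum_i (u i - theta i) * (b i)%:~R.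
    by rewrite /pairing -sumrB; apply: eq_bigr => i _; rewrite mulrBl.
  apply: le_lt_trans (ler_norm_sum _ _ _) _.
  apply: (@le_lt_trans _ _ ((n%:R * M)^-1 * (M - 1))); last first.
    rewrite invfM -mulrA gtr_pMr ?invr_gt0 // mulrBr mulVf ?gt_eqF // mulr1.
    by rewrite ltrBlDr ltrDl invr_gt0.
  have -> : M - 1 = \sum_i (alpha i)%:R by rewrite /M addrC addKr.
  rewrite mulr_sumr; apply: ler_sum => i _; rewrite normrM ler_pM //.
    exact/ltW/near.
  have /andP[b0 b1] := wall_bounds wb i.
  rewrite ger0_norm ?ler0z // -[leRHS]/((alpha i)%:Z%:~R) ler_int //.
have keep b : wall b -> pairing theta b != 0 ->
    n%:R^-1 <= `|pairing theta b|.
  move=> wb ne; rewrite -(ler_pM2l n0') mulfV ?gt_eqF // -{1}(gtr0_norm n0') -normrM.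
  have [z e] := int_pairing b; rewrite e -intr_norm -[1]/(1%:~R) ler_int.
  have : z != 0 by apply: contraNneq ne => z0; move/eqP: e; rewrite z0 mulf_eq0 gt_eqF.
  lia.
split.
  by apply: zero => r; case: (hv r).
move=> b wb; rewrite -sgn_ge // -sgn_le //.
have [e|ne] := eqVneq (pairing theta b) 0.
  have -> : pairing u b = 0.
    apply: zero => r; have [_ /(_ b wb)[]] := hv r.
    rewrite -sgn_ge // -sgn_le // e lexx => /(_ isT) h1 /(_ isT) h2.
    by apply/eqP; rewrite eq_le h1 h2.
  by [].
have := lt_le_trans (close b wb) (keep b wb ne).
move: (pairing u b) (pairing theta b) => x y; rewrite ltr_norml => /andP[].
by case: (ger0P y) => h h1 h2; split; lra.
Qed.

End Chambers.

Theorem theorem4p18 (k : closedFieldType) (hk : [pchar k]%R =i pred0)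
  (Q : double_quiver) (alpha : Q -> nat)
  (halpha : Sigma0 (dim_vector alpha)) (hindiv : indivisible alpha) :
  git_fan k alpha =
  arrangement_fan (stability_space alpha) (root_arrangement alpha).
Proof.
set Theta := stability_space alpha.
have lin : forall u v y, Theta u -> Theta v -> Theta (segment u v y).
  exact: perp_segment.
(* GIT classes are the relative interiors of wall cones, as both are described by the signs on all
   walls. *)
have gitE t : Theta t -> [set theta | Theta theta /\
    semistable theta = semistable t :> set (rep k alpha)]%classic = relint (wall_cone alpha t).
  move=> tt; rewrite wall_cone_relint //; apply/seteqP; split=> u [hu h]; split=> //.
    exact/(git_equivalence hk halpha hindiv).
  exact/(git_equivalence hk halpha hindiv).
apply/seteqP; split=> sigma.
  case=> ps [t tt e]; exists t => //; rewrite arrangement_cone //.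
  (* The weight [t] lies in its own class, so the common relative interior is inhabited and
     determines the cone. *)
  apply: (polyhedral_relint_inj (v := t) lin ps (wall_cone_polyhedral alpha t)).
    by rewrite e gitE.
  by rewrite e.
case=> t tt; rewrite arrangement_cone // => ->; split; first exact: wall_cone_polyhedral.
by exists t => //; rewrite gitE.
Qed.
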